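(* Consider the D-ASG iterates $x^{(k+1)}=\mathcal{W}y^{(k)}-\alpha\tilde\nabla F(y^{(k)})$, $y^{(k)}=(1+\beta)x^{(k)}-\beta x^{(k-1)}$, $k\ge 0$, with $0<\alpha\le\min\left\{\frac{1}{L+\mu},\frac{\lambda_N^W}{L}\right\}$, $\beta=\frac{1-\sqrt{\alpha\mu}}{1+\sqrt{\alpha\mu}}$ and initialization $x^{(0)}=x^{(-1)}=0$, and the node averages $\bar x^{(k)}=\frac1N\sum_{i=1}^Nx_i^{(k)}$. There is a positive constant $C_0$, independent of $k$ and satisfying $C_0=\mathcal{O}(1)$ as $\alpha\to0$ (all other data fixed), such that for any $k\ge 0$, $$\begin{aligned}\mathbb{E}\|\bar x^{(k)}-x_*\|^2\le\;&\left(1-\tfrac{\sqrt{\alpha\mu}}{2}\right)^k\frac{2V_{\bar S,\alpha}(\bar\xi_0)}{\mu}+\frac{8}{\gamma^2\mu\sqrt\mu}\sqrt\alpha\,H_1H_3\,\frac{\gamma^{2k}-(1-\sqrt{\alpha\mu}/2)^k}{\gamma^2-(1-\sqrt{\alpha\mu}/2)}+\frac{2}{\mu^2}\alpha H_1H_2\\&+\frac{2\sigma^2\sqrt\alpha}{\mu\sqrt\mu N}\left(1+\tfrac{\sqrt{\alpha\mu}}{2}\right)(1+\alpha L),\end{aligned}$$ and for every $i=1,\dots,N$ and any $k\ge 0$, $$\begin{aligned}\mathbb{E}\|x_i^{(k)}-x_*\|^2\le\;&\left(1-\tfrac{\sqrt{\alpha\mu}}{2}\right)^k\frac{4V_{\bar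 S,\alpha}(\bar\xi_0)}{\mu}+\frac{16}{\gamma^2\mu\sqrt\mu}\sqrt\alpha\,H_1H_3\,\frac{\gamma^{2k}-(1-\sqrt{\alpha\mu}/2)^k}{\gamma^2-(1-\sqrt{\alpha\mu}/2)}+\frac{4}{\mu^2}\alpha H_1H_2\\&+16\gamma^{2k}\left(\frac{4V_{S,\alpha}(\xi_0)}{\mu}+\frac{2\sigma^2N\sqrt\alpha}{\mu\sqrt\mu}(2-\lambda_N^W+\alpha L)+\frac{2C_1^2N\alpha^2}{(1-\gamma)^2}+\|x^*\|^2\right)\\&+\frac{8D_y^2\alpha^2}{(1-\gamma)^2}+\frac{8\sigma^2N\alpha^2}{(1-\gamma)^2}+\frac{16C_0\alpha}{(1-\gamma)^2}+\frac{4\sigma^2\sqrt\alpha}{\mu\sqrt\mu N}\left(1+\tfrac{\sqrt{\alpha\mu}}{2}\right)(1+\alpha L),\end{aligned}$$ where $$D_y^2:=4L^2\left((1+\beta)^2+\beta^2\right)\left(\frac{4V_{S,\alpha}(\xi_0)}{\mu}+\frac{2\sigma^2N\sqrt\alpha}{\mu\sqrt\mu}(2-\lambda_N^W+\alpha L)+\frac{2C_1^2N\alpha^2}{(1-\gamma)^2}\right)+2\|\nabla F(x^* )\|^2,$$ $$H_1:=8\left(1+\tfrac{\mu\alpha}{2}-\sqrt{\alpha\mu}\right)+\frac{2L^2\alpha}{\mu}+(L\alpha+2+\mu\alpha)\sqrt{\alpha\mu}-2\mu\alpha,$$ $$H_2:=\frac2NL^2\left((1+\beta)^2+\beta^2\right)\left(\frac{4D_y^2\alpha}{(1-\gamma)^2}+\frac{4\sigma^2N\alpha}{(1-\gamma)^2}+\frac{8C_0}{(1-\gamma)^2}\right),$$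 $$H_3:=\frac2NL^2\left((1+\beta)^2+\beta^2\right)\left(\frac{4V_{S,\alpha}(\xi_0)}{\mu}+\frac{2\sigma^2N\sqrt\alpha}{\mu\sqrt\mu}(2-\lambda_N^W+\alpha L)+\frac{2C_1^2N\alpha^2}{(1-\gamma)^2}+\|x^*\|^2\right).$$ (If $\gamma^2=1-\sqrt{\alpha\mu}/2$, the quotient with that denominator is read as its limiting value $k\gamma^{2(k-1)}$.)
   Context: Functions: $f_1,\dots,f_N:\mathbb{R}^d\to\mathbb{R}$ are each $\mu$-strongly convex with $L$-Lipschitz gradient ($0<\mu\le L$). $f=\frac1N\sum_{i=1}^N f_i$ with unique minimizer $x_*\in\mathbb{R}^d$; $x^*=[x_*^T,\dots,x_*^T]^T\in\mathbb{R}^{Nd}$. $F:\mathbb{R}^{Nd}\to\mathbb{R}$, $F(x_1,\dots,x_N)=\sum_{i=1}^N f_i(x_i)$. Network: $(\mathcal V,\mathcal E)$ is a connected undirected graph on $\{1,\dots,N\}$; $W$ is a symmetric doubly stochastic $N\times N$ matrix with, for $i\ne j$, $W_{ij}>0$ if $(i,j)\in\mathcal E$ and $W_{ij}=0$ otherwise, and $W_{ii}=1-\sum_{j\neq i}W_{ij}>0$. Its eigenvalues are $1=\lambda_1^W>\lambda_2^W\ge\cdots\ge\lambda_N^W$, and it is assumed that $\lambda_N^W>0$. $\gamma:=\max\{|\lambda_2^W|,|\lambda_N^W|\}$; $\mathcal{W}:=W\otimes I_d$. Iterates: $x^{(k)},y^{(k)}\in\mathbb{R}^{Nd}$ stack the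 node variables $x_i^{(k)},y_i^{(k)}\in\mathbb{R}^d$; $\tilde\nabla F(y^{(k)})$ stacks the stochastic gradients $\tilde\nabla f_i(y_i^{(k)})=\tilde\nabla f_i(y_i^{(k)},w_i^{(k)})$. Noise: $w_i^{(k)}$ is a random variable independent of all $w_j^{(t)}$ with $t<k$ and of $w_j^{(k)}$, $j\neq i$, and $\mathbb{E}[\tilde\nabla f_i(y_i^{(k)},w_i^{(k)})\,|\,y_i^{(k)}]=\nabla f_i(y_i^{(k)})$, $\mathbb{E}[\|\tilde\nabla f_i(y_i^{(k)},w_i^{(k)})-\nabla f_i(y_i^{(k)})\|^2\,|\,y_i^{(k)}]\le\sigma^2$. Penalized objective: $F_{\mathcal W,\alpha}(x):=\frac{1}{2\alpha}x^T(I_{Nd}-\mathcal W)x+F(x)$, with unique minimizer $x^\infty\in\mathbb{R}^{Nd}$. Lyapunov functions: let $\tilde S_\alpha=vv^T$, $v=\left[\frac{1}{\sqrt{2\alpha}},\ \sqrt{\frac{\mu}{2}}-\sqrt{\frac{1}{2\alpha}}\right]^T$. For $\xi\in\mathbb{R}^{2Nd}$, $V_{S,\alpha}(\xi):=\xi^T(\tilde S_\alpha\otimes I_{Nd})\xi+F_{\mathcal W,\alpha}(T\xi+x^\infty)-F_{\mathcal W,\alpha}(x^\infty)$ with $T=[1\ \ 0]\otimes I_{Nd}$, and $\xi_0=[(x^{(0)}-x^\infty)^T,(x^{(-1)}-x^\infty)^T]^T$. For $\bar\xi\in\mathbb{R}^{2d}$, $V_{\bar S,\alpha}(\bar\xi):=\bar\xi^T(\tilde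 S_\alpha\otimes I_d)\bar\xi+f(\bar T\bar\xi+x_* )-f(x_* )$ with $\bar T=[1\ \ 0]\otimes I_d$, and $\bar\xi_0=[(\bar x^{(0)}-x_* )^T,(\bar x^{(-1)}-x_* )^T]^T$. Constant: $C_1:=\sqrt{2L\sum_{i=1}^N(f_i(0)-f_i^* )}\cdot\left(1+\frac{2(L+\mu)}{\mu}\right)$ with $f_i^*:=\min_{x\in\mathbb{R}^d}f_i(x)$. *)

(* Defs.v *)
From HB Require Import structures.
From mathcomp Require Import all_boot all_order all_algebra.
From mathcomp Require Import all_classical all_reals all_analysis.
Set Implicit Arguments.
Unset Strict Implicit.
Unset Printing Implicit Defensive.
Import Order.TTheory GRing.Theory Num.Theory.
Import numFieldNormedType.Exports.
Local Open Scope classical_set_scope.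
Local Open Scope ring_scope.

(* Encoding of stacked vectors: [x_1^T, ..., x_N^T]^T in R^{Nd} is the matrix
   X : 'M[R]_(N, d) whose i-th row is x_i.  Block i of (W (x) I_d) x is
   \sum_j W_ij x_j, that is row i of W *m X, so W (x) I_d acts as W *m _. *)

Section euclidean.
Context {R : realType}.

(* The library norm `|x| on matrices is the sup norm; these are the Euclidean
   (Frobenius) inner product, squared norm and norm. *)
Definition dotmx m n (A B : 'M[R]_(m, n)) : R := \sum_i \sum_j A i j * B i j.
Definition sqnorm m n (A : 'M[R]_(m, n)) : R := dotmx A A.
Definition norm2 m n (A : 'M[R]_(m, n)) : R := Num.sqrt (sqnorm A).

Definition grad m n (h : 'M[R]_(m, n) -> R) (x : 'M[R]_(m, n)) : 'M[R]_(m, n) :=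
  \matrix_(i, j) 'D_(delta_mx i j) h x.

Definition strongly_convex m n (mu : R) (h : 'M[R]_(m, n) -> R) : Prop :=
  forall (x y : 'M[R]_(m, n)) (t : R), 0 <= t <= 1 ->
    h (t *: x + (1 - t) *: y) <=
      t * h x + (1 - t) * h y - mu / 2 * (t * (1 - t)) * sqnorm (x - y).

Definition lipschitz_gradient m n (L : R) (h : 'M[R]_(m, n) -> R) : Prop :=
  (forall x, differentiable h x) /\
  (forall x y, norm2 (grad h x - grad h y) <= L * norm2 (x - y)).

Definition unique_minimizer (U : Type) (h : U -> R) (x : U) : Prop :=
  forall y, y <> x -> h x < h y.

Definition is_minimum (U : Type) (h : U -> R) (m : R) : Prop :=
  (exists x, h x = m) /\ (forall x, m <= h x).

(* xi^T (S (x) I) xi for xi = [u^T, v^T]^T. *)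
Definition quad_blocks m n (S : 'M[R]_2) (u v : 'M[R]_(m, n)) : R :=
  S 0 0 * dotmx u u + S 0 1 * dotmx u v + S 1 0 * dotmx v u + S 1 1 * dotmx v v.

End euclidean.

Section network.
Context {R : realType} (N : nat).

Definition connected_graph (E : rel 'I_N) : Prop :=
  symmetric E /\ (forall i j, connect E i j).

Definition doubly_stochastic (W : 'M[R]_N) : Prop :=
  [/\ forall i j, 0 <= W i j,
      forall i, \sum_j W i j = 1 &
      forall j, \sum_i W i j = 1].

Definition mixing_matrix (E : rel 'I_N) (W : 'M[R]_N) : Prop :=
  [/\ W^T = W,
      doubly_stochastic W,
      forall i j, i != j -> E i j -> 0 < W i j,
      forall i j, i != j -> ~~ E i j -> W i j = 0 &
      forall i, W i i = 1 - \sum_(j | j != i) W i j /\ 0 < W i i].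

(* The eigenvalues with multiplicity, in nonincreasing order: the k-th largest
   eigenvalue is lam`_(k - 1). *)
Definition spectrum (W : 'M[R]_N) (lam : seq R) : Prop :=
  char_poly W = \prod_(a <- lam) ('X - a%:P) /\ sorted (fun a b => b <= a) lam.

End network.

Section objectives.
Context {R : realType} (N d : nat).
Implicit Types (f : 'I_N -> 'rV[R]_d -> R) (X : 'M[R]_(N, d)).

Definition avg_fun f (x : 'rV[R]_d) : R := N%:R^-1 * \sum_i f i x.

Definition sum_fun f X : R := \sum_i f i (row i X).

Definition node_avg X : 'rV[R]_d := N%:R^-1 *: \sum_i row i X.

Definition replicate (x : 'rV[R]_d) : 'M[R]_(N, d) := \matrix_(i, j) x 0 j.

Definition penalized f (W : 'M[R]_N) (alpha : R) X : R :=
  1 / (2 * alpha) * dotmx X ((1%:M - W) *m X) + sum_fun f X.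

Definition Svec (mu alpha : R) : 'cV[R]_2 :=
  \col_i (if i == 0 then 1 / Num.sqrt (2 * alpha)
          else Num.sqrt (mu / 2) - Num.sqrt (1 / (2 * alpha))).
Definition Smat (mu alpha : R) : 'M[R]_2 := Svec mu alpha *m (Svec mu alpha)^T.

(* V_{S,alpha} at xi = [u^T, v^T]^T in R^{2Nd}. *)
Definition lyapunov f (W : 'M[R]_N) (mu alpha : R) (xinf u v : 'M[R]_(N, d)) : R :=
  quad_blocks (Smat mu alpha) u v +
  penalized f W alpha (u + xinf) - penalized f W alpha xinf.

(* V_{\bar S,alpha} at \bar xi = [u^T, v^T]^T in R^{2d}. *)
Definition lyapunov_avg f (mu alpha : R) (xstar u v : 'rV[R]_d) : R :=
  quad_blocks (Smat mu alpha) u v + avg_fun f (u + xstar) - avg_fun f xstar.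

End objectives.

Section algorithm.
Context {R : realType} (N d : nat).
Implicit Types (W : 'M[R]_N) (G : nat -> 'M[R]_(N, d) -> 'M[R]_(N, d)).

Definition extrapolate (beta : R) (s : 'M[R]_(N, d) * 'M[R]_(N, d)) :=
  (1 + beta) *: s.1 - beta *: s.2.

(* The pair (x^(k), x^(k-1)); [init] is (x^(0), x^(-1)) and [G k] is the
   gradient oracle called at step k. *)
Fixpoint dasg_state W (alpha beta : R) (init : 'M[R]_(N, d) * 'M[R]_(N, d)) G
    (k : nat) : 'M[R]_(N, d) * 'M[R]_(N, d) :=
  if k is k'.+1 then
    let s := dasg_state W alpha beta init G k' in
    let y := extrapolate beta s in
    (W *m y - alpha *: G k' y, s.1)
  else init.

Definition dasg_x W alpha beta init G k : 'M[R]_(N, d) :=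
  (dasg_state W alpha beta init G k).1.

Definition dasg_y W alpha beta init G k : 'M[R]_(N, d) :=
  extrapolate beta (dasg_state W alpha beta init G k).

End algorithm.

Section noise.
Context {R : realType} (N d : nat).
Context {dT dZ : measure_display} {T : measurableType dT} {Z : measurableType dZ}.
Context (P : probability T R).

(* These sets generate the Borel sigma-algebra of R^d. *)
Definition coord_cylinders : set (set 'rV[R]_d) :=
  \bigcup_j preimage_set_system setT (fun v : 'rV[R]_d => v 0 j) measurable.

Definition measurable_oracle (g : 'rV[R]_d -> Z -> 'rV[R]_d) : Prop :=
  forall j, measurable_fun setT
    (fun p : g_sigma_algebraType coord_cylinders * Z => g p.1 p.2 0 j).

(* sigma(Y) for a random vector Y. *)
Definition sigma_of (Y : T -> 'rV[R]_d) : set (set T) :=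
  g_sigma_preimage (fun (j : 'I_d) (omega : T) => Y omega 0 j).

(* Y is a version of the conditional expectation of X given the
   sigma-algebra G. *)
Definition is_cond_expectation (G : set (set T)) (X Y : T -> R) : Prop :=
  [/\ P.-integrable setT (EFin \o X),
      P.-integrable setT (EFin \o Y),
      preimage_set_system setT Y measurable `<=` G &
      forall A, G A ->
        (\int[P]_(omega in A) (X omega)%:E = \int[P]_(omega in A) (Y omega)%:E)%E].

(* w_i^(k) is independent of the whole family made of the w_j^(t), t < k, and
   of the w_j^(k), j <> i. *)
Definition independent_noise (w : 'I_N -> nat -> {RV P >-> Z}) : Prop :=
  forall (i : 'I_N) (k : nat) (B : set Z) (A : set T),
    measurable B ->
    <<s \bigcup_(p in [set p : 'I_N * nat | (p.2 < k)%N \/ p.2 = k /\ p.1 <> i])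
          preimage_set_system setT (w p.1 p.2) measurable >> A ->
    P ((w i k @^-1` B) `&` A) = (P (w i k @^-1` B) * P A)%E.

Definition stack_oracle (g : 'I_N -> 'rV[R]_d -> Z -> 'rV[R]_d)
    (w : 'I_N -> nat -> {RV P >-> Z}) (omega : T) (k : nat) (Y : 'M[R]_(N, d)) :
    'M[R]_(N, d) :=
  \matrix_(i, j) g i (row i Y) (w i k omega) 0 j.

(* E[g_i(y_i^(k), w_i^(k)) | y_i^(k)] = grad f_i (y_i^(k)) and
   E[|g_i(y_i^(k), w_i^(k)) - grad f_i (y_i^(k))|^2 | y_i^(k)] <= sigma^2 a.s. *)
Definition unbiased_bounded_variance (f : 'I_N -> 'rV[R]_d -> R)
    (g : 'I_N -> 'rV[R]_d -> Z -> 'rV[R]_d) (w : 'I_N -> nat -> {RV P >-> Z})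
    (sigma : R) (y : 'I_N -> nat -> T -> 'rV[R]_d) : Prop :=
  (forall i k j, is_cond_expectation (sigma_of (y i k))
     (fun omega => g i (y i k omega) (w i k omega) 0 j)
     (fun omega => grad (f i) (y i k omega) 0 j)) /\
  (forall i k, exists V : T -> R,
     is_cond_expectation (sigma_of (y i k))
       (fun omega => sqnorm (g i (y i k omega) (w i k omega)
                             - grad (f i) (y i k omega))) V /\
     {ae P, forall omega, V omega <= sigma ^+ 2}).

End noise.

(* (a^k - b^k) / (a - b), extended by its limit k a^(k-1) when a = b. *)
Definition geom_quotient {R : realType} (a b : R) (k : nat) : R :=
  if a == b then k%:R * a ^+ k.-1 else (a ^+ k - b ^+ k) / (a - b).

(* Main.v *)
(* Put s = sqrt (alpha mu).  One step x+ = y - alpha (G y + xi) of accelerated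
   gradient descent on an objective phi contracts
     V = phi x - phi x_min + |(x - x_min) - (1 - s) (x_prev - x_min)|^2 / (2 alpha)
   by the factor 1 - s, up to alpha |xi|^2 and a term linear in xi.

   D-ASG is this scheme applied to the penalized objective, whose gradient is
   (1 - lambda_N) / alpha + L <= 1 / alpha Lipschitz, with xi the centred noise.  Hence
   E V stays bounded uniformly in k and in alpha, so E |x - x_prev|^2 = O(alpha).
   As x+ = W x + beta W (x - x_prev) - alpha (stochastic gradient) and W contracts the
   vectors of zero mean, the disagreement between the nodes, which vanishes at the
   zero initialization, satisfies E |x_i - xbar|^2 = O(alpha).

   The node averages follow the same scheme for f, with an error made of the averaged
   noise, of variance at most sigma^2 / N, and of a bias of size O(disagreement).
   Giving up half of the contraction absorbs the terms linear in the bias, and the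
   bias then contributes O(alpha).  So both estimates hold with a constant C_0, and
   their transient terms in gamma^(2k) are only needed to be nonnegative. *)

From Pilot Require Import Defs.
From HB Require Import structures.
From mathcomp Require Import all_boot all_order all_algebra.
From mathcomp Require Import all_classical all_reals all_analysis.
From mathcomp Require Import measurable_realfun ring lra.
Set Implicit Arguments.
Unset Strict Implicit.
Unset Printing Implicit Defensive.
Import Order.TTheory GRing.Theory Num.Theory.
Import numFieldNormedType.Exports.
Local Open Scope classical_set_scope.
Local Open Scope ring_scope.

(* [dotmx] alone would denote MathComp's sesquilinear form. *)
Local Notation dotmx := Pilot.Defs.dotmx.

(** * Euclidean geometry of matrices *)

Section inner_product.
Context {R : realType}.

(** The noise of node i is centred conditionally on y_i^(k) alone, whereas the linear terms of the
    energy pair it with vectors that depend on the whole past and on all nodes. Independence bridges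
    the gap: u |-> E g_i(u, w_i^(k)) - grad f_i(u) vanishes almost everywhere for the law of
    y_i^(k). So the noise is orthogonal to every square-integrable function of the earlier noise and
    of the other nodes' noise at the same step; the latter yields sigma^2 / N for averages.

    The relation s^2 = alpha mu keeps constants uniform as alpha -> 0: s^2 / (2 alpha) = mu / 2
    trades momentum terms for distances. Summing a recursion divides its error by s or s / 2, so
    each error must carry a factor s.

    The contraction on zero-sum vectors is obtained by compactness, with a factor [rho] not
    expressed through gamma. For gamma, 0 < gamma < 1 is proved, so 1 / (1 - gamma)^2 >= 1. Since
    C_0 enters the right-hand sides linearly with positive coefficients, it is chosen last, as a
    large enough multiple of the uniform constant plus 1. *)

Lemma dotmxC m n (A B : 'M[R]_(m, n)) : dotmx A B = dotmx B A.
Proof. by apply: eq_bigr => i _; apply: eq_bigr => j _; rewrite mulrC. Qed.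

Lemma dotmxDl m n (A B C : 'M[R]_(m, n)) :
  dotmx (A + B) C = dotmx A C + dotmx B C.
Proof.
rewrite /dotmx -big_split; apply: eq_bigr => i _.
by rewrite -big_split; apply: eq_bigr => j _; rewrite mxE mulrDl.
Qed.

Lemma dotmxZl m n (a : R) (A B : 'M[R]_(m, n)) :
  dotmx (a *: A) B = a * dotmx A B.
Proof.
rewrite /dotmx mulr_sumr; apply: eq_bigr => i _.
by rewrite mulr_sumr; apply: eq_bigr => j _; rewrite mxE mulrA.
Qed.

Lemma dotmxDr m n (A B C : 'M[R]_(m, n)) :
  dotmx C (A + B) = dotmx C A + dotmx C B.
Proof. by rewrite !(dotmxC C) dotmxDl. Qed.

Lemma dotmxZr m n (a : R) (A B : 'M[R]_(m, n)) :
  dotmx A (a *: B) = a * dotmx A B.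
Proof. by rewrite dotmxC dotmxZl dotmxC. Qed.

Lemma dotmxNl m n (A B : 'M[R]_(m, n)) : dotmx (- A) B = - dotmx A B.
Proof. by rewrite -scaleN1r dotmxZl mulN1r. Qed.

Lemma dotmxNr m n (A B : 'M[R]_(m, n)) : dotmx A (- B) = - dotmx A B.
Proof. by rewrite dotmxC dotmxNl dotmxC. Qed.

Lemma dotmx0l m n (A : 'M[R]_(m, n)) : dotmx 0 A = 0.
Proof. by rewrite -(scale0r 0) dotmxZl mul0r. Qed.

Definition dotmxE := (dotmxDl, dotmxDr, dotmxNl, dotmxNr, dotmxZl, dotmxZr).

Lemma dotmx_suml m n (I : Type) (r : seq I) (F : I -> 'M[R]_(m, n)) B :
  dotmx (\sum_(i <- r) F i) B = \sum_(i <- r) dotmx (F i) B.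
Proof.
by apply: (big_morph (fun A => dotmx A B)); [move=> *; exact: dotmxDl|exact: dotmx0l].
Qed.

Lemma dotmx_rows m n (A B : 'M[R]_(m, n)) :
  dotmx A B = \sum_i dotmx (row i A) (row i B).
Proof.
apply: eq_bigr => i _; rewrite /dotmx big_ord1.
by apply: eq_bigr => j _; rewrite !mxE.
Qed.

Lemma dotmx_tr m n (A B : 'M[R]_(m, n)) : dotmx A^T B^T = dotmx A B.
Proof.
rewrite /dotmx exchange_big; apply: eq_bigr => i _.
by apply: eq_bigr => j _; rewrite !mxE.
Qed.

Lemma sqnorm_rows m n (A : 'M[R]_(m, n)) : sqnorm A = \sum_i sqnorm (row i A).
Proof. exact: dotmx_rows. Qed.

Lemma sqnorm_cols m n (A : 'M[R]_(m, n)) : sqnorm A = \sum_j sqnorm (row j A^T).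
Proof. by rewrite -sqnorm_rows /sqnorm dotmx_tr. Qed.

Lemma sqnorm_ge0 m n (A : 'M[R]_(m, n)) : 0 <= sqnorm A.
Proof. by apply: sumr_ge0 => i _; apply: sumr_ge0 => j _; rewrite -expr2 sqr_ge0. Qed.

Lemma sqnorm_row_le m n (A : 'M[R]_(m, n)) i : sqnorm (row i A) <= sqnorm A.
Proof.
by rewrite [leRHS]sqnorm_rows (bigD1 i)//= lerDl sumr_ge0// => *; exact: sqnorm_ge0.
Qed.

Lemma sqr_coord_le m n (A : 'M[R]_(m, n)) i j : A i j ^+ 2 <= sqnorm A.
Proof.
apply: le_trans (sqnorm_row_le A i).
rewrite /sqnorm /dotmx big_ord1 (bigD1 j)//= mxE -expr2 lerDl sumr_ge0// => k _.
by rewrite -expr2 sqr_ge0.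
Qed.

Lemma sqnorm_eq0 m n (A : 'M[R]_(m, n)) : sqnorm A = 0 -> A = 0.
Proof.
move=> A0; apply/matrixP => i j; rewrite mxE; apply/eqP.
by rewrite -sqrf_eq0 eq_le sqr_ge0 andbT -A0 sqr_coord_le.
Qed.

Lemma sqnormN m n (A : 'M[R]_(m, n)) : sqnorm (- A) = sqnorm A.
Proof. by rewrite /sqnorm !dotmxE opprK. Qed.

Lemma sqnormZ m n (a : R) (A : 'M[R]_(m, n)) : sqnorm (a *: A) = a ^+ 2 * sqnorm A.
Proof. by rewrite /sqnorm !dotmxE mulrA. Qed.

Lemma sqnorm0 m n : sqnorm (0 : 'M[R]_(m, n)) = 0.
Proof. exact: dotmx0l. Qed.

Lemma sqnormD m n (A B : 'M[R]_(m, n)) :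
  sqnorm (A + B) = sqnorm A + 2 * dotmx A B + sqnorm B.
Proof. by rewrite /sqnorm !dotmxE (dotmxC B A); ring. Qed.

Lemma norm2_le m n (A B : 'M[R]_(m, n)) (c : R) : 0 <= c ->
  norm2 A <= c * norm2 B -> sqnorm A <= c ^+ 2 * sqnorm B.
Proof.
move=> c0; rewrite /norm2 => h; have := sqnorm_ge0 A; have := sqnorm_ge0 B => B0 A0.
rewrite -(sqr_sqrtr A0) -(sqr_sqrtr B0) -exprMn ler_sqr// nnegrE ?sqrtr_ge0//.
by rewrite mulr_ge0// sqrtr_ge0.
Qed.

Lemma dotmx_young m n (A B : 'M[R]_(m, n)) (c : R) : 0 < c ->
  dotmx A B <= c / 2 * sqnorm A + (2 * c)^-1 * sqnorm B.
Proof.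
move=> c0; have := sqnorm_ge0 (c *: A - B).
rewrite /sqnorm !dotmxE (dotmxC B A) => h.
rewrite -subr_ge0.
have -> : c / 2 * dotmx A A + (2 * c)^-1 * dotmx B B - dotmx A B =
  (2 * c)^-1 * (c * (c * dotmx A A) - c * dotmx A B - (c * dotmx A B - dotmx B B)).
  by field; rewrite gt_eqF.
by apply: mulr_ge0; [rewrite invr_ge0 mulr_ge0// ltW|lra].
Qed.

Lemma sqnormD_young m n (A B : 'M[R]_(m, n)) (c : R) : 0 < c ->
  sqnorm (A + B) <= (1 + c) * sqnorm A + (1 + c^-1) * sqnorm B.
Proof.
move=> c0; rewrite sqnormD; have := dotmx_young A B c0; rewrite invfM. lra.
Qed.

Lemma sqnormD_le m n (A B : 'M[R]_(m, n)) :
  sqnorm (A + B) <= 2 * sqnorm A + 2 * sqnorm B.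
Proof. by have := sqnormD_young A B ltr01; rewrite invr1; lra. Qed.

Lemma sqnormB_le m n (A B : 'M[R]_(m, n)) :
  sqnorm (A - B) <= 2 * sqnorm A + 2 * sqnorm B.
Proof. by have := sqnormD_le A (- B); rewrite sqnormN. Qed.

Lemma sqnorm_convex m n (A B : 'M[R]_(m, n)) (t : R) : 0 <= t <= 1 ->
  sqnorm ((1 - t) *: A + t *: B) <= (1 - t) * sqnorm A + t * sqnorm B.
Proof.
move=> /andP[t0 t1]; have := sqnorm_ge0 (A - B).
move=> /(mulr_ge0 (mulr_ge0 t0 (eqbRL (subr_ge0 t 1) t1))).
move=> h; rewrite -subr_ge0; apply: le_trans h _; rewrite /sqnorm !dotmxE (dotmxC B A).
by rewrite le_eqVlt; apply/orP; left; apply/eqP; ring.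
Qed.

(** The square expands into a double sum of inner products. Young bounds each by the half-sum of two
    squares, and the halves of each square add up to [k] copies. *)
Lemma sqnorm_sum_le m n k (F : 'I_k -> 'M[R]_(m, n)) :
  sqnorm (\sum_i F i) <= k%:R * \sum_i sqnorm (F i).
Proof.
have h i j : dotmx (F i) (F j) <= 2^-1 * sqnorm (F i) + 2^-1 * sqnorm (F j).
  by have := dotmx_young (F i) (F j) ltr01; rewrite mulr1 mul1r.
rewrite /sqnorm dotmx_suml.
under eq_bigr do rewrite dotmxC dotmx_suml.
have -> : k%:R * (\sum_i dotmx (F i) (F i)) =
  \sum_(i < k) \sum_(j < k) (2^-1 * sqnorm (F j) + 2^-1 * sqnorm (F i)).
  under [RHS]eq_bigr do rewrite big_split sumr_const card_ord /= -mulr_sumr.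
  rewrite big_split sumr_const card_ord /= sumrMnl -mulr_sumr /sqnorm.
  by rewrite -mulrnDr -mulr_natl; field.
by apply: ler_sum => i _; apply: ler_sum => j _; exact: h.
Qed.

End inner_product.

(** * Accelerated gradient step *)

Section accelerated_gradient.
Context {R : realType} {m n : nat}.
Implicit Types (x y u v xi : 'M[R]_(m, n)).

(** Strong convexity and the descent inequality in one, with [G] as a parameter: the penalized and
    the averaged objective then come with explicit fields [G], and their derivatives need not be
    computed. *)
Definition sandwiched (mu Lam : R) (phi : 'M[R]_(m, n) -> R)
    (G : 'M[R]_(m, n) -> 'M[R]_(m, n)) :=
  forall x y,
    phi y + dotmx (G y) (x - y) + mu / 2 * sqnorm (x - y) <= phi x /\
    phi x <= phi y + dotmx (G y) (x - y) + Lam / 2 * sqnorm (x - y).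

Variables (mu Lam alpha s : R) (phi : 'M[R]_(m, n) -> R).
Variables (G : 'M[R]_(m, n) -> 'M[R]_(m, n)) (xs : 'M[R]_(m, n)).
Hypotheses (mu0 : 0 < mu) (alpha0 : 0 < alpha) (s0 : 0 < s) (s1 : s < 1).
Hypothesis s2 : s ^+ 2 = alpha * mu.
Hypothesis phiG : sandwiched mu Lam phi G.
Hypothesis phi_min : forall x, phi xs <= phi x.

Definition energy x u :=
  phi x - phi xs + (2 * alpha)^-1 * sqnorm ((x - xs) - (1 - s) *: (u - xs)).

(** The momentum vector of the next energy before the gradient step: at the pair
    [(y - alpha *: v, x)] the squared term of [energy] is that of [drift x y - alpha *: v]. *)
Definition drift x y := (y - xs) - (1 - s) *: (x - xs).

(** [G] is not known to be the derivative, so the upper bound is used instead: a step of length 1 /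
    [Lam] along - [G xs] would lower [phi] by |G xs|^2 / (2 Lam). *)
Lemma sandwiched_min_grad : 0 < Lam -> G xs = 0.
Proof.
move=> L0; apply: sqnorm_eq0; apply/eqP; rewrite eq_le sqnorm_ge0 andbT.
have [_] := phiG (xs - Lam^-1 *: G xs) xs.
rewrite [_ - xs]addrAC subrr add0r sqnormN sqnormZ dotmxNr dotmxZr.
rewrite -/(sqnorm (G xs)).
have := phi_min (xs - Lam^-1 *: G xs) => h1 h2.
have -> : sqnorm (G xs) = 2 * Lam * (Lam^-1 * sqnorm (G xs)
    - Lam / 2 * (Lam^-1 ^+ 2 * sqnorm (G xs))) by field; rewrite gt_eqF.
by rewrite pmulr_rle0 ?mulr_gt0//; lra.
Qed.

Lemma sandwiched_growth x : 0 < Lam ->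
  mu / 2 * sqnorm (x - xs) <= phi x - phi xs /\
  phi x - phi xs <= Lam / 2 * sqnorm (x - xs).
Proof.
move=> L0; have := phiG x xs; rewrite sandwiched_min_grad// dotmx0l.
by move=> -[]; lra.
Qed.

Lemma energy_ge_dist x u : 0 < Lam -> sqnorm (x - xs) <= 2 / mu * energy x u.
Proof.
move=> L0; have [h _] := sandwiched_growth x L0; rewrite /energy.
have := sqnorm_ge0 ((x - xs) - (1 - s) *: (u - xs)); set p := sqnorm (_ - _ *: _).
move=> p0; have -> : sqnorm (x - xs) = 2 / mu * (mu / 2 * sqnorm (x - xs)).
  by field; rewrite gt_eqF.
rewrite ler_pM2l ?divr_gt0//.
have : 0 <= (2 * alpha)^-1 * p by rewrite mulr_ge0// invr_ge0 mulr_ge0// ltW.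
lra.
Qed.

Lemma energy_ge0 x u : 0 <= energy x u.
Proof.
apply: addr_ge0; first by rewrite subr_ge0.
by rewrite mulr_ge0 ?sqnorm_ge0// invr_ge0 mulr_ge0// ltW.
Qed.

Lemma energy_ge_momentum x u :
  sqnorm ((x - xs) - (1 - s) *: (u - xs)) <= 2 * alpha * energy x u.
Proof.
rewrite /energy mulrDr mulrA mulfV ?mul1r; last by rewrite gt_eqF// mulr_gt0.
by rewrite lerDr mulr_ge0 ?mulr_ge0// ?subr_ge0// ltW.
Qed.

(** The increment is the momentum vector minus s (u - xs). The first has square at most 2 alpha
    times the energy, and s^2 = alpha mu, so both contributions are of order alpha. *)
Lemma energy_ge_increment x u :
  sqnorm (x - u) <= 4 * alpha * energy x u + 2 * s ^+ 2 * sqnorm (u - xs).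
Proof.
have -> : x - u = ((x - xs) - (1 - s) *: (u - xs)) + (- s) *: (u - xs).
  by apply/matrixP => i j; rewrite !mxE; ring.
apply: le_trans (sqnormD_le _ _) _; rewrite sqnormZ sqrrN.
have := energy_ge_momentum x u; lra.
Qed.

Let beta := (1 - s) / (1 + s).

(** With p the momentum vector, y - xs is the average of x - xs and p / s with weights 1 / (1 + s)
    and s / (1 + s). Both obey the same bound, because |p|^2 <= 2 alpha V and s^2 = alpha mu; hence
    extrapolation loses nothing as alpha -> 0. *)
Lemma extrapolate_dist x u : 0 < Lam ->
  sqnorm (extrapolate beta (x, u) - xs) <= 2 / mu * energy x u.
Proof.
move=> L0; have s10 : 1 + s != 0 by rewrite gt_eqF// addr_gt0.
set p := (x - xs) - (1 - s) *: (u - xs).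
have -> : extrapolate beta (x, u) - xs =
    (1 - s / (1 + s)) *: (x - xs) + (s / (1 + s)) *: (s^-1 *: p).
  apply/matrixP => i j; rewrite /beta /p /extrapolate !mxE /=; field.
  by rewrite s10 gt_eqF.
apply: le_trans (sqnorm_convex _ _ _) _.
  rewrite divr_ge0 ?ler_pdivrMr ?ltW ?addr_gt0//=; lra.
have h1 := energy_ge_dist x u L0; have h2 := energy_ge_momentum x u.
rewrite sqnormZ -/p in h2 *.
have {}h2 : s^-1 ^+ 2 * sqnorm p <= 2 / mu * energy x u.
  rewrite exprVn mulrC ler_pdivrMr ?exprn_gt0// s2.
  apply: le_trans h2 _; rewrite le_eqVlt; apply/orP; left; apply/eqP.
  by field; rewrite gt_eqF.
have t0 : 0 <= s / (1 + s) by rewrite divr_ge0// ?addr_ge0// ltW.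
have t1 : 0 <= 1 - s / (1 + s).
  by rewrite subr_ge0 ler_pdivrMr ?addr_gt0//; lra.
have := ler_wpM2l t0 h2; have := ler_wpM2l t1 h1; lra.
Qed.

(** The value of [beta] is the one for which the drift is the convex combination, with weights 1 - s
    and s, of the old momentum vector and of s (y - xs). The first part contracts; strong convexity
    will absorb the second. *)
Lemma drift_sqnorm_le x u :
  sqnorm (drift x (extrapolate beta (x, u))) <=
  (1 - s) * sqnorm ((x - xs) - (1 - s) *: (u - xs))
  + s * (s ^+ 2 * sqnorm (extrapolate beta (x, u) - xs)).
Proof.
have s10 : 1 + s != 0 by rewrite gt_eqF// addr_gt0.
set p := (x - xs) - (1 - s) *: (u - xs).
have -> : drift x (extrapolate beta (x, u)) =
    (1 - s) *: p + s *: (s *: (extrapolate beta (x, u) - xs)).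
  by apply/matrixP => i j; rewrite /drift /beta /p /extrapolate !mxE /=; field.
by apply: le_trans (sqnorm_convex _ _ _) _; rewrite ?sqnormZ ?lexx// !ltW.
Qed.

Lemma drift_le_energy x u : 0 < Lam ->
  sqnorm (drift x (extrapolate beta (x, u))) <= 2 * alpha * energy x u.
Proof.
move=> L0; apply: le_trans (drift_sqnorm_le _ _) _.
have h1 := energy_ge_momentum x u; have := extrapolate_dist x u L0.
move=> /(ler_wpM2l (sqr_ge0 s)).
have -> : s ^+ 2 * (2 / mu * energy x u) = 2 * alpha * energy x u.
  by rewrite s2; field; rewrite gt_eqF.
move=> /(ler_wpM2l (ltW s0)).
have t1 : 0 <= 1 - s by rewrite subr_ge0 ltW.
by have := ler_wpM2l t1 h1; lra.
Qed.

(** Three inequalities are added: the upper bound from [y] to the new point, 1 - s times convexity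
    between [y] and [x], and s times strong convexity between [y] and [xs]. The terms linear in [xi]
    are not estimated, since they will have zero mean. *)
Lemma energy_step x u xi y : y = extrapolate beta (x, u) ->
  energy (y - alpha *: (G y + xi)) x <=
    (1 - s) * energy x u - alpha / 2 * (1 - alpha * Lam) * sqnorm (G y)
    + alpha ^+ 2 * Lam * dotmx (G y) xi
    + alpha / 2 * (1 + alpha * Lam) * sqnorm xi - dotmx xi (drift x y).
Proof.
move=> ye.
have [_ h1] := phiG (y - alpha *: (G y + xi)) y.
have [h2 _] := phiG x y; have [h3 _] := phiG xs y.
have h4 := drift_sqnorm_le x u; rewrite -ye in h4.
have h2a : phi y + dotmx (G y) (x - y) <= phi x.
  by apply: le_trans h2; rewrite lerDl mulr_ge0 ?sqnorm_ge0// divr_ge0 ?ltW.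
have h2b : (1 - s) * (phi y + dotmx (G y) (x - y)) <= (1 - s) * phi x.
  by apply: ler_wpM2l h2a; rewrite subr_ge0 ltW.
move: h3 => /(ler_wpM2l (ltW s0)) h3.
have i0 : 0 <= (2 * alpha)^-1 by rewrite invr_ge0 mulr_ge0// ltW.
(* After division by 2 alpha, the part s^3 |y - xs|^2 of the drift bound becomes s mu / 2 |y -
   xs|^2, exactly what strong convexity at [xs] supplies. *)
move: h4 => /(ler_wpM2l i0).
have -> : (2 * alpha)^-1 * ((1 - s) * sqnorm ((x - xs) - (1 - s) *: (u - xs))
    + s * (s ^+ 2 * sqnorm (y - xs))) =
  (1 - s) * ((2 * alpha)^-1 * sqnorm ((x - xs) - (1 - s) *: (u - xs)))
    + s * (mu / 2 * sqnorm (y - xs)) by rewrite s2; field; rewrite gt_eqF.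
rewrite /energy => h4.
have -> : sqnorm (y - alpha *: (G y + xi) - xs - (1 - s) *: (x - xs)) =
  sqnorm (drift x y) - 2 * alpha * dotmx (G y + xi) (drift x y)
  + alpha ^+ 2 * sqnorm (G y + xi).
  have -> : y - alpha *: (G y + xi) - xs - (1 - s) *: (x - xs) =
      drift x y - alpha *: (G y + xi).
    by apply/matrixP => i j; rewrite /drift !mxE; ring.
  by rewrite sqnormD sqnormN sqnormZ dotmxNr dotmxZr (dotmxC (drift x y)); ring.
(* The drift is the same combination of x - y and xs - y as the one used for convexity, so the inner
   products with [G y] cancel. *)
have h5 : dotmx (G y) (drift x y) =
  - (1 - s) * dotmx (G y) (x - y) - s * dotmx (G y) (xs - y).
  rewrite -!dotmxZr -dotmxNr -dotmxDr; congr (Pilot.Defs.dotmx _ _).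
  by apply/matrixP => i j; rewrite /drift !mxE; ring.
rewrite [_ - y]addrAC subrr add0r sqnormN sqnormZ dotmxNr dotmxZr in h1.
rewrite -(sqnormN (y - xs)) opprB in h4.
rewrite (_ : forall A B C : R, (2 * alpha)^-1 *
  (A - 2 * alpha * B + alpha ^+ 2 * C) = (2 * alpha)^-1 * A - B + alpha / 2 * C);
  last by move=> A B C; field; rewrite gt_eqF.
rewrite dotmxDl h5; rewrite sqnormD in h1 *.
rewrite dotmxDr -/(sqnorm (G y)) in h1.
by move: h1 h2b h3 h4; lra.
Qed.

End accelerated_gradient.

(** * Smooth strongly convex functions *)

Section smoothness.
Context {R : realType} {m n : nat}.
Implicit Types (h : 'M[R]_(m, n) -> R) (x y v : 'M[R]_(m, n)).

Lemma derive_grad h x v : differentiable h x -> 'D_v h x = dotmx (grad h x) v.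
Proof.
move=> dh; rewrite deriveE// {1}(matrix_sum_delta v) linear_sum.
apply: eq_bigr => i _; rewrite linear_sum; apply: eq_bigr => j _.
by rewrite linearZ /= /grad mxE deriveE// mulrC.
Qed.

Lemma is_derive_line h y v (t : R) : (forall x, differentiable h x) ->
  is_derive t 1 (fun t => h (y + t *: v)) (dotmx (grad h (y + t *: v)) v).
Proof.
move=> dh; set g := fun t : R => y + t *: v.
have dg : is_diff t g (0 + *:%R ^~ v) by exact: is_diffD.
have dg' : differentiable g t by exact: ex_diff.
rewrite -/(h \o g); have dhg : differentiable (h \o g) t.
  by apply: differentiable_comp => //; exact: dh.
apply: DeriveDef; first exact: diff_derivable.
rewrite deriveE// diff_comp//=.
by rewrite diff_val /= add0r scale1r -deriveE ?derive_grad//.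
Qed.

(** [c] is a sign, so that one proof gives the upper and the lower quadratic bound. The defect [psi]
    along the segment has a nonpositive derivative, and the mean value theorem compares its values
    at 0 and 1. *)
Lemma smooth_bound (L c : R) h x y : 0 < L -> c ^+ 2 = 1 -> lipschitz_gradient L h ->
  c * (h x - h y - dotmx (grad h y) (x - y)) <= L / 2 * sqnorm (x - y).
Proof.
move=> L0 c1 [dh lip]; set v := x - y.
set psi := fun t : R => c * (h (y + t *: v) - dotmx (grad h y) v * t)
  - L / 2 * sqnorm v * t ^+ 2.
set dpsi := fun t : R => c * (dotmx (grad h (y + t *: v)) v - dotmx (grad h y) v)
  - L * sqnorm v * t.
have dpsiE (t : R) : is_derive t (1 : R) psi (dpsi t).
  have h1 := is_derive_line y v t dh.
  rewrite /psi /dpsi; apply: is_derive_eq.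
  by rewrite /GRing.scale /=; field.
have cpsi : {within `[0, 1], continuous psi}.
  apply: continuous_subspaceT => t; apply: differentiable_continuous.
  by apply/derivable1_diffP; have [] := dpsiE t.
have [t] := MVT ltr01 (fun t _ => dpsiE t) cpsi.
rewrite in_itv /= => /andP[t0 t1].
rewrite /psi !scale1r !scale0r addr0 /v subrKC -/v expr0n /= => e.
suff : dpsi t <= 0 by move: e; rewrite expr1n; lra.
rewrite /dpsi subr_le0; set w := grad h (y + t *: v).
have -> : dotmx w v - dotmx (grad h y) v = dotmx (w - grad h y) v.
  by rewrite dotmxDl dotmxNl.
(* The mean value point has t > 0. With the weight 1 / (L t), both terms of Young's inequality are
   at most L t / 2 |v|^2. *)
rewrite -dotmxZl; have Lt : 0 < L * t by exact: mulr_gt0.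
have := dotmx_young (c *: (w - grad h y)) v (_ : 0 < (L * t)^-1).
rewrite invr_gt0 => /(_ Lt) /le_trans; apply; rewrite sqnormZ c1 mul1r.
have := norm2_le (ltW L0) (lip (y + t *: v) y).
rewrite [_ - y]addrAC subrr add0r sqnormZ -/w => hw.
have i0 : 0 <= (L * t)^-1 / 2 by rewrite divr_ge0// invr_ge0 ltW.
have := ler_wpM2l i0 hw; move=> {hw} hw.
rewrite -lerBrDr; apply: le_trans hw _; rewrite le_eqVlt; apply/orP; left.
by apply/eqP; field; rewrite !gt_eqF.
Qed.

(** Stands in for the limit t -> 0; a positive [a] is refuted at t = min(1/2, a / (2 b)). *)
Lemma le0_small_multiple (a b : R) : (forall t : R, 0 < t < 1 -> a <= t * b) -> a <= 0.
Proof.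
move=> h; rewrite leNgt; apply/negP => a0.
have b0 : 0 < b.
  have /h : 0 < (2^-1 : R) < 1 by lra.
  lra.
have : 0 < Num.min 2^-1 (a / (2 * b)) < 1.
  by rewrite lt_min gt_min divr_gt0 ?mulr_gt0// invr_gt0 ltr0n invf_lt1// ltr1n.
move=> /h; apply/negP; rewrite -ltNge.
have : Num.min 2^-1 (a / (2 * b)) * b <= a / (2 * b) * b.
  by rewrite ler_wpM2r ?(ltW b0)// ge_min lexx orbT.
move=> /le_lt_trans; apply.
by rewrite (_ : a / (2 * b) * b = a / 2); [lra|field; rewrite gt_eqF].
Qed.

(** For the lower bound, strong convexity at t x + (1 - t) y is compared with the lower quadratic
    bound at the same point. Dividing by t leaves an error t (mu + L) / 2 |x - y|^2, which vanishes
    with t. *)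
Lemma strongly_convex_sandwiched (mu L : R) h : 0 < L ->
  strongly_convex mu h -> lipschitz_gradient L h -> sandwiched mu L h (grad h).
Proof.
move=> L0 sc lip x y; split; last first.
  have := smooth_bound x y L0 (expr1n _ 2) lip; lra.
suff : h y + dotmx (grad h y) (x - y) + mu / 2 * sqnorm (x - y) - h x <= 0 by lra.
apply: (@le0_small_multiple _ ((mu + L) / 2 * sqnorm (x - y))) => t /andP[t0 t1].
have := smooth_bound (t *: x + (1 - t) *: y) y L0 (_ : (-1) ^+ 2 = 1) lip.
rewrite sqrrN expr1n => /(_ erefl).
have -> : t *: x + (1 - t) *: y - y = t *: (x - y).
  by apply/matrixP => i j; rewrite !mxE; ring.
rewrite dotmxZr sqnormZ => h1.
have t01 : 0 <= t <= 1 by rewrite !ltW.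
have h2 := sc x y t t01.
rewrite -(ler_pM2l t0); lra.
Qed.

End smoothness.

(** * Spectrum of the mixing matrix *)

Section rayleigh.
Context {R : realType} {n : nat}.
Implicit Types (v u : 'rV[R]_n) (W : 'M[R]_n).

Lemma dotrV m (v u : 'rV[R]_m) : dotmx v u = \sum_j v 0 j * u 0 j.
Proof. by rewrite /dotmx big_ord1. Qed.

Lemma continuous_dotmulmx (W W' : 'M[R]_n) :
  continuous (fun v : 'rV[R]_n => dotmx (v *m W) (v *m W')).
Proof.
have sumc (I : Type) (r : seq I) (F : I -> 'rV[R]_n -> R) :
    (forall i, continuous (F i)) -> continuous (fun v => \sum_(i <- r) F i v).
  by move=> cF; apply: continuous_big => //; exact: add_continuous.
have mulc (M : 'M[R]_n) i j : continuous (fun v : 'rV[R]_n => (v *m M) i j).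
  rewrite (_ : (fun _ => _) = fun v : 'rV[R]_n => \sum_k v i k * M k j); last first.
    by apply/funext => v; rewrite mxE.
  apply: sumc => k v; apply: continuousM; first exact: coord_continuous.
  exact: cst_continuous.
apply: (@sumc _ _ (fun i v => \sum_j _)) => i.
apply: (@sumc _ _ (fun j v => _)) => j v.
by apply: continuousM; exact: mulc.
Qed.

Lemma compact_sphere (A : set 'rV[R]_n) : closed A ->
  compact [set v : 'rV[R]_n | sqnorm v = 1 /\ A v].
Proof.
move=> cA; have := @rV_compact _ n (fun=> `[(-1 : R), 1]%classic).
move=> /(_ (fun=> @segment_compact _ _ _)) cbox.
apply: subclosed_compact cbox _.
  apply: (@closedI _ [set v : 'rV[R]_n | sqnorm v = 1]) => //.
  rewrite (_ : [set _ | _] = (fun v : 'rV[R]_n => sqnorm v) @^-1` [set 1])//.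
  apply: preimage_closed; last exact: closed_eq.
  move=> v _; have := @continuous_dotmulmx 1%:M 1%:M v.
  by under eq_fun do rewrite !mulmx1.
move=> v [v1 _] i /=; rewrite in_itv /= -ler_norml -(expr_le1 (n := 2))//.
by rewrite real_normK ?num_real// -v1 sqr_coord_le.
Qed.

Lemma unit_scale v : v != 0 -> exists2 c : R, 0 < c & sqnorm (c *: v) = 1.
Proof.
move=> v0; have q0 : 0 < sqnorm v.
  by rewrite lt_def sqnorm_ge0 andbT; apply: contra_neq v0 => /sqnorm_eq0.
exists (Num.sqrt (sqnorm v))^-1; first by rewrite invr_gt0 sqrtr_gt0.
by rewrite sqnormZ exprVn sqr_sqrtr ?ltW// mulVf// gt_eqF.
Qed.

Lemma dotmx_sym W v u : W^T = W -> dotmx (v *m W) u = dotmx v (u *m W).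
Proof.
move=> sW; have dE (a b : 'rV[R]_n) : dotmx a b = (a *m b^T) 0 0.
  by rewrite dotrV mxE; apply: eq_bigr => j _; rewrite mxE.
by rewrite !dE trmx_mul sW mulmxA.
Qed.

(* The minimum of the Rayleigh quotient is attained at an eigenvector. *)
Lemma rayleigh_min W : W^T = W -> (0 < n)%N ->
  exists2 a : R, eigenvalue W a & forall v, a * sqnorm v <= dotmx (v *m W) v.
Proof.
move=> sW n0; pose A := [set v : 'rV[R]_n | sqnorm v = 1 /\ [set: 'rV[R]_n] v].
have A0 : A !=set0.
  have e0 : (const_mx 1 : 'rV[R]_n) != 0.
    apply/eqP => /rowP /(_ (Ordinal n0)); rewrite !mxE => /eqP.
    by rewrite oner_eq0.
  by have [c _ c1] := unit_scale e0; exists (c *: const_mx 1).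
have cA : compact A by apply: compact_sphere; exact: closedT.
have cf : {within A, continuous (fun v : 'rV[R]_n => dotmx (v *m W) v)}.
  apply: continuous_subspaceT => v; have := @continuous_dotmulmx W 1%:M v.
  by under eq_fun do rewrite mulmx1.
have [u /set_mem[u1 _] umin] := EVT_min_rV A0 cA cf.
set a := dotmx (u *m W) u in umin.
have amin v : a * sqnorm v <= dotmx (v *m W) v.
  have [->|v0] := eqVneq v 0; first by rewrite mul0mx sqnorm0 dotmx0l mulr0.
  have [c c0 c1] := unit_scale v0.
  have : c *: v \in A by apply/mem_set; split.
  move=> /umin; rewrite -scalemxAl dotmxZl dotmxZr => h.
  have c2 : 0 < c ^+ 2 by rewrite exprn_gt0.
  rewrite -(ler_pM2l c2) mulrCA -sqnormZ c1 mulr1; apply: le_trans h _.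
  by rewrite expr2 mulrA.
exists a => //; apply/eigenvalueP; exists u; last first.
  by apply: contra_eq_neq u1 => ->; rewrite sqnorm0 eq_sym oner_neq0.
apply/eqP; rewrite -subr_eq0; apply/eqP.
move: {-2}(_ - _) (erefl (u *m W - a *: u)) => w wE.
(* The minimizer is perturbed along its own residual w = u W - a u, for which the first-order term
   is 2 t |w|^2. Small negative t then force w = 0. *)
have quad (t : R) : 0 <= 2 * (t * sqnorm w) + t ^+ 2 * (dotmx (w *m W) w - a * sqnorm w).
  have := amin (u + t *: w); rewrite sqnormD sqnormZ mulmxDl -scalemxAl !dotmxE u1.
  rewrite -/a (dotmx_sym w u sW) (dotmxC w (u *m W)).
  have -> : sqnorm w = dotmx (u *m W) w - a * dotmx u w.
    by rewrite /sqnorm {1}wE dotmxDl dotmxNl dotmxZl.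
  lra.
apply: sqnorm_eq0; apply/eqP; rewrite eq_le sqnorm_ge0 andbT.
apply: (@le0_small_multiple _ _ (2^-1 * `|dotmx (w *m W) w - a * sqnorm w|)) => t /andP[t0 t1].
have := quad (- t); rewrite sqrrN => h.
rewrite -(ler_pM2l t0); have := ler_norm (dotmx (w *m W) w - a * sqnorm w).
have t2 : 0 <= t ^+ 2 by rewrite sqr_ge0.
move=> /(ler_wpM2l t2); lra.
Qed.

End rayleigh.

(** * Contraction of the mixing matrix on vectors of zero sum *)

Section doubly_stochastic.
Context {R : realType} {n : nat} (E : rel 'I_n) (W : 'M[R]_n).
Hypotheses (hE : connected_graph E) (hW : mixing_matrix E W).
Implicit Type v : 'rV[R]_n.

(** Row i of W is a probability vector and, by symmetry, (v W)_i is the mean of v under it. The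
    right-hand side adds up the variances, and the column sums turn the second moments into
    |v|^2. *)
Lemma stochastic_deficit v : sqnorm v - sqnorm (v *m W) =
  \sum_i \sum_j W i j * (v 0 j - (v *m W) 0 i) ^+ 2.
Proof.
have [sW [_ r1 c1] _ _ _] := hW.
have vWE i : (v *m W) 0 i = \sum_j W i j * v 0 j.
  rewrite mxE; apply: eq_bigr => j _; rewrite mulrC; congr (_ * _).
  by rewrite -{1}sW mxE.
have -> : sqnorm v = \sum_i \sum_j W i j * v 0 j ^+ 2.
  rewrite exchange_big /sqnorm dotrV; apply: eq_bigr => j _.
  by rewrite -mulr_suml c1 mul1r.
rewrite /sqnorm dotrV -sumrB; apply: eq_bigr => i _.
set m := (v *m W) 0 i.
transitivity (\sum_j (W i j * v 0 j ^+ 2 - 2 * m * (W i j * v 0 j) + m ^+ 2 * W i j));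
  last by apply: eq_bigr => j _; ring.
rewrite big_split sumrB -!mulr_sumr r1 -vWE -/m /=; ring.
Qed.

Lemma stochastic_contract v : sqnorm (v *m W) <= sqnorm v.
Proof.
have [_ [W0 _ _] _ _ _] := hW.
rewrite -subr_ge0 stochastic_deficit; apply: sumr_ge0 => i _; apply: sumr_ge0 => j _.
by rewrite mulr_ge0// sqr_ge0.
Qed.

(** All variances vanish, so v_j = (v W)_i as soon as W_ij > 0. The positive diagonal gives v_i = (v
    W)_i, hence neighbours agree, and connectedness does the rest. Without the diagonal, a sign
    change across a bipartite graph would survive. *)
Lemma stochastic_isometric_cst v : sqnorm v <= sqnorm (v *m W) ->
  forall i j, v 0 i = v 0 j.
Proof.
have [_ [W0 _ _] We _ Wd] := hW; move=> h.
have d0 : \sum_i \sum_j W i j * (v 0 j - (v *m W) 0 i) ^+ 2 = 0.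
  by apply/eqP; rewrite -stochastic_deficit eq_le subr_le0 h subr_ge0 stochastic_contract.
have e0 i j : W i j * (v 0 j - (v *m W) 0 i) ^+ 2 = 0.
  have p0 k l : 0 <= W k l * (v 0 l - (v *m W) 0 k) ^+ 2.
    by rewrite mulr_ge0// sqr_ge0.
  have := psumr_eq0P _ d0 => /(_ (fun k _ => sumr_ge0 _ (fun l _ => p0 k l))).
  move=> /(_ i isT) /psumr_eq0P; apply=> // l _; exact: p0.
have e1 i j : 0 < W i j -> v 0 j = (v *m W) 0 i.
  move=> Wij; have /eqP := e0 i j; rewrite mulf_eq0 gt_eqF//= sqrf_eq0 subr_eq0.
  by move=> /eqP.
have e2 i j : E i j -> v 0 i = v 0 j.
  have [->//|ij Eij] := eqVneq i j.
  by rewrite (e1 i i) ?(e1 i j)//; [exact: We|have [] := Wd i].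
move=> i j; have /connectP[p] := hE.2 i j.
elim: p i => [i _ -> //|k p IH i /= /andP[Eik pk] jl].
by rewrite (e2 _ _ Eik); exact: IH.
Qed.

Lemma fixed_sum0 v : sqnorm v <= sqnorm (v *m W) -> \sum_j v 0 j = 0 -> v = 0.
Proof.
move=> h s0; have c := stochastic_isometric_cst h; apply/rowP => i; rewrite mxE.
move: s0; under eq_bigr => j _ do rewrite (c j i).
rewrite sumr_const card_ord -mulr_natl => /eqP; rewrite mulf_eq0 pnatr_eq0.
by case: n i {h c} v => [[]//|k i v] /= /eqP.
Qed.

(** The maximum of |v W|^2 over unit vectors of zero sum is attained; if it reached 1, the maximizer
    would be constant with zero sum, hence null. *)
Lemma spectral_gap : exists rho : R, [/\ 0 <= rho, rho < 1 &
  forall v, \sum_j v 0 j = 0 -> sqnorm (v *m W) <= rho * sqnorm v].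
Proof.
pose S := [set v : 'rV[R]_n | \sum_j v 0 j = 0].
pose A := [set v : 'rV[R]_n | sqnorm v = 1 /\ S v].
have Sc v c : S v -> S (c *: v).
  by rewrite /S /= => h; under eq_bigr do rewrite mxE; rewrite -mulr_sumr h mulr0.
have cS : closed S.
  rewrite (_ : S = (fun v : 'rV[R]_n => \sum_j v 0 j) @^-1` [set 0])//.
  apply: preimage_closed; last exact: closed_eq.
  move=> v _; apply: (@continuous_big _ _ _ _ _ (@add_continuous _)) => j _.
  exact: coord_continuous.
(* If no unit vector has zero sum, then v = 0 is the only case and [rho] = 0 serves. *)
have [A0|/set0P] := pselect (A !=set0); last first.
  move=> /negP; rewrite negbK => /eqP A0; exists 0; split => // v Sv.
  have [->|v0] := eqVneq v 0; first by rewrite mul0mx sqnorm0 mulr0.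
  have [c c0 c1] := unit_scale v0.
  have : A (c *: v) by split => //; exact: Sc.
  by rewrite A0.
have cf : {within A, continuous (fun v : 'rV[R]_n => sqnorm (v *m W))}.
  by apply: continuous_subspaceT => v; exact: continuous_dotmulmx.
have [u /set_mem[u1 Su] umax] := EVT_max_rV A0 (compact_sphere cS) cf.
exists (sqnorm (u *m W)); split; first exact: sqnorm_ge0.
  rewrite ltNge -u1; apply/negP => /fixed_sum0 /(_ Su) u0.
  by move: u1; rewrite u0 sqnorm0 => /eqP; rewrite eq_sym oner_eq0.
move=> v Sv; have [->|v0] := eqVneq v 0; first by rewrite mul0mx !sqnorm0 mulr0.
have [c c0 c1] := unit_scale v0.
have : c *: v \in A by apply/mem_set; split => //; exact: Sc.
move=> /umax; rewrite -scalemxAl sqnormZ => h.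
have c2 : 0 < c ^+ 2 by rewrite exprn_gt0.
by rewrite -(ler_pM2l c2) mulrCA -(sqnormZ c v) c1 mulr1.
Qed.

Lemma eigenvalue_le1 (a : R) : eigenvalue W a -> a ^+ 2 <= 1.
Proof.
move=> /eigenvalueP[v vW v0]; have := stochastic_contract v.
rewrite vW sqnormZ -[leRHS]mul1r ler_pM2r// lt_def sqnorm_ge0 andbT.
by apply: contra_neq v0 => /sqnorm_eq0.
Qed.

End doubly_stochastic.

(** * Simplicity of the eigenvalue 1 *)

Section second_eigenvalue.
Context {R : realType} {n : nat} (E : rel 'I_n.+1) (W : 'M[R]_n.+1).
Hypotheses (hE : connected_graph E) (hW : mixing_matrix E W).

(* [XI - W] with its first column replaced by ones: the rows of [XI - W] sum to
   [X - 1], so [X - 1] can be factored out of the first column. *)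
Let bordered : 'M[{poly R}]_n.+1 :=
  \matrix_(i, j) if j == 0 then 1 else char_poly_mx W i j.

Lemma char_poly_bordered : char_poly W = \det bordered * ('X - 1%:P).
Proof.
have [_ [_ r1 _] _ _ _] := hW.
(* Multiplying by [Q] on the right adds all columns to the first; [Q] is lower triangular with unit
   diagonal. *)
pose Q : 'M[{poly R}]_n.+1 := \matrix_(i, j) if j == 0 then 1 else (i == j)%:R.
pose D : 'rV[{poly R}]_n.+1 := \row_j if j == 0 then 'X - 1%:P else 1.
have QD : char_poly_mx W *m Q = bordered *m diag_mx D.
  apply/matrixP => i j; rewrite mul_mx_diag !mxE.
  have [->|j0] := eqVneq j 0.
    under eq_bigr do rewrite !mxE eqxx mulr1.
    rewrite sumrB -rmorph_sum r1 mul1r (bigD1 i)//= eqxx mulr1n big1 ?addr0// => k ki.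
    by rewrite eq_sym (negbTE ki).
  rewrite mulr1 (bigD1 j)//= !mxE (negbTE j0) eqxx mulr1 big1 ?addr0// => k kj.
  by rewrite !mxE (negbTE j0) (negbTE kj) mulr0.
have dQ : \det Q = 1.
  rewrite det_trig ?big1//; first by move=> i _; rewrite mxE eqxx; case: ifP.
  apply/is_trig_mxP => i j ij; rewrite mxE; case: eqP => [j0|_].
    by move: ij; rewrite j0.
  by case: eqP => // ij'; rewrite ij' ltnn in ij.
have dD : \det (diag_mx D) = 'X - 1%:P.
  rewrite det_diag big_ord_recl mxE eqxx big1 ?mulr1// => i _; rewrite mxE.
  by case: eqP.
by have := congr1 determinant QD; rewrite !det_mulmx dQ dD mulr1.
Qed.

(** This makes 1 a simple root of the characteristic polynomial, the multiplicity that [spectrum]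
    records. A left null vector at X = 1 has zero sum by the first column and is fixed by W by the
    others, so it vanishes. *)
Lemma bordered_nonsingular : (\det bordered).[1] != 0.
Proof.
have [_ [_ r1 _] _ _ _] := hW.
rewrite -horner_evalE -det_map_mx; apply/negP => /det0P[v v0 vM].
have vj (j : 'I_n.+1) : \sum_i v 0 i * (if j == 0 then 1 else (i == j)%:R - W i j) = 0.
  move/rowP: vM => /(_ j); rewrite !mxE => vMj; apply: etrans vMj; apply: eq_bigr => i _.
  rewrite !mxE; congr (_ * _); rewrite /= horner_evalE.
  case: ifP => _; first by rewrite hornerC.
  by rewrite !hornerE; case: (i == j); rewrite ?hornerX ?hornerC ?mulr1n ?mulr0n.
have s0 : \sum_i v 0 i = 0.
  by have := vj 0; under eq_bigr do rewrite eqxx mulr1.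
have vW j : j != 0 -> (v *m W) 0 j = v 0 j.
  move=> j0; have := vj j; rewrite (negbTE j0); under eq_bigr do rewrite mulrBr.
  rewrite sumrB (bigD1 j)//= eqxx mulr1 big1 => [|i /negbTE->]; last by rewrite mulr0.
  by rewrite addr0 mxE => /eqP; rewrite subr_eq0 => /eqP.
(* The column for coordinate 0 was overwritten; this coordinate is recovered because W preserves the
   sum. *)
have vW0 : (v *m W) 0 0 = v 0 0.
  have : \sum_j (v *m W) 0 j = \sum_j v 0 j.
    under eq_bigr do rewrite mxE.
    rewrite exchange_big; apply: eq_bigr => i _.
    by rewrite -mulr_sumr r1 mulr1.
  rewrite (bigD1 0)// [RHS](bigD1 0)//= (eq_bigr (fun j => v 0 j) vW).
  by move/addIr.
have {}vW : v *m W = v.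
  by apply/rowP => j; have [->|/vW] := eqVneq j 0.
by move/eqP: v0; apply; apply: (fixed_sum0 hE hW) => //; rewrite vW.
Qed.

Variable lam : seq R.
Hypothesis hlam : spectrum W lam.

Lemma size_spectrum : size lam = n.+1.
Proof. by have := size_char_poly W; rewrite hlam.1 size_prod_XsubC => -[]. Qed.

Lemma mem_spectrum a : (a \in lam) = eigenvalue W a.
Proof. by rewrite eigenvalue_root_char hlam.1 root_prod_XsubC. Qed.

Lemma spectrum_ge_last a : a \in lam -> lam`_n <= a.
Proof.
move=> /(nthP 0)[i il <-]; have [_ srt] := hlam.
have := @sorted_leq_nth _ (fun a b : R => b <= a) _ _ 0 _ srt i n.
rewrite !inE il size_spectrum ltnSn; apply=> //.
- by move=> x y z /[swap]; exact: le_trans.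
- by move: il; rewrite size_spectrum.
Qed.

(** If the second entry were 1, so would be the first. Cancelling one factor X - 1 in the
    characteristic polynomial would leave the bordered determinant with a root at 1. *)
Lemma second_eigenvalue_lt1 : (0 < n)%N -> lam`_1 < 1.
Proof.
move=> n0; have sz := size_spectrum.
case: lam sz mem_spectrum hlam => [//|a [|b l]] [sz]; first by rewrite -sz in n0.
move=> mem [cp /= /andP[ba _]].
have le1 c : eigenvalue W c -> c <= 1.
  move=> /(eigenvalue_le1 hW) h; apply: le_trans (ler_norm c) _.
  by rewrite -(expr_le1 (n := 2))// real_normK ?num_real.
have a1 : a <= 1 by apply: le1; rewrite -mem mem_head.
rewrite lt_def (le_trans ba a1) andbT; apply/negP => /eqP b1.
have aE : a = 1 by apply: le_anti; rewrite a1 b1.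
move: cp; rewrite !big_cons aE -b1 char_poly_bordered mulrC.
move=> /(mulfI (negbT (polyXsubC_eq0 1))) dM.
have := bordered_nonsingular; rewrite dM !hornerE subrr mul0r eqxx.
by [].
Qed.

End second_eigenvalue.

(** * Random vectors and independence *)

Section measurable_vectors.
Context {R : realType} {d : nat}.

(** Measurability is known coordinate by coordinate only, so an open preimage is written as a
    countable union of boxes with rational centres and radii 1 / (k + 1). *)
Lemma measurable_continuous_coords (dX : measure_display) (X : measurableType dX)
    (Y : X -> 'rV[R]_d) (phi : 'rV[R]_d -> R) :
  continuous phi -> (forall j, measurable_fun setT (fun x => Y x 0 j)) ->
  measurable_fun setT (phi \o Y).
Proof.
move=> cphi mY; apply: (measurability _ (RGenOInfty.measurableE R)).
move=> /= _ [_ [a ->] <-]; rewrite setTI comp_preimage; set U := phi @^-1` _.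
have oU : open U.
  by apply: open_comp; [move=> x _; exact: cphi|exact: interval_open].
pose box (p : 'rV[rat]_d * nat) := [set v : 'rV[R]_d |
  forall j, `|v 0 j - ratr (p.1 0 j)| < p.2.+1%:R^-1].
have -> : Y @^-1` U = \bigcup_p [set x | box p (Y x) /\ box p `<=` U].
  apply/seteqP; split=> [x Ux|x [p _ [h /(_ _ h)]]//].
  have /nbhs_ballP[e /= e0 eU] : nbhs (Y x) U by exact: oU.
  have [k ke] : exists k : nat, k.+1%:R^-1 < e / 2.
    have [k _ /(_ k (leqnn k))] := near_infty_natSinv_lt (PosNum (divr_gt0 e0 (ltr0n R 2))).
    by exists k.
  have k0 : 0 < k.+1%:R^-1 :> R by rewrite invr_gt0 ltr0n.
  have near_rat (r : R) : exists q : rat, `|r - ratr q| < k.+1%:R^-1.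
    have [|q] := @rat_in_itvoo _ (r - k.+1%:R^-1) (r + k.+1%:R^-1).
      by rewrite ltrD2l -subr_gt0 opprK addr_gt0.
    by rewrite in_itv /= => h; exists q; rewrite distrC ltr_distl.
  have [q hq] := choice (fun j => near_rat (Y x 0 j)).
  exists (\row_j q j, k) => //; split=> [j|v hv]; first by rewrite mxE.
  apply: eU; split=> // i j; rewrite (ord1 i) /ball /= /ball_ /=.
  have := hv j; rewrite /= mxE => h1; have h2 := hq j.
  have -> : Y x 0 j - v 0 j = (Y x 0 j - ratr (q j)) - (v 0 j - ratr (q j)) by lra.
  apply: le_lt_trans (ler_normB _ _) _; apply: lt_trans (ltrD h2 h1) _.
  by move: ke; rewrite ltr_pdivlMr// mulr_natr mulr2n.
apply: countable_bigcupT_measurable => // p.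
have [bU|bU] := pselect (box p `<=` U); last first.
  rewrite (_ : [set _ | _] = set0)//; apply/seteqP; split=> // x [_ /bU].
  by [].
rewrite (_ : [set _ | _] =
    \bigcap_(j in [set: 'I_d]) [set x | `|Y x 0 j - ratr (p.1 0 j)| < p.2.+1%:R^-1]).
  apply: fin_bigcap_measurable; first exact: finite_finset.
  move=> j _; rewrite -[X in measurable X]setTI.
  have mf : measurable_fun setT (fun x => `|Y x 0 j - ratr (p.1 0 j)|).
    apply: measurableT_comp => //.
    by apply: measurable_funB; [exact: mY|exact: measurable_cst].
  have := mf measurableT `]-oo, p.2.+1%:R^-1[%classic.
  rewrite (_ : _ @^-1` `]-oo, _[ = [set x | `|Y x 0 j - ratr (p.1 0 j)| < p.2.+1%:R^-1]).
    by apply; exact: measurable_itv.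
  by apply/seteqP; split=> x /=; rewrite in_itv.
by apply/seteqP; split=> [x [h _] j _|x h]; [exact: h|split=> // j; exact: h].
Qed.

Lemma measurable_coord_cylinders (dX : measure_display) (X : measurableType dX)
    (Y : X -> 'rV[R]_d) : (forall j, measurable_fun setT (fun x => Y x 0 j)) ->
  measurable_fun setT (Y : X -> g_sigma_algebraType (@coord_cylinders R d)).
Proof.
move=> mY; apply: (@measurability _ _ X (g_sigma_algebraType (@coord_cylinders R d)) setT Y
  (@coord_cylinders R d) erefl).
move=> _ [C [j _ [B mB <-]] <-]; rewrite !setTI -comp_preimage -[X in measurable X]setTI.
exact: mY.
Qed.

Lemma measurable_coord j : measurable_fun setT
  (fun v : g_sigma_algebraType (@coord_cylinders R d) => (v : 'rV[R]_d) 0 j).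
Proof.
by move=> _ B mB; apply: sub_sigma_algebra; exists j => //; exists B.
Qed.

End measurable_vectors.

(** * Joint law of two independent random elements *)

Section independence.
Context {R : realType} {dT d1 d2 : measure_display} {T : measurableType dT}.
Context {T1 : measurableType d1} {Z : measurableType d2} (P : probability T R).

Definition independent_elements (U : {RV P >-> T1}) (w : {RV P >-> Z}) :=
  forall A B, measurable A -> measurable B ->
    P (U @^-1` A `&` w @^-1` B) = (P (U @^-1` A) * P (w @^-1` B))%E.

Variables (U : {RV P >-> T1}) (w : {RV P >-> Z}).
Hypothesis Uw : independent_elements U w.
Variable h : T1 * Z -> R.
Hypothesis mh : measurable_fun setT h.
Hypothesis ih : P.-integrable setT (fun x => (h (U x, w x))%:E).

Let mpair : measurable_fun setT (fun x => (U x, w x)).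
Proof. by apply: measurable_fun_pair; exact: measurable_funPT. Qed.

Let Uw_rv : {RV P >-> (T1 * Z)%type} := mfun_Sub (mem_set mpair).

Let prodE X : measurable X ->
  (distribution P U \x distribution P w)%E X = distribution P Uw_rv X.
Proof.
by move=> mX; apply: product_measure_unique => // A B mA mB; exact/esym/Uw.
Qed.

Let prod_integrable :
  (distribution P U \x distribution P w)%E.-integrable setT (EFin \o h).
Proof.
have : (distribution P Uw_rv).-integrable setT (EFin \o h).
  apply: (integrable_pushforward (measurable_funPT Uw_rv)) => //; exact/measurable_EFinP.
move=> /integrableP[mE iE]; apply/integrableP; split=> //.
apply: le_lt_trans iE; rewrite le_eqVlt; apply/orP; left; apply/eqP.
by apply: eq_measure_integral => A mA _; exact: prodE.
Qed.

Lemma independent_integrable :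
  (distribution P U).-integrable setT (fubini_F (distribution P w) (EFin \o h)).
Proof. exact: integrable_fubini_F. Qed.

(** The joint law agrees with the product of the laws on rectangles, hence everywhere, and Fubini
    applies. [fubini_F] is u |-> E h(u, w), the conditional mean of h(U, w) given U. *)
Lemma independent_integral : (\int[P]_x (h (U x, w x))%:E =
  \int[distribution P U]_u fubini_F (distribution P w) (EFin \o h) u)%E.
Proof.
rewrite integral12_prod_meas1//.
transitivity (\int[distribution P Uw_rv]_z (h z)%:E)%E; last first.
  by apply/esym; apply: eq_measure_integral => A mA _; exact: prodE.
by rewrite integral_distribution//; exact/measurable_EFinP.
Qed.

Lemma independent_ae_integrable : {ae distribution P U, forall u,
  (distribution P w).-integrable setT (fun z => (h (u, z))%:E)}.
Proof. exact: ae_integrable1 prod_integrable. Qed.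

End independence.

Section orthogonality.
Context {R : realType} {dT d1 d2 dZ : measure_display} {T : measurableType dT}.
Context {T1 : measurableType d1} {T2 : measurableType d2} {Z : measurableType dZ}.
Context (P : probability T R).
Variables (U : {RV P >-> T1}) (V : {RV P >-> T2}) (w : {RV P >-> Z}).
Variables (phi : T2 -> T1) (h : T1 * Z -> R) (H : T2 -> R).
Hypothesis UE : forall x, U x = phi (V x).
Hypothesis mphi : measurable_fun setT phi.
Hypothesis Vw : independent_elements V w.
Hypothesis mh : measurable_fun setT h.
Hypothesis mH : measurable_fun setT H.
Hypothesis ih : P.-integrable setT (fun x => (h (U x, w x))%:E).
Hypothesis ihH : P.-integrable setT (fun x => (h (U x, w x) * H (V x))%:E).
Hypothesis h0 : forall A, measurable A ->
  (\int[P]_(x in U @^-1` A) (h (U x, w x))%:E = 0)%E.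

Let Uw : independent_elements U w.
Proof.
move=> A B mA mB; have UA : U @^-1` A = V @^-1` (phi @^-1` A).
  by apply/seteqP; split=> x /=; rewrite UE.
by rewrite UA; apply: Vw => //; rewrite -[X in measurable X]setTI; exact: mphi.
Qed.

Let m := fubini_F (distribution P w) (EFin \o h).

Let m_int0 A : measurable A -> (\int[distribution P U]_(u in A) m u = 0)%E.
Proof.
(* The restriction to A is moved into the integrand as a factor depending on u, so that the previous
   section applies to it. *)
move=> mA; pose hA p := \1_A p.1 * h p.
have mhA : measurable_fun setT hA.
  apply: measurable_funM => //.
  by apply: measurableT_comp => //; exact: measurable_indic.
have hAE x : hA (U x, w x) = (h (U x, w x)) * \1_(U @^-1` A) x.
  by rewrite /hA mulrC.
have ihA : P.-integrable setT (fun x => (hA (U x, w x))%:E).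
  apply: le_integrable ih => //.
    apply/measurable_EFinP; apply: measurableT_comp => //.
    by apply: measurable_fun_pair; exact: measurable_funPT.
  move=> x _; rewrite !abse_EFin lee_fin /hA normrM ler_piMl//.
  by rewrite indicE; case: (_ \in _); rewrite /= ?normr0 ?normr1.
rewrite integral_mkcond; transitivity (\int[P]_x (hA (U x, w x))%:E)%E; last first.
  have mUA : measurable (U @^-1` A).
    by rewrite -[X in measurable X]setTI; exact: measurable_funPT.
  rewrite -[RHS](h0 mA) [RHS]integral_mkcond; apply: eq_integral => x _.
  by rewrite hAE patchE indicE; case: (x \in _); rewrite ?mulr1 ?mulr0.
rewrite (independent_integral Uw mhA ihA); apply: eq_integral => u _.
rewrite patchE /m /fubini_F; case: ifPn => uA.
  by apply: eq_integral => z _ /=; rewrite /hA indicE uA mul1r.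
by rewrite integral0_eq// => z _ /=; rewrite /hA indicE (negbTE uA) mul0r.
Qed.

(** The centring holds given [U], while the factor [H] depends on the finer [V]. As [w] is
    independent of [V], the function m(u) = E h(u, w) is the conditional mean given [V] as well. It
    has zero integral over every event of [U], so it vanishes almost everywhere, and integrating
    first in w gives H(v) m(phi v) = 0. *)
Lemma orthogonal_independent : (\int[P]_x (h (U x, w x) * H (V x))%:E = 0)%E.
Proof.
have mm := independent_integrable Uw mh ih.
have m_ae : ae_eq (distribution P U) setT m (cst 0%E).
  apply: integral_ae_eq; [by []|exact: mm|exact: measurable_cst|move=> A _ mA].
  by rewrite m_int0// integral0_eq.
(* Since U = phi(V), null sets for the law of [U] pull back along [phi] to null sets for the law of
   [V]. *)
have aeV (Q : T1 -> Prop) : {ae distribution P U, forall u, Q u} ->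
    {ae distribution P V, forall v, Q (phi v)}.
  move=> [N [mN N0 QN]]; exists (phi @^-1` N); split.
  - by rewrite -[X in measurable X]setTI; exact: mphi.
  - rewrite -[RHS]N0 /distribution /pushforward; congr (P _).
    by apply/seteqP; split=> x /=; rewrite UE.
  - by move=> v /= Qv; apply: QN.
pose hH (p : T2 * Z) := h (phi p.1, p.2) * H p.1.
have mhH : measurable_fun setT hH.
  apply: measurable_funM; last by apply: measurableT_comp.
  apply: measurableT_comp => //.
  by apply: measurable_fun_pair => //; apply: measurableT_comp.
have ihH' : P.-integrable setT (fun x => (hH (V x, w x))%:E).
  by under eq_fun do rewrite /hH /= -UE.
transitivity (\int[P]_x (hH (V x, w x))%:E)%E.
  by apply: eq_integral => x _; rewrite /hH /= -UE.
rewrite (independent_integral Vw mhH ihH').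
rewrite (ae_eq_integral (cst 0%E))//; first by rewrite integral0_eq.
  by have /integrableP[] := independent_integrable Vw mhH ihH'.
have := aeV _ m_ae; have := aeV _ (independent_ae_integrable Uw mh ih).
apply: filterS2 => v iv mv _; rewrite /fubini_F /hH /=.
under eq_integral do rewrite mulrC EFinM.
rewrite integralZl//; have := mv I; rewrite /m /fubini_F /= => ->.
by rewrite mule0.
Qed.

End orthogonality.

(** * Real expectations and square-integrable matrices *)

Section integrable_real.
Context {R : realType} {dT : measure_display} {T : measurableType dT}.
Context (P : probability T R).
Implicit Types X Y : T -> R.

Definition L1 X := P.-integrable setT (EFin \o X).
(** A real number even when the integral is infinite, which [fine] sends to 0; integrability
    therefore travels separately as [L1]. *)
Definition Ex X : R := (\int[P]_x X x)%R.

Lemma L1_measurable X : L1 X -> measurable_fun setT X.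
Proof. by move=> /integrableP[/measurable_EFinP]. Qed.

Lemma L1_le X Y : measurable_fun setT X -> (forall x, `|X x| <= Y x) -> L1 Y -> L1 X.
Proof.
move=> mX XY; apply: le_integrable => //; first exact/measurable_EFinP.
by move=> x _; rewrite /= lee_fin (le_trans (XY x))// ler_norm.
Qed.

Lemma L1D X Y : L1 X -> L1 Y -> L1 (fun x => X x + Y x).
Proof.
by move=> iX iY; have := integrableD measurableT iX iY; apply: eq_integrable.
Qed.

Lemma L1Z (c : R) X : L1 X -> L1 (fun x => c * X x).
Proof.
by move=> iX; have := integrableZl measurableT c iX; apply: eq_integrable.
Qed.

Lemma L1N X : L1 X -> L1 (fun x => - X x).
Proof. by move=> /(L1Z (-1)); under eq_fun do rewrite mulN1r. Qed.

Lemma L1B X Y : L1 X -> L1 Y -> L1 (fun x => X x - Y x).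
Proof. by move=> iX /L1N; exact: L1D. Qed.

Lemma L1_cst (c : R) : L1 (fun=> c).
Proof. exact: finite_measure_integrable_cst. Qed.

Lemma L1_sum (I : finType) (F : I -> T -> R) :
  (forall i, L1 (F i)) -> L1 (fun x => \sum_i F i x).
Proof.
move=> h; elim: (index_enum I) => [|i r IH].
  by under eq_fun do rewrite big_nil; exact: L1_cst.
by under eq_fun do rewrite big_cons; exact: L1D.
Qed.

Lemma ExD X Y : L1 X -> L1 Y -> Ex (fun x => X x + Y x) = Ex X + Ex Y.
Proof. exact: RintegralD. Qed.

Lemma ExZ (c : R) X : L1 X -> Ex (fun x => c * X x) = c * Ex X.
Proof. by move=> iX; exact: RintegralZl. Qed.

Lemma Ex_cst (c : R) : Ex (fun=> c) = c.
Proof.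
by have := expectation_cst P c; rewrite unlock /Ex /Rintegral => ->.
Qed.

Lemma Ex_sum (I : finType) (F : I -> T -> R) :
  (forall i, L1 (F i)) -> Ex (fun x => \sum_i F i x) = \sum_i Ex (F i).
Proof.
move=> h; suff [_ //] : L1 (fun x => \sum_i F i x) /\
  Ex (fun x => \sum_i F i x) = \sum_i Ex (F i).
elim: (index_enum I) => [|i r [IH1 IH2]].
  under [X in L1 X]eq_fun do rewrite big_nil.
  under [X in Ex X]eq_fun do rewrite big_nil.
  by rewrite big_nil Ex_cst; split=> //; exact: L1_cst.
under [X in L1 X]eq_fun do rewrite big_cons.
under [X in Ex X]eq_fun do rewrite big_cons.
by rewrite big_cons ExD// IH2; split=> //; exact: L1D.
Qed.

Lemma le_Ex X Y : L1 X -> L1 Y -> (forall x, X x <= Y x) -> Ex X <= Ex Y.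
Proof. by move=> iX iY h; apply: le_Rintegral. Qed.

Lemma Ex_ge0 X : (forall x, 0 <= X x) -> 0 <= Ex X.
Proof. by move=> h; apply: Rintegral_ge0. Qed.

Lemma expectationE X : L1 X -> ('E_P[X] = (Ex X)%:E)%E.
Proof.
by move=> iX; rewrite unlock /Ex /Rintegral fineK//; exact: integrable_fin_num.
Qed.

Definition L2 X := measurable_fun setT X /\ L1 (fun x => X x ^+ 2).

Lemma L2_cst (c : R) : L2 (fun=> c).
Proof. by split; [exact: measurable_cst|exact: L1_cst]. Qed.

Lemma L2M X Y : L2 X -> L2 Y -> L1 (fun x => X x * Y x).
Proof.
move=> [mX iX] [mY iY]; apply: L1_le (L1D iX iY); first exact: measurable_funM.
move=> x; have := sqr_ge0 (`|X x| - `|Y x|).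
rewrite normrM -(real_normK (num_real (X x))) -(real_normK (num_real (Y x))).
have := normr_ge0 (X x); have := normr_ge0 (Y x); nra.
Qed.

Lemma L2D X Y : L2 X -> L2 Y -> L2 (fun x => X x + Y x).
Proof.
move=> hX hY; split; first by apply: measurable_funD; [case: hX|case: hY].
under eq_fun do rewrite sqrrD.
by apply: L1D; [apply: L1D; [case: hX|apply: L1D; exact: L2M]|case: hY].
Qed.

Lemma L2Z (c : R) X : L2 X -> L2 (fun x => c * X x).
Proof.
move=> [mX iX]; split; first by apply: measurable_funM => //; exact: measurable_cst.
by under eq_fun do rewrite exprMn; exact: L1Z.
Qed.

Lemma L2_sum (I : finType) (F : I -> T -> R) :
  (forall i, L2 (F i)) -> L2 (fun x => \sum_i F i x).
Proof.
move=> h; elim: (index_enum I) => [|i r IH].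
  by under eq_fun do rewrite big_nil; exact: L2_cst.
by under eq_fun do rewrite big_cons; exact: L2D.
Qed.

Definition L2mx m n (A : T -> 'M[R]_(m, n)) := forall i j, L2 (fun x => A x i j).

Section matrices.
Variables m n : nat.
Implicit Types A B : T -> 'M[R]_(m, n).

Lemma L2mx_cst (A : 'M[R]_(m, n)) : L2mx (fun=> A).
Proof. by move=> i j; exact: L2_cst. Qed.

Lemma L2mxD A B : L2mx A -> L2mx B -> L2mx (fun x => A x + B x).
Proof. by move=> hA hB i j; under eq_fun do rewrite mxE; exact: L2D. Qed.

Lemma L2mxZ (c : R) A : L2mx A -> L2mx (fun x => c *: A x).
Proof. by move=> hA i j; under eq_fun do rewrite mxE; exact: L2Z. Qed.

Lemma L2mxN A : L2mx A -> L2mx (fun x => - A x).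
Proof. by move=> /(L2mxZ (-1)); under eq_fun do rewrite scaleN1r. Qed.

Lemma L2mxB A B : L2mx A -> L2mx B -> L2mx (fun x => A x - B x).
Proof. by move=> hA /L2mxN; exact: L2mxD. Qed.

Lemma L1_dotmx A B : L2mx A -> L2mx B -> L1 (fun x => dotmx (A x) (B x)).
Proof.
move=> hA hB; apply: (@L1_sum _ (fun i x => \sum_j _)) => i.
by apply: (@L1_sum _ (fun j x => A x i j * B x i j)) => j; exact: L2M.
Qed.

Lemma L1_sqnorm A : L2mx A -> L1 (fun x => sqnorm (A x)).
Proof. by move=> hA; exact: L1_dotmx. Qed.

Lemma L2mx_le A (Y : T -> R) : (forall i j, measurable_fun setT (fun x => A x i j)) ->
  (forall x, sqnorm (A x) <= Y x) -> L1 Y -> L2mx A.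
Proof.
move=> mA AY iY i j; split=> //; apply: L1_le iY.
  by under eq_fun do rewrite expr2; exact: measurable_funM.
by move=> x; rewrite ger0_norm ?sqr_ge0// (le_trans _ (AY x))// sqr_coord_le.
Qed.

Lemma L2mx_row A i : L2mx A -> L2mx (fun x => row i (A x)).
Proof. by move=> hA k j; under eq_fun do rewrite mxE; exact: hA. Qed.

Lemma L2mx_mul p (W : 'M[R]_(p, m)) A :
  L2mx A -> L2mx (fun x => W *m A x).
Proof.
move=> hA i j; under eq_fun do rewrite mxE.
by apply: (@L2_sum _ (fun k x => W i k * A x k j)) => k; apply: L2Z.
Qed.

Lemma Ex_dotmx_eq0 A B : (forall i j, L1 (fun x => A x i j * B x i j)) ->
  (forall i j, Ex (fun x => A x i j * B x i j) = 0) ->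
  Ex (fun x => dotmx (A x) (B x)) = 0.
Proof.
move=> i1 h; rewrite (@Ex_sum _ (fun i x => \sum_j A x i j * B x i j)); last first.
  by move=> i; exact: (@L1_sum _ (fun j x => A x i j * B x i j)).
rewrite big1// => i _; rewrite (@Ex_sum _ (fun j x => A x i j * B x i j))//.
by rewrite big1.
Qed.

End matrices.

End integrable_real.

(** * Stochastic iterates *)

(** The Lipschitz bound is Euclidean but the topology comes from the sup norm; continuity of v |->
    |v - y|^2 links the two. *)
Lemma lipschitz_gradient_continuous {R : realType} {d : nat} (L : R)
    (h : 'rV[R]_d -> R) j : 0 < L -> lipschitz_gradient L h ->
  continuous (fun v : 'rV[R]_d => grad h v 0 j).
Proof.
move=> L0 [_ lip] y; apply/(@cvgrPdist_lt _ _ _ (nbhs y) (nbhs_filter y)) => e e0.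
have cq : continuous (fun v : 'rV[R]_d => sqnorm (v - y)).
  rewrite (_ : (fun _ => _) =
      (fun v : 'rV[R]_d => sqnorm v) \o (fun v => v - y))//.
  move=> v; apply: continuous_comp.
    by apply: continuousB; [exact: cvg_id|exact: cst_continuous].
  have := @continuous_dotmulmx R d 1%:M 1%:M (v - y).
  by under eq_fun do rewrite !mulmx1.
have := cq y; rewrite /continuous_at subrr sqnorm0.
move=> /(@cvgrPdist_lt _ _ _ (nbhs y) (nbhs_filter y)).
have d0 : 0 < (e / L) ^+ 2 by rewrite exprn_gt0// divr_gt0.
move=> /(_ _ d0); apply: filterS => v.
rewrite sub0r normrN ger0_norm ?sqnorm_ge0// => hv.
rewrite -(ltr_pXn2r (n := 2))// ?nnegrE ?ltW// real_normK ?num_real//.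
have := sqr_coord_le (grad h y - grad h v) 0 j; rewrite !mxE => /le_lt_trans; apply.
apply: le_lt_trans (norm2_le (ltW L0) (lip _ _)) _.
rewrite -sqnormN opprB -ltr_pdivlMl ?exprn_gt0//.
by apply: lt_le_trans hv _; rewrite expr_div_n mulrC.
Qed.

Section stochastic_iterates.
Context {R : realType} {N d : nat} {dT dZ : measure_display}.
Context {T : measurableType dT} {Z : measurableType dZ} (P : probability T R).
Variables (L sigma : R) (f : 'I_N -> 'rV[R]_d -> R).
Variables (w : 'I_N -> nat -> {RV P >-> Z}) (g : 'I_N -> 'rV[R]_d -> Z -> 'rV[R]_d).
Variables (W : 'M[R]_N) (alpha beta : R).
Hypothesis L0 : 0 < L.
Hypothesis hf_smooth : forall i, lipschitz_gradient L (f i).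
Hypothesis hw : independent_noise w.
Hypothesis hg : forall i, measurable_oracle (g i).

Let state k omega := dasg_state W alpha beta (0, 0) (stack_oracle g w omega) k.
Let y k omega := extrapolate beta (state k omega).

Definition stack_grad (Y : 'M[R]_(N, d)) : 'M[R]_(N, d) :=
  \matrix_(i, j) grad (f i) (row i Y) 0 j.

Definition grad_noise k omega :=
  stack_oracle g w omega k (y k omega) - stack_grad (y k omega).

Let noiseE i k j omega : grad_noise k omega i j =
  g i (row i (y k omega)) (w i k omega) 0 j - grad (f i) (row i (y k omega)) 0 j.
Proof. by rewrite !mxE. Qed.

Let stack_gradE Y i j : stack_grad Y i j = grad (f i) (row i Y) 0 j.
Proof. by rewrite mxE. Qed.

Lemma row_stack_grad i Y : row i (stack_grad Y) = grad (f i) (row i Y).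
Proof. by apply/rowP => j; rewrite !mxE. Qed.

Lemma row_grad_noise i k omega : row i (grad_noise k omega) =
  g i (row i (y k omega)) (w i k omega) - grad (f i) (row i (y k omega)).
Proof. by apply/rowP => j; rewrite !mxE. Qed.

Lemma stack_grad_lipschitz X Y :
  sqnorm (stack_grad X - stack_grad Y) <= L ^+ 2 * sqnorm (X - Y).
Proof.
rewrite sqnorm_rows [sqnorm (X - Y)]sqnorm_rows mulr_sumr; apply: ler_sum => i _.
rewrite !raddfB /= !row_stack_grad.
by have [_ lip] := hf_smooth i; apply: norm2_le (ltW L0) (lip _ _).
Qed.

Lemma measurable_grad_coord (dX : measure_display) (X : measurableType dX)
    (Y : X -> 'rV[R]_d) i j : (forall k, measurable_fun setT (fun x => Y x 0 k)) ->
  measurable_fun setT (fun x => grad (f i) (Y x) 0 j).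
Proof.
move=> mY; apply: (measurable_continuous_coords (phi := fun v => grad (f i) v 0 j)) => //.
exact: lipschitz_gradient_continuous L0 (hf_smooth i).
Qed.

Lemma measurable_oracle_coord (dX : measure_display) (X : measurableType dX)
    (Y : X -> 'rV[R]_d) (z : X -> Z) i j :
  (forall k, measurable_fun setT (fun x => Y x 0 k)) -> measurable_fun setT z ->
  measurable_fun setT (fun x => g i (Y x) (z x) 0 j).
Proof.
move=> mY mz; have mYz : measurable_fun setT
    (fun x => (Y x, z x) : g_sigma_algebraType (@coord_cylinders R d) * Z).
  by apply: measurable_fun_pair => //; exact: measurable_coord_cylinders.
exact: (measurableT_comp (hg i j) mYz).
Qed.

Lemma L2mx_stack_grad (Y : T -> 'M[R]_(N, d)) :
  L2mx P Y -> L2mx P (fun omega => stack_grad (Y omega)).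
Proof.
move=> hY; apply: (L2mx_le (Y := fun omega => 2 * (L ^+ 2 * sqnorm (Y omega)) +
    2 * sqnorm (stack_grad 0))).
- move=> i j; under eq_fun do rewrite stack_gradE; apply: measurable_grad_coord => j'.
  by under eq_fun do rewrite mxE; have [] := hY i j'.
- move=> omega; rewrite -{1}[stack_grad (Y omega)](subrK (stack_grad 0)).
  apply: le_trans (sqnormD_le _ _) _; rewrite lerD2r ler_pM2l//.
  by apply: le_trans (stack_grad_lipschitz _ _) _; rewrite subr0.
- by apply: L1D; [do 2 apply: L1Z; exact: L1_sqnorm|exact: L1_cst].
Qed.

Section filtration.
Variable D : set ('I_N * nat).

(** [D] is left free: predictability asks only that it contain the steps before k, while
    independence of w_i^(k) holds for the larger set [others i k], which includes the other nodes at
    step k. *)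
Definition noise_events : set (set T) :=
  \bigcup_(p in D) preimage_set_system setT (w p.1 p.2) measurable.

Lemma noise_events_measurable : measurable_fun setT (id : T -> g_sigma_algebraType noise_events).
Proof.
move=> _ B mB; rewrite setTI preimage_id; apply: smallest_sub mB.
  exact: sigma_algebra_measurable.
by move=> _ [p _ [C mC <-]]; rewrite setTI -[X in measurable X]setTI; exact: measurable_funPT.
Qed.

Lemma measurable_noise i k : D (i, k) ->
  measurable_fun setT (w i k : g_sigma_algebraType noise_events -> Z).
Proof. by move=> Dik _ B mB; apply: sub_sigma_algebra; exists (i, k) => //; exists B. Qed.

Let mD (X : T -> R) :=
  measurable_fun setT (X : g_sigma_algebraType noise_events -> R).

Lemma measurable_state k : (forall j t, (t < k)%N -> D (j, t)) ->
  forall i j, mD (fun omega => (state k omega).1 i j) /\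
              mD (fun omega => (state k omega).2 i j).
Proof.
elim: k => [_ i j|k IH hD i j]; first by split; exact: measurable_cst.
have {}IH := IH (fun j t tk => hD j t (ltnW tk)).
split; last by have [] := IH i j.
have my i' j' : mD (fun omega => y k omega i' j').
  rewrite /mD /y /extrapolate; under eq_fun do rewrite !mxE.
  apply: measurable_funB; apply: measurable_funM; try exact: measurable_cst.
    by have [] := IH i' j'.
  by have [] := IH i' j'.
rewrite /mD /state /= -/(state k); under eq_fun do rewrite !mxE.
apply: measurable_funB; last first.
  apply: measurable_funM; first exact: measurable_cst.
  apply: measurable_oracle_coord; last by apply: measurable_noise; exact: hD.
  by move=> j'; under eq_fun do rewrite mxE; exact: my.
apply: (@measurable_sum _ (g_sigma_algebraType noise_events) R setT _ (index_enum _)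
  (fun k' omega => W i k' * y k omega k' j)) => k'.
by apply: measurable_funM; [exact: measurable_cst|exact: my].
Qed.

Lemma measurable_y k : (forall j t, (t < k)%N -> D (j, t)) ->
  forall i j, mD (fun omega => y k omega i j).
Proof.
move=> hD i j; rewrite /mD /y /extrapolate; under eq_fun do rewrite !mxE.
have [m1 m2] := measurable_state hD i j.
by apply: measurable_funB; apply: measurable_funM => //; exact: measurable_cst.
Qed.

Lemma measurable_grad_noise k i j : (forall j t, (t < k)%N -> D (j, t)) -> D (i, k) ->
  mD (fun omega => grad_noise k omega i j).
Proof.
move=> hD Dik; rewrite /mD; under eq_fun do rewrite noiseE.
have my j' : mD (fun omega => row i (y k omega) 0 j').
  by rewrite /mD; under eq_fun do rewrite mxE; exact: measurable_y.
apply: measurable_funB; last exact: measurable_grad_coord.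
by apply: measurable_oracle_coord => //; exact: measurable_noise.
Qed.

End filtration.

Hypothesis hub : unbiased_bounded_variance f g w sigma (fun i k omega => row i (y k omega)).

Definition others i k : set ('I_N * nat) :=
  [set p | (p.2 < k)%N \/ p.2 = k /\ p.1 <> i].

Lemma L1_noise_coord i k j : L1 P (fun omega => grad_noise k omega i j).
Proof.
under eq_fun do rewrite noiseE.
by have [i1 i2 _ _] := hub.1 i k j; exact: L1B.
Qed.

Lemma L1_sqnorm_noise i k : L1 P (fun omega => sqnorm (row i (grad_noise k omega))).
Proof.
under eq_fun do rewrite row_grad_noise.
by have [V [[i1 _ _ _] _]] := hub.2 i k.
Qed.

Lemma L2mx_noise k : L2mx P (grad_noise k).
Proof.
apply: (L2mx_le (Y := fun omega => \sum_i sqnorm (row i (grad_noise k omega)))).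
- by move=> i j; apply: L1_measurable; exact: L1_noise_coord.
- by move=> omega; rewrite -sqnorm_rows.
- by apply: L1_sum => i; exact: L1_sqnorm_noise.
Qed.

Lemma Ex_sqnorm_noise i k :
  Ex P (fun omega => sqnorm (row i (grad_noise k omega))) <= sigma ^+ 2.
Proof.
have [V [[i1 i2 mV hV] Vs]] := hub.2 i k.
have -> : Ex P (fun omega => sqnorm (row i (grad_noise k omega))) = Ex P V.
  rewrite /Ex /Rintegral; congr fine; rewrite -[RHS]hV.
    by apply: eq_integral => omega _; rewrite row_grad_noise.
  exact: (@measurableT _ (g_sigma_algebraType _)).
(* The version [V] may be negative or exceed sigma^2 on a null set. Its positive part makes the
   almost-everywhere comparison of nonnegative integrands applicable. *)
have mVp : measurable_fun setT (fun omega => Num.max (V omega) 0).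
  by apply: measurable_maxr; [exact: L1_measurable i2|exact: measurable_cst].
have i3 : L1 P (fun omega => Num.max (V omega) 0).
  have [_ iV] := integrableP _ _ _ i2.
  apply: (L1_le (Y := fun omega => `|V omega|)) => //.
    by move=> omega; rewrite maxEle; case: ifP; rewrite ?normr0.
  by have := integrable_abse i2; apply: eq_integrable.
apply: (@le_trans _ _ (Ex P (fun omega => Num.max (V omega) 0))).
  by apply: le_Ex => // omega; rewrite le_max lexx.
have -> : sigma ^+ 2 = Ex P (fun=> sigma ^+ 2) by rewrite Ex_cst.
rewrite /Ex /Rintegral; apply: fine_le.
- exact: integrable_fin_num.
- by apply: integrable_fin_num => //; exact: L1_cst.
apply: ae_ge0_le_integral => //.
- by move=> omega _; rewrite lee_fin le_max lexx orbT.
- exact/measurable_EFinP.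
- by move=> omega _; rewrite lee_fin sqr_ge0.
- by apply: filterS Vs => omega h _; rewrite lee_fin ge_max h sqr_ge0.
Qed.

(** An instance of [orthogonal_independent]: [V] is the identity of the sample space onto its copy
    with the smaller sigma-algebra, so any function measurable for that sigma-algebra is a function
    of [V], and in particular y_i^(k) is. *)
Lemma noise_orthogonal i k j (H : T -> R) :
  measurable_fun setT (H : g_sigma_algebraType (noise_events (others i k)) -> R) ->
  L2 P H -> Ex P (fun omega => grad_noise k omega i j * H omega) = 0.
Proof.
move=> mH H2; pose past := g_sigma_algebraType (noise_events (others i k)).
pose V : {RV P >-> past} := mfun_Sub (mem_set (@noise_events_measurable (others i k))).
have past_lt : forall j t, (t < k)%N -> others i k (j, t) by move=> j' t tk; left.
have my j' : measurable_fun setT (fun omega : past => row i (y k omega) 0 j').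
  by under eq_fun do rewrite mxE; exact: measurable_y.
have mphi := measurable_coord_cylinders my.
have mU : measurable_fun setT
    (fun omega : T => row i (y k omega) : g_sigma_algebraType (@coord_cylinders R d)).
  exact: (measurableT_comp mphi (@noise_events_measurable (others i k))).
pose U : {RV P >-> _} := mfun_Sub (mem_set mU).
pose h (p : g_sigma_algebraType (@coord_cylinders R d) * Z) : R :=
  g i p.1 p.2 0 j - grad (f i) p.1 0 j.
have mh : measurable_fun setT h.
  apply: measurable_funB; first exact: hg.
  apply: measurable_grad_coord => j'.
  exact: (measurableT_comp (measurable_coord j')).
have hE omega : h (U omega, w i k omega) = grad_noise k omega i j by rewrite noiseE.
have Vw : independent_elements V (w i k).
  move=> A B mA mB; rewrite setIC [RHS]muleC; apply: hw => //.
have ih : L1 P (fun omega => h (U omega, w i k omega)).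
  by under eq_fun do rewrite hE; exact: L1_noise_coord.
have ihH : L1 P (fun omega => h (U omega, w i k omega) * H (V omega)).
  by under eq_fun do rewrite hE; apply: L2M => //; exact: L2mx_noise.
have h0 A : measurable A ->
    (\int[P]_(omega in U @^-1` A) (h (U omega, w i k omega))%:E = 0)%E.
  move=> mA; have [i1 i2 _ hA] := hub.1 i k j.
  have mUA : measurable (U @^-1` A).
    by rewrite -[X in measurable X]setTI; exact: measurable_funPT.
  rewrite /h; under eq_integral do rewrite EFinB.
  rewrite integralB//; last 2 first.
  - exact: integrableS i1.
  - exact: integrableS i2.
  rewrite hA ?subee//.
    by apply: integrable_fin_num => //; exact: integrableS i2.
  (* The event that [U] lies in A belongs to the sigma-algebra generated by the coordinates of
     y_i^(k), over which the conditional mean is prescribed. *)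
  pose TU := g_sigma_algebraType (\big[setU/set0]_(j' < d)
    preimage_set_system setT (fun omega : T => row i (y k omega) 0 j') measurable).
  have mc j' : measurable_fun setT (fun omega : TU => row i (y k omega) 0 j').
    by move=> _ B mB; apply: sub_sigma_algebra; rewrite (bigD1 j')//=; left; exists B.
  have := measurable_coord_cylinders mc measurableT mA.
  by rewrite setTI.
have := orthogonal_independent (U := U) (V := V) (fun=> erefl) mphi Vw mh mH ih ihH h0.
rewrite /Ex /Rintegral => e.
by rewrite -[RHS]/(fine 0%E) -e; congr fine; apply: eq_integral => omega _; rewrite hE.
Qed.

Lemma L2mx_state k : L2mx P (fun omega => (state k omega).1) /\
  L2mx P (fun omega => (state k omega).2).
Proof.
elim: k => [|k [IH1 IH2]]; first by split; exact: L2mx_cst.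
split=> //.
have hy : L2mx P (y k) by apply: L2mxB; exact: L2mxZ.
rewrite /state /= -/(state k).
have -> : (fun omega => W *m extrapolate beta (state k omega) -
    alpha *: stack_oracle g w omega k (extrapolate beta (state k omega))) =
  (fun omega => W *m y k omega - alpha *: (grad_noise k omega + stack_grad (y k omega))).
  by apply/funext => omega; rewrite /grad_noise subrK.
apply: L2mxB; first exact: L2mx_mul.
apply: L2mxZ; apply: L2mxD; first exact: L2mx_noise.
exact: L2mx_stack_grad.
Qed.

Lemma L2mx_y k : L2mx P (y k).
Proof. by have [h1 h2] := L2mx_state k; apply: L2mxB; exact: L2mxZ. Qed.

End stochastic_iterates.

(** * Energies on the network *)

Section network_energy.
Context {R : realType} {N d : nat}.
Implicit Types (X Y A : 'M[R]_(N, d)) (x : 'rV[R]_d).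
Hypothesis N0 : (0 < N)%N.

Let NR : N%:R != 0 :> R.
Proof. by rewrite pnatr_eq0 -lt0n. Qed.

Let NR0 : 0 < N%:R :> R.
Proof. by rewrite ltr0n. Qed.

Lemma node_avgE X j : node_avg X 0 j = N%:R^-1 * \sum_i X i j.
Proof.
by rewrite /node_avg mxE summxE; congr (_ * _); apply: eq_bigr => i _; rewrite mxE.
Qed.

Lemma node_avgD X Y : node_avg (X + Y) = node_avg X + node_avg Y.
Proof.
by apply/rowP => j; rewrite [RHS]mxE !node_avgE -mulrDr -big_split; congr (_ * _);
  apply: eq_bigr => i _; rewrite mxE.
Qed.

Lemma node_avgZ (c : R) X : node_avg (c *: X) = c *: node_avg X.
Proof.
apply/rowP => j; rewrite [RHS]mxE !node_avgE [RHS]mulrCA.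
congr (_ * _); rewrite mulr_sumr.
by apply: eq_bigr => i _; rewrite mxE.
Qed.

Lemma node_avgB X Y : node_avg (X - Y) = node_avg X - node_avg Y.
Proof. by rewrite node_avgD -scaleN1r node_avgZ scaleN1r. Qed.

Lemma node_avg_replicate x : node_avg (replicate N x) = x.
Proof.
apply/rowP => j; rewrite node_avgE.
under eq_bigr do rewrite mxE.
by rewrite sumr_const card_ord -[x 0 j *+ N]mulr_natl mulKf.
Qed.

Lemma row_replicate x i : row i (replicate N x) = x.
Proof. by apply/rowP => j; rewrite !mxE. Qed.

Lemma sqnorm_node_avg_le X : sqnorm (node_avg X) <= N%:R^-1 * sqnorm X.
Proof.
rewrite /node_avg sqnormZ [sqnorm X]sqnorm_rows.
have := @sqnorm_sum_le R 1 d N (fun i => row i X).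
have i2 : 0 <= N%:R^-1 ^+ 2 :> R by exact: sqr_ge0.
move=> /(ler_wpM2l i2) /le_trans; apply.
by rewrite mulrA expr2 -(mulrA N%:R^-1) mulVf// mulr1.
Qed.

Lemma dotmx_node_avg X x : dotmx (node_avg X) x = N%:R^-1 * dotmx X (replicate N x).
Proof.
rewrite /node_avg dotmxZl dotmx_suml [in RHS]dotmx_rows; congr (_ * _).
by apply: eq_bigr => i _; rewrite row_replicate.
Qed.

Definition disagreement X := X - replicate N (node_avg X).

Lemma replicateD x y : replicate N (x + y) = replicate N x + replicate N y.
Proof. by apply/matrixP => i j; rewrite !mxE. Qed.

Lemma replicateZ (c : R) x : replicate N (c *: x) = c *: replicate N x.
Proof. by apply/matrixP => i j; rewrite !mxE. Qed.

Lemma disagreementD X Y : disagreement (X + Y) = disagreement X + disagreement Y.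
Proof.
by rewrite /disagreement node_avgD replicateD; apply/matrixP => i j; rewrite !mxE; ring.
Qed.

Lemma disagreementZ (c : R) X : disagreement (c *: X) = c *: disagreement X.
Proof.
by rewrite /disagreement node_avgZ replicateZ; apply/matrixP => i j; rewrite !mxE; ring.
Qed.

Lemma disagreement0 : disagreement 0 = 0.
Proof. by have := disagreementZ 0 0; rewrite !scale0r. Qed.

Lemma sum_disagreement X j : \sum_i disagreement X i j = 0.
Proof.
have dE i : disagreement X i j = X i j - node_avg X 0 j by rewrite !mxE.
under eq_bigr do rewrite dE.
rewrite sumrB sumr_const card_ord node_avgE.
by rewrite -[_ *+ N]mulr_natl mulVKf ?subrr.
Qed.

(** Pythagoras: the disagreement is orthogonal to stacks of identical rows. *)
Lemma sqnorm_disagreement_le X : sqnorm (disagreement X) <= sqnorm X.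
Proof.
have e : sqnorm X = sqnorm (disagreement X) + N%:R * sqnorm (node_avg X).
  have -> : N%:R * sqnorm (node_avg X) = sqnorm (replicate N (node_avg X)).
    rewrite [RHS]sqnorm_rows; under eq_bigr do rewrite row_replicate.
    by rewrite sumr_const card_ord mulr_natl.
  rewrite -{1}[X](subrK (replicate N (node_avg X))) sqnormD -/(disagreement X).
  rewrite [dotmx _ _](_ : _ = 0) ?mulr0 ?addr0//.
  have := dotmx_node_avg (disagreement X) (node_avg X).
  rewrite {1}/disagreement node_avgB node_avg_replicate subrr dotmx0l.
  by move=> /esym/eqP; rewrite mulf_eq0 invr_eq0 (negbTE NR) => /eqP.
by rewrite e lerDl mulr_ge0// sqnorm_ge0.
Qed.

Section mixing.
Variables (E : rel 'I_N) (W : 'M[R]_N).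
Hypothesis hW : mixing_matrix E W.

Lemma node_avg_mix X : node_avg (W *m X) = node_avg X.
Proof.
have [_ [_ _ c1] _ _ _] := hW.
apply/rowP => j; rewrite !node_avgE; congr (_ * _).
under eq_bigr do rewrite mxE.
rewrite exchange_big; apply: eq_bigr => i _.
by rewrite -mulr_suml c1 mul1r.
Qed.

Lemma mix_replicate x : W *m replicate N x = replicate N x.
Proof.
have [_ [_ r1 _] _ _ _] := hW.
apply/matrixP => i j; rewrite !mxE.
under eq_bigr do rewrite mxE.
by rewrite -mulr_suml r1 mul1r.
Qed.

Lemma disagreement_mix X : disagreement (W *m X) = W *m disagreement X.
Proof. by rewrite /disagreement node_avg_mix mulmxBr mix_replicate. Qed.

(** By symmetry of W, the columns of [W *m X] are the columns of X, read as row vectors, times W.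
    This carries the facts on row vectors over to stacked variables. *)
Lemma row_tr_mix X j : row j (W *m X)^T = row j X^T *m W.
Proof.
have [sW _ _ _ _] := hW.
by rewrite trmx_mul sW row_mul.
Qed.

Lemma sqnorm_mix_le X : sqnorm (W *m X) <= sqnorm X.
Proof.
rewrite sqnorm_cols [leRHS]sqnorm_cols; apply: ler_sum => j _.
by rewrite row_tr_mix; exact: stochastic_contract hW _.
Qed.

Lemma sqnorm_mix_disagreement (rho : R) X :
  (forall v : 'rV[R]_N, \sum_j v 0 j = 0 -> sqnorm (v *m W) <= rho * sqnorm v) ->
  sqnorm (W *m disagreement X) <= rho * sqnorm (disagreement X).
Proof.
move=> hrho; rewrite sqnorm_cols [sqnorm (disagreement X)]sqnorm_cols mulr_sumr.
apply: ler_sum => j _; rewrite row_tr_mix; apply: hrho.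
have trE i : row j (disagreement X)^T 0 i = disagreement X i j by rewrite !mxE.
by under eq_bigr do rewrite trE; exact: sum_disagreement.
Qed.

Lemma dotmx_mix_sym X Y : dotmx X (W *m Y) = dotmx (W *m X) Y.
Proof.
have [sW _ _ _ _] := hW.
rewrite -dotmx_tr dotmx_rows -[RHS]dotmx_tr [RHS]dotmx_rows.
by apply: eq_bigr => j _; rewrite !row_tr_mix dotmx_sym.
Qed.

Lemma dotmx_mix_le X : dotmx X (W *m X) <= sqnorm X.
Proof.
have := dotmx_young X (W *m X) ltr01; have := sqnorm_mix_le X.
rewrite mulr1 mul1r; lra.
Qed.

Lemma dotmx_mix_ge (a : R) X :
  (forall v : 'rV[R]_N, a * sqnorm v <= dotmx (v *m W) v) ->
  a * sqnorm X <= dotmx X (W *m X).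
Proof.
move=> ha; rewrite sqnorm_cols -dotmx_tr dotmx_rows mulr_sumr.
by apply: ler_sum => j _; rewrite row_tr_mix dotmxC.
Qed.

Variables (mu L alpha a : R) (f : 'I_N -> 'rV[R]_d -> R).
Hypotheses (L0 : 0 < L) (alpha0 : 0 < alpha).
Hypothesis hf_convex : forall i, strongly_convex mu (f i).
Hypothesis hf_smooth : forall i, lipschitz_gradient L (f i).
Hypothesis ha : forall v : 'rV[R]_N, a * sqnorm v <= dotmx (v *m W) v.

Definition penalized_grad X := stack_grad f X + alpha^-1 *: (X - W *m X).

(** The penalty is quadratic, so its expansion at Y is exact, with remainder q(X - Y) / (2 alpha)
    and 0 <= q <= (1 - a) |X - Y|^2. The remaining terms come from the f_i, row by row. *)
Lemma penalized_sandwiched :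
  sandwiched mu ((1 - a) / alpha + L) (penalized f W alpha) penalized_grad.
Proof.
move=> X Y; pose q A := dotmx A ((1%:M - W) *m A).
have qE A : q A = sqnorm A - dotmx A (W *m A).
  by rewrite /q mulmxBl mul1mx dotmxDr dotmxNr.
have hs : sum_fun f Y + dotmx (stack_grad f Y) (X - Y) + mu / 2 * sqnorm (X - Y)
      <= sum_fun f X /\
    sum_fun f X <= sum_fun f Y + dotmx (stack_grad f Y) (X - Y) + L / 2 * sqnorm (X - Y).
  have sw i := strongly_convex_sandwiched L0 (hf_convex i) (hf_smooth i) (row i X) (row i Y).
  rewrite /sum_fun dotmx_rows sqnorm_rows !mulr_sumr -!big_split /=.
  split; apply: ler_sum => i _; rewrite row_stack_grad !raddfB /=.
    by have [] := sw i.
  by have [] := sw i.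
have q0 : 0 <= q (X - Y) by rewrite qE subr_ge0 dotmx_mix_le.
have q1 : q (X - Y) <= (1 - a) * sqnorm (X - Y).
  by rewrite qE; have := dotmx_mix_ge (X - Y) ha; lra.
have eq : penalized f W alpha X - sum_fun f X = penalized f W alpha Y - sum_fun f Y
    + dotmx (alpha^-1 *: (Y - W *m Y)) (X - Y) + (2 * alpha)^-1 * q (X - Y).
  rewrite /penalized div1r -!/(q _) !qE mulmxBr /sqnorm !dotmxE.
  rewrite (dotmxC Y X) (dotmxC (W *m Y) X) (dotmxC (W *m Y) Y) (dotmxC Y (W *m X)).
  rewrite -(dotmx_mix_sym X Y); field; rewrite gt_eqF//.
have i0 : 0 <= (2 * alpha)^-1 by rewrite invr_ge0 mulr_ge0// ltW.
have h1 := mulr_ge0 i0 q0; have h2 := ler_wpM2l i0 q1.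
have h3 : (2 * alpha)^-1 * ((1 - a) * sqnorm (X - Y)) =
  (1 - a) / alpha / 2 * sqnorm (X - Y) by field; rewrite gt_eqF.
rewrite /penalized_grad dotmxDl; case: hs; rewrite h3 in h2; split; lra.
Qed.

Definition avg_grad x := N%:R^-1 *: \sum_i grad (f i) x.

Lemma avg_gradE x : avg_grad x = node_avg (stack_grad f (replicate N x)).
Proof.
rewrite /avg_grad /node_avg; congr (_ *: _); apply: eq_bigr => i _.
by rewrite row_stack_grad row_replicate.
Qed.

Lemma avg_sandwiched : sandwiched mu L (avg_fun f) avg_grad.
Proof.
move=> x y; have i0 : 0 < N%:R^-1 :> R by rewrite invr_gt0.
have sw i := strongly_convex_sandwiched L0 (hf_convex i) (hf_smooth i) x y.
have cst (c : R) : c = N%:R^-1 * \sum_(i < N) c.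
  by rewrite sumr_const card_ord -[c *+ N]mulr_natl mulKf.
rewrite /avg_grad dotmxZl dotmx_suml (cst (mu / 2 * _)) (cst (L / 2 * _)) /avg_fun.
rewrite -!mulrDr -!big_split /= !ler_pM2l//.
by split; apply: ler_sum => i _; have [] := sw i.
Qed.

End mixing.

End network_energy.

(** The vector v of the statement is r (1, s - 1) with r = 1 / sqrt(2 alpha), because sqrt(mu / 2) =
    s r. The rank-one quadratic form is therefore a single square. *)
Lemma quad_blocks_energy {R : realType} m n (mu alpha : R) (u v : 'M[R]_(m, n)) :
  0 < mu -> 0 < alpha ->
  quad_blocks (Smat mu alpha) u v =
    (2 * alpha)^-1 * sqnorm (u - (1 - Num.sqrt (alpha * mu)) *: v).
Proof.
move=> mu0 alpha0; set s := Num.sqrt _; set r := Num.sqrt (1 / (2 * alpha)).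
have a2 : 0 < 2 * alpha by rewrite mulr_gt0.
have r2 : r ^+ 2 = (2 * alpha)^-1 by rewrite sqr_sqrtr div1r// invr_ge0 ltW.
have v0 : Svec mu alpha 0 0 = r by rewrite mxE eqxx /r !div1r sqrtrV// ltW.
have v1 : Svec mu alpha 1 0 = (s - 1) * r.
  rewrite mxE /= -/r mulrBl mul1r; congr (_ - _).
  rewrite /s /r -sqrtrM ?mulr_ge0 ?ltW//; congr Num.sqrt.
  by field; rewrite gt_eqF.
have SE i j : Smat mu alpha i j = Svec mu alpha i 0 * Svec mu alpha j 0.
  by rewrite mxE big_ord1 [_^T _ _]mxE.
rewrite /quad_blocks !SE v0 v1 -r2 /sqnorm !dotmxE (dotmxC v u); ring.
Qed.

(** * Energy recursions, with and without bias *)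

Lemma recursion_bound {R : realFieldType} (a : nat -> R) (q b : R) k :
  0 <= q -> q < 1 -> 0 <= b -> (forall k, a k.+1 <= q * a k + b) ->
  a k <= q ^+ k * a 0 + b / (1 - q).
Proof.
move=> q0 q1 b0 h; have q10 : 0 < 1 - q by rewrite subr_gt0.
elim: k => [|k IH]; first by rewrite expr0 mul1r lerDl divr_ge0// ltW.
apply: le_trans (h k) _; have {IH} := ler_wpM2l q0 IH.
rewrite -(lerD2r b) => /le_trans; apply; rewrite exprS le_eqVlt; apply/orP; left.
by apply/eqP; field; rewrite gt_eqF.
Qed.

(** The perturbation splits into noise [eta], whose linear terms are kept for their zero mean, and
    bias [e], whose linear terms go through Young. The two of them cost s / 4 of the energy each,
    half of the contraction. Every coefficient left on |e|^2 carries a factor s, which the later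
    division by s / 2 removes. *)
Lemma biased_energy_step {R : realType} m n (mu L alpha s : R)
    (phi : 'M[R]_(m, n) -> R) (G : 'M[R]_(m, n) -> 'M[R]_(m, n))
    (xs x u eta e y : 'M[R]_(m, n)) :
  0 < mu -> 0 < L -> 0 < alpha -> 0 < s -> s < 1 -> s ^+ 2 = alpha * mu ->
  alpha * L <= 1 -> sandwiched mu L phi G -> (forall x, phi xs <= phi x) ->
  sqnorm (G y) <= L ^+ 2 * sqnorm (y - xs) ->
  y = extrapolate ((1 - s) / (1 + s)) (x, u) ->
  energy alpha s phi xs (y - alpha *: (G y + (eta + e))) x <=
    (1 - s / 2) * energy alpha s phi xs x u
    + dotmx eta ((alpha ^+ 2 * L) *: G y + (alpha * (1 + alpha * L)) *: e
                 - drift s xs x y)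
    + alpha / 2 * (1 + alpha * L) * sqnorm eta
    + s * (2 * L / mu ^+ 2 + 3 / mu) * sqnorm e.
Proof.
move=> mu0 L0 alpha0 s0 s1 s2 aL phiG phim Gy ye.
apply: le_trans (energy_step xs mu0 alpha0 s0 s1 s2 phiG _ ye) _.
set V := energy _ _ _ _ x u.
have V0 : 0 <= V by exact: energy_ge0.
have hD := drift_le_energy mu0 alpha0 s0 s1 s2 phiG phim x u L0.
rewrite -ye -/V in hD.
have hy := extrapolate_dist mu0 alpha0 s0 s2 phiG phim x u L0.
rewrite -ye -/V in hy.
have {}Gy : sqnorm (G y) <= L ^+ 2 * (2 / mu * V).
  by apply: le_trans Gy _; rewrite ler_pM2l// exprn_gt0.
have alphaE : alpha = s ^+ 2 / mu by rewrite s2 mulfK// gt_eqF.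
have hGe : alpha ^+ 2 * L * dotmx (G y) e <= s / 4 * V + s * (2 * L / mu ^+ 2) * sqnorm e.
  have c0 : 0 < s * mu / (4 * alpha ^+ 2 * L ^+ 3).
    by rewrite divr_gt0 ?mulr_gt0 ?exprn_gt0.
  have aL0 : 0 <= alpha ^+ 2 * L by rewrite mulr_ge0 ?sqr_ge0// ltW.
  have := ler_wpM2l aL0 (dotmx_young (G y) e c0); move=> /le_trans; apply.
  rewrite mulrDr; apply: lerD.
    have c1 : 0 <= alpha ^+ 2 * L * (s * mu / (4 * alpha ^+ 2 * L ^+ 3) / 2).
      by rewrite mulr_ge0// divr_ge0// ltW.
    rewrite mulrA; apply: le_trans (ler_wpM2l c1 Gy) _.
    rewrite le_eqVlt; apply/orP; left; apply/eqP; field.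
    by rewrite !gt_eqF.
  rewrite [leLHS]mulrA; apply: ler_wpM2r; first exact: sqnorm_ge0.
  have -> : alpha ^+ 2 * L * (2 * (s * mu / (4 * alpha ^+ 2 * L ^+ 3)))^-1 =
      2 / (s * mu) * (alpha * L) ^+ 3 * (alpha * L).
    by field; rewrite !gt_eqF.
  have -> : s * (2 * L / mu ^+ 2) = 2 / (s * mu) * 1 * (alpha * L).
    by rewrite alphaE; field; rewrite !gt_eqF.
  have aL1 : 0 <= alpha * L by rewrite mulr_ge0// ltW.
  rewrite ler_wpM2r// ler_wpM2l ?exprn_ile1// divr_ge0// mulr_ge0// ltW//.
have heD : - dotmx e (drift s xs x y) <= s / 4 * V + s * (2 / mu) * sqnorm e.
  have c0 : 0 < s / (4 * alpha) by rewrite divr_gt0// mulr_gt0.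
  rewrite dotmxC -dotmxNr; apply: le_trans (dotmx_young _ _ c0) _.
  rewrite sqnormN; apply: lerD.
    have c1 : 0 <= s / (4 * alpha) / 2 by rewrite divr_ge0// ltW.
    have := ler_wpM2l c1 hD; move=> /le_trans; apply.
    by rewrite le_eqVlt; apply/orP; left; apply/eqP; field; rewrite gt_eqF.
  rewrite le_eqVlt; apply/orP; left; apply/eqP; rewrite alphaE; field.
  by rewrite !gt_eqF.
have hee : alpha / 2 * (1 + alpha * L) * sqnorm e <= s * (1 / mu) * sqnorm e.
  rewrite ler_wpM2r ?sqnorm_ge0//; apply: (@le_trans _ _ alpha).
    by have := ler_wpM2l (ltW alpha0) aL; lra.
  rewrite alphaE mulrA mulr1 ler_pM2r ?invr_gt0// expr2 -[leRHS]mulr1.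
  by rewrite ler_pM2l// ltW.
have hG : 0 <= alpha / 2 * (1 - alpha * L) * sqnorm (G y).
  by rewrite mulr_ge0 ?sqnorm_ge0// mulr_ge0 ?subr_ge0// divr_ge0// ltW.
move: (drift s xs x y) hD heD => D _ heD.
rewrite sqnormD !dotmxE (dotmxC eta (G y)).
have -> : s * (2 * L / mu ^+ 2 + 3 / mu) * sqnorm e = s * (2 * L / mu ^+ 2) * sqnorm e
    + s * (2 / mu) * sqnorm e + s * (1 / mu) * sqnorm e by field; rewrite gt_eqF.
by move: hGe heD hee hG; lra.
Qed.

Lemma unbiased_energy_step {R : realType} m n (mu Lam alpha s : R)
    (phi : 'M[R]_(m, n) -> R) (G : 'M[R]_(m, n) -> 'M[R]_(m, n))
    (xs x u xi y : 'M[R]_(m, n)) :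
  0 < mu -> 0 < alpha -> 0 < s -> s < 1 -> s ^+ 2 = alpha * mu ->
  alpha * Lam <= 1 -> sandwiched mu Lam phi G ->
  y = extrapolate ((1 - s) / (1 + s)) (x, u) ->
  energy alpha s phi xs (y - alpha *: (G y + xi)) x <=
    (1 - s) * energy alpha s phi xs x u + alpha * sqnorm xi
    + dotmx xi ((alpha ^+ 2 * Lam) *: G y - drift s xs x y).
Proof.
move=> mu0 alpha0 s0 s1 s2 aLam sw ye.
apply: le_trans (energy_step xs mu0 alpha0 s0 s1 s2 sw xi ye) _.
move: (drift s xs x y) => D; rewrite dotmxDr dotmxNr dotmxZr (dotmxC xi (G y)).
have h1 : 0 <= alpha / 2 * (1 - alpha * Lam) * sqnorm (G y).
  by rewrite mulr_ge0 ?sqnorm_ge0// mulr_ge0 ?subr_ge0// divr_ge0// ltW.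
have h2 : alpha / 2 * (1 + alpha * Lam) * sqnorm xi <= alpha * sqnorm xi.
  rewrite ler_wpM2r ?sqnorm_ge0//.
  by have := ler_wpM2l (ltW alpha0) aLam; lra.
by move: h1 h2; lra.
Qed.

(** * Noise against predictable factors *)

Section predictable.
Context {R : realType} {N d : nat} {dT dZ : measure_display}.
Context {T : measurableType dT} {Z : measurableType dZ} (P : probability T R).
Variables (L sigma : R) (f : 'I_N -> 'rV[R]_d -> R).
Variables (w : 'I_N -> nat -> {RV P >-> Z}) (g : 'I_N -> 'rV[R]_d -> Z -> 'rV[R]_d).
Variables (W : 'M[R]_N) (alpha beta : R).
Hypothesis N0 : (0 < N)%N.
Hypothesis L0 : 0 < L.
Hypothesis hf_smooth : forall i, lipschitz_gradient L (f i).
Hypothesis hw : independent_noise w.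
Hypothesis hg : forall i, measurable_oracle (g i).

Let state k omega := dasg_state W alpha beta (0, 0) (stack_oracle g w omega) k.
Let y k omega := extrapolate beta (state k omega).

Hypothesis hub : unbiased_bounded_variance f g w sigma (fun i k omega => row i (y k omega)).

(* Square-integrable, and a function of the noise of the steps before [k]. *)
Definition predictable m n k (A : T -> 'M[R]_(m, n)) := L2mx P A /\
  forall D, (forall (j : 'I_N) t, (t < k)%N -> D (j, t)) -> forall i j,
    measurable_fun setT
      ((fun omega => A omega i j) : g_sigma_algebraType (noise_events w D) -> R).

Lemma predictableD m n k (A B : T -> 'M[R]_(m, n)) :
  predictable k A -> predictable k B -> predictable k (fun omega => A omega + B omega).
Proof.
move=> [A2 hA] [B2 hB]; split; first exact: L2mxD.
move=> D hD i j; under eq_fun do rewrite mxE.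
by apply: measurable_funD; [exact: hA|exact: hB].
Qed.

Lemma predictableZ m n k (c : R) (A : T -> 'M[R]_(m, n)) :
  predictable k A -> predictable k (fun omega => c *: A omega).
Proof.
move=> [A2 hA]; split; first exact: L2mxZ.
move=> D hD i j; under eq_fun do rewrite mxE.
by apply: measurable_funM; [exact: measurable_cst|exact: hA].
Qed.

Lemma predictableB m n k (A B : T -> 'M[R]_(m, n)) :
  predictable k A -> predictable k B -> predictable k (fun omega => A omega - B omega).
Proof.
move=> hA /(predictableZ (-1)) hB; under eq_fun do rewrite -scaleN1r.
exact: predictableD.
Qed.

Lemma predictable_cst m n k (A : 'M[R]_(m, n)) : predictable k (fun=> A).
Proof. by split=> [|D hD i j]; [exact: L2mx_cst|exact: measurable_cst]. Qed.

Lemma predictable_mul m n p k (M : 'M[R]_(p, m)) (A : T -> 'M[R]_(m, n)) :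
  predictable k A -> predictable k (fun omega => M *m A omega).
Proof.
move=> [A2 hA]; split; first exact: L2mx_mul.
move=> D hD i j; under eq_fun do rewrite mxE.
apply: (@measurable_sum _ (g_sigma_algebraType (noise_events w D)) R setT _
  (index_enum _) (fun k' omega => M i k' * A omega k' j)) => k'.
by apply: measurable_funM; [exact: measurable_cst|exact: hA].
Qed.

Lemma predictable_node_avg k (A : T -> 'M[R]_(N, d)) :
  predictable k A -> predictable k (fun omega => node_avg (A omega)).
Proof.
move=> /(predictable_mul (const_mx N%:R^-1 : 'rV[R]_N)).
suff e omega : const_mx N%:R^-1 *m A omega = node_avg (A omega).
  by under eq_fun do rewrite e.
apply/rowP => j; rewrite node_avgE mxE mulr_sumr.
by apply: eq_bigr => i _; rewrite mxE.
Qed.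

Lemma predictable_replicate k (A : T -> 'rV[R]_d) :
  predictable k A -> predictable k (fun omega => replicate N (A omega)).
Proof.
move=> [A2 hA]; split=> [i j|D hD i j].
  by under eq_fun do rewrite mxE; exact: A2.
by under eq_fun do rewrite mxE; exact: hA.
Qed.

Lemma predictable_stack_grad k (A : T -> 'M[R]_(N, d)) :
  predictable k A -> predictable k (fun omega => stack_grad f (A omega)).
Proof.
move=> [A2 hA]; split=> [|D hD i j]; first exact: (L2mx_stack_grad L0 hf_smooth).
have e omega : stack_grad f (A omega) i j = grad (f i) (row i (A omega)) 0 j.
  by rewrite mxE.
under eq_fun do rewrite e; apply: (measurable_grad_coord L0 hf_smooth) => j'.
by under eq_fun do rewrite mxE; exact: hA.
Qed.

Lemma predictable_state k : predictable k (fun omega => (state k omega).1) /\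
  predictable k (fun omega => (state k omega).2).
Proof.
have [h1 h2] := L2mx_state L0 hf_smooth hub k.
by split; split=> // D hD i j; have [] := measurable_state w W alpha beta hg hD i j.
Qed.

Lemma predictable_y k : predictable k (y k).
Proof.
by have [h1 h2] := predictable_state k; apply: predictableB; exact: predictableZ.
Qed.

Let xi k := grad_noise f w g W alpha beta k.

Lemma Ex_noise_predictable k (A : T -> 'M[R]_(N, d)) : predictable k A ->
  Ex P (fun omega => dotmx (xi k omega) (A omega)) = 0.
Proof.
move=> [A2 hA]; apply: Ex_dotmx_eq0 => i j.
  by apply: L2M => //; exact: (L2mx_noise hub).
apply: (noise_orthogonal L0 hf_smooth hw hg hub) => //.
by apply: hA => j' t tk; left.
Qed.

Lemma Ex_sqnorm_noise_stack k :
  Ex P (fun omega => sqnorm (xi k omega)) <= N%:R * sigma ^+ 2.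
Proof.
under eq_fun do rewrite sqnorm_rows.
rewrite Ex_sum; last by move=> i; exact: (L1_sqnorm_noise hub).
apply: (@le_trans _ _ (\sum_(i < N) sigma ^+ 2)).
  by apply: ler_sum => i _; exact: (Ex_sqnorm_noise hub i k).
by rewrite sumr_const card_ord mulr_natl.
Qed.

(* Distinct nodes have uncorrelated noise, so averaging divides the variance by [N]. *)
Lemma Ex_sqnorm_noise_avg k :
  Ex P (fun omega => sqnorm (node_avg (xi k omega))) <= N%:R^-1 * sigma ^+ 2.
Proof.
have xi2 := L2mx_noise hub k.
have dotE i i' omega : dotmx (row i (xi k omega)) (row i' (xi k omega)) =
    \sum_j xi k omega i j * xi k omega i' j.
  by rewrite dotrV; apply: eq_bigr => j _; rewrite [row i _ _ _]mxE [row i' _ _ _]mxE.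
have i1 i i' j : L1 P (fun omega => xi k omega i j * xi k omega i' j) by exact: L2M.
have cross i i' : i' != i ->
    Ex P (fun omega => dotmx (row i (xi k omega)) (row i' (xi k omega))) = 0.
  move=> ii'; under eq_fun do rewrite dotE.
  rewrite (@Ex_sum _ _ _ _ _ (fun j omega => xi k omega i j * xi k omega i' j))//.
  rewrite big1// => j _; apply: (noise_orthogonal L0 hf_smooth hw hg hub) => //.
  have hD j' t : (t < k)%N -> others i k (j', t) by left.
  (* This is where the noise of another node at the same step counts as known for node i. *)
  have Dk : others i k (i', k) by right; split=> //; apply/eqP.
  exact: (measurable_grad_noise W alpha beta L0 hf_smooth hg j hD Dk).
have nE omega : sqnorm (node_avg (xi k omega)) = N%:R^-1 ^+ 2 *
    \sum_i \sum_i' dotmx (row i (xi k omega)) (row i' (xi k omega)).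
  rewrite /node_avg sqnormZ /sqnorm dotmx_suml; congr (_ * _).
  by apply: eq_bigr => i _; rewrite dotmxC dotmx_suml; apply: eq_bigr => i' _; rewrite dotmxC.
have i2 i i' : L1 P (fun omega => dotmx (row i (xi k omega)) (row i' (xi k omega))).
  by apply: L1_dotmx; exact: L2mx_row.
under eq_fun do rewrite nE.
rewrite ExZ; last by apply: L1_sum => i; apply: L1_sum.
rewrite Ex_sum; last by move=> i; apply: L1_sum.
under eq_bigr => i _.
  rewrite Ex_sum// (bigD1 i)//= big1 ?addr0; last by move=> i' /cross.
  over.
rewrite expr2 -mulrA ler_pM2l ?invr_gt0 ?ltr0n//.
rewrite ler_pdivrMl ?ltr0n//.
apply: (@le_trans _ _ (\sum_(i < N) sigma ^+ 2)).
  by apply: ler_sum => i _; exact: (Ex_sqnorm_noise hub i k).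
by rewrite sumr_const card_ord mulr_natl.
Qed.

End predictable.

(** * Expected descent *)

Section expected_descent.
Context {R : realType} {N d : nat} {dT dZ : measure_display}.
Context {T : measurableType dT} {Z : measurableType dZ} (P : probability T R).
Variables (mu L sigma : R) (f : 'I_N -> 'rV[R]_d -> R) (E : rel 'I_N).
Variables (w : 'I_N -> nat -> {RV P >-> Z}) (g : 'I_N -> 'rV[R]_d -> Z -> 'rV[R]_d).
Variables (W : 'M[R]_N) (alpha s a rho : R).
Hypothesis N0 : (0 < N)%N.
Hypotheses (mu0 : 0 < mu) (L0 : 0 < L).
Hypothesis hf_convex : forall i, strongly_convex mu (f i).
Hypothesis hf_smooth : forall i, lipschitz_gradient L (f i).
Hypothesis hW : mixing_matrix E W.
Hypothesis ha : forall v : 'rV[R]_N, a * sqnorm v <= dotmx (v *m W) v.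
Hypotheses (rho0 : 0 < rho) (rho1 : rho < 1).
Hypothesis hrho : forall v : 'rV[R]_N, \sum_j v 0 j = 0 -> sqnorm (v *m W) <= rho * sqnorm v.
Hypothesis hw : independent_noise w.
Hypothesis hg : forall i, measurable_oracle (g i).
Hypotheses (alpha0 : 0 < alpha) (s0 : 0 < s) (s1 : s < 1) (s2 : s ^+ 2 = alpha * mu).
Hypotheses (aL : alpha * L <= a) (a1 : a <= 1).

Let beta := (1 - s) / (1 + s).
Let state k omega := dasg_state W alpha beta (0, 0) (stack_oracle g w omega) k.
Let y k omega := extrapolate beta (state k omega).
Let xi k := grad_noise f w g W alpha beta k.

Hypothesis hub : unbiased_bounded_variance f g w sigma (fun i k omega => row i (y k omega)).

(** f_i differs from its affine part at 0 by a quantity between 0 and L / 2 |Y|^2. *)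
Lemma L1_objective i (Y : T -> 'rV[R]_d) : L2mx P Y -> L1 P (fun omega => f i (Y omega)).
Proof.
move=> hY; have mf : measurable_fun setT (fun omega => f i (Y omega)).
  apply: (measurable_continuous_coords (phi := f i)); last first.
    by move=> j; have [] := hY 0 j.
  by move=> v; apply: differentiable_continuous; exact: (hf_smooth i).1.
have i1 : L1 P (fun omega => f i 0 + dotmx (grad (f i) 0) (Y omega)).
  by apply: L1D; [exact: L1_cst|apply: L1_dotmx => //; exact: L2mx_cst].
have mr := measurable_funB mf (L1_measurable i1).
have i2 : L1 P (fun omega => f i (Y omega) - (f i 0 + dotmx (grad (f i) 0) (Y omega))).
  apply: (L1_le (Y := fun omega => L / 2 * sqnorm (Y omega))) => // [omega|]; last first.
    by apply: L1Z; exact: L1_sqnorm.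
  have := strongly_convex_sandwiched L0 (hf_convex i) (hf_smooth i) (Y omega) 0.
  rewrite subr0 => -[h1 h2]; rewrite ger0_norm; first by move: h2; lra.
  have : 0 <= mu / 2 * sqnorm (Y omega).
    by rewrite mulr_ge0 ?sqnorm_ge0// divr_ge0// ltW.
  by move: h1; lra.
by have := L1D i2 i1; under eq_fun do rewrite subrK.
Qed.

Let beta_nneg : 0 <= beta <= 1.
Proof.
rewrite /beta divr_ge0 ?subr_ge0 ?addr_ge0 ?(ltW s0) ?(ltW s1)//=.
by rewrite ler_pdivrMr ?addr_gt0// mul1r lerD2l (le_trans _ (ltW s0))// oppr_le0 ltW.
Qed.

Let stateS k omega : state k.+1 omega =
  (W *m y k omega - alpha *: (stack_grad f (y k omega) + xi k omega), (state k omega).1).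
Proof. by rewrite /xi /grad_noise [stack_grad _ _ + _]addrC subrK. Qed.

Let st2 k : L2mx P (fun omega => (state k omega).1) /\
  L2mx P (fun omega => (state k omega).2).
Proof. exact: (L2mx_state L0 hf_smooth hub). Qed.

Let xi2 k : L2mx P (xi k).
Proof. exact: (L2mx_noise hub). Qed.

Section penalized_descent.
Variable xinf : 'M[R]_(N, d).
Hypothesis xinf_min : forall X, penalized f W alpha xinf <= penalized f W alpha X.

Let Lam := (1 - a) / alpha + L.
Let phi := penalized f W alpha.
Let G := penalized_grad W alpha f.
Let V k omega := energy alpha s phi xinf (state k omega).1 (state k omega).2.

Let Lam0 : 0 < Lam.
Proof. by rewrite ltr_wpDl// divr_ge0 ?subr_ge0// ltW. Qed.

Let aLam : alpha * Lam <= 1.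
Proof.
have -> : alpha * Lam = 1 - a + alpha * L by rewrite /Lam; field; rewrite gt_eqF.
by move: aL; lra.
Qed.

Let sw : sandwiched mu Lam phi G.
Proof. exact: (penalized_sandwiched hW L0 alpha0 hf_convex hf_smooth ha). Qed.

Lemma L1_penalized_energy k : L1 P (V k).
Proof.
have [h1 h2] := st2 k; apply: L1D.
  apply: L1B; last exact: L1_cst.
  apply: L1D; first by apply: L1Z; apply: L1_dotmx => //; exact: L2mx_mul.
  by apply: L1_sum => i; apply: L1_objective; exact: L2mx_row.
apply: L1Z; apply: L1_sqnorm; apply: L2mxB; first by apply: L2mxB => //; exact: L2mx_cst.
by apply: L2mxZ; apply: L2mxB => //; exact: L2mx_cst.
Qed.

Lemma penalized_energy_step k :
  Ex P (V k.+1) <= (1 - s) * Ex P (V k) + alpha * (N%:R * sigma ^+ 2).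
Proof.
have [p1 p2] := predictable_state L0 hf_smooth hg hub k.
have py := predictable_y L0 hf_smooth hg hub k.
pose A omega := (alpha ^+ 2 * Lam) *: G (y k omega)
  - drift s xinf (state k omega).1 (y k omega).
have pA : predictable w k A.
  apply: predictableB.
    apply: predictableZ; apply: predictableD; first exact: (predictable_stack_grad L0 hf_smooth).
    by apply: predictableZ; apply: predictableB => //; exact: predictable_mul.
  apply: predictableB; first by apply: predictableB => //; exact: predictable_cst.
  by apply: predictableZ; apply: predictableB => //; exact: predictable_cst.
have step omega : V k.+1 omega <= (1 - s) * V k omega + alpha * sqnorm (xi k omega)
    + dotmx (xi k omega) (A omega).
  have e : (state k.+1 omega).1 = y k omega - alpha *: (G (y k omega) + xi k omega).
    rewrite stateS /= /G /penalized_grad; apply/matrixP => i j; rewrite !mxE.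
    by field; rewrite gt_eqF.
  rewrite /V e stateS /=.
  have ye : y k omega = extrapolate ((1 - s) / (1 + s)) ((state k omega).1, (state k omega).2).
    by rewrite /y; case: (state k omega).
  exact: (unbiased_energy_step xinf (xi k omega) mu0 alpha0 s0 s1 s2 aLam sw ye).
have iV := L1_penalized_energy k; have ixi := L1_sqnorm (xi2 k).
have iA : L1 P (fun omega => dotmx (xi k omega) (A omega)) by apply: L1_dotmx => //; exact: pA.1.
apply: le_trans (le_Ex (L1_penalized_energy k.+1) (L1D (L1D (L1Z _ iV) (L1Z _ ixi)) iA) step) _.
rewrite ExD//; last by apply: L1D; exact: L1Z.
rewrite ExD ?ExZ//; [|exact: L1Z|exact: L1Z].
rewrite (Ex_noise_predictable L0 hf_smooth hw hg hub pA) addr0 lerD2l.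
by rewrite ler_pM2l//; exact: (Ex_sqnorm_noise_stack hub).
Qed.

(** The noise accumulates to alpha N sigma^2 / s = s N sigma^2 / mu, and s < 1 removes the
    dependence on alpha. *)
Lemma penalized_energy_bound k :
  Ex P (V k) <= energy alpha s phi xinf 0 0 + N%:R * sigma ^+ 2 / mu.
Proof.
have V0 : 0 <= energy alpha s phi xinf 0 0 by exact: energy_ge0.
have ns : 0 <= N%:R * sigma ^+ 2 by rewrite mulr_ge0// sqr_ge0.
have b0 : 0 <= alpha * (N%:R * sigma ^+ 2) by rewrite mulr_ge0// ltW.
have s10 : 0 <= 1 - s by rewrite subr_ge0 ltW.
have s11 : 1 - s < 1 by rewrite gtrDl oppr_lt0.
apply: le_trans (recursion_bound k s10 s11 b0 penalized_energy_step) _.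
apply: lerD.
  rewrite {1}/V /state /= Ex_cst -[leRHS]mul1r ler_wpM2r//.
  by rewrite exprn_ile1// ltW.
rewrite subKr; have -> : alpha = s ^+ 2 / mu by rewrite s2 mulfK// gt_eqF.
have -> : s ^+ 2 / mu * (N%:R * sigma ^+ 2) / s = s * (N%:R * sigma ^+ 2 / mu).
  by field; rewrite !gt_eqF.
by rewrite -[leRHS]mul1r ler_wpM2r ?divr_ge0// ltW.
Qed.

(** [K], and [K1] further on, stand for the constants free of [alpha] that [uniform_bounds]
    supplies. *)
Variable K : R.
Hypothesis hK : energy alpha s phi xinf 0 0 + N%:R * sigma ^+ 2 / mu <= K.

Let VK k : Ex P (V k) <= K.
Proof. by apply: le_trans hK; exact: penalized_energy_bound. Qed.

Lemma iterate_dist_bound k :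
  Ex P (fun omega => sqnorm ((state k omega).1 - xinf)) <= 2 / mu * K /\
  Ex P (fun omega => sqnorm ((state k omega).2 - xinf)) <= 2 / mu * K.
Proof.
have c0 : 0 < 2 / mu by rewrite divr_gt0.
have b1 k' : Ex P (fun omega => sqnorm ((state k' omega).1 - xinf)) <= 2 / mu * K.
  have [h1 h2] := st2 k'.
  apply: (@le_trans _ _ (2 / mu * Ex P (V k'))); last by rewrite ler_pM2l.
  rewrite -ExZ; last exact: L1_penalized_energy.
  apply: le_Ex.
  - by apply: L1_sqnorm; apply: L2mxB => //; exact: L2mx_cst.
  - by apply: L1Z; exact: L1_penalized_energy.
  - move=> omega; exact: (energy_ge_dist s mu0 alpha0 sw xinf_min).
(* The second component at step k + 1 is the first at step k; at step 0 both are 0. *)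
split=> //; case: k => [|k]; last exact: b1.
exact: (b1 0%N).
Qed.

Lemma increment_bound k :
  Ex P (fun omega => sqnorm ((state k omega).1 - (state k omega).2)) <= 8 * alpha * K.
Proof.
have [h1 h2] := st2 k; have [_ hd] := iterate_dist_bound k.
have i1 : L1 P (fun omega => sqnorm ((state k omega).2 - xinf)).
  by apply: L1_sqnorm; apply: L2mxB => //; exact: L2mx_cst.
apply: (@le_trans _ _ (4 * alpha * Ex P (V k) +
   2 * s ^+ 2 * Ex P (fun omega => sqnorm ((state k omega).2 - xinf)))).
  rewrite -!ExZ//; last exact: L1_penalized_energy.
  rewrite -ExD; [|by apply: L1Z; exact: L1_penalized_energy|exact: L1Z].
  apply: le_Ex; first by apply: L1_sqnorm; exact: L2mxB.
    by apply: L1D; apply: L1Z => //; exact: L1_penalized_energy.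
  by move=> omega; exact: energy_ge_increment.
have c1 : 0 <= 4 * alpha by rewrite mulr_ge0// ltW.
have c2 : 0 <= 2 * s ^+ 2 by rewrite mulr_ge0// sqr_ge0.
have := lerD (ler_wpM2l c1 (VK k)) (ler_wpM2l c2 hd); move=> /le_trans; apply.
rewrite s2 le_eqVlt; apply/orP; left; apply/eqP.
by field; rewrite gt_eqF.
Qed.

(** The gradient is compared with its value at [xinf], which need not vanish: [xinf] minimizes the
    penalized objective, not F. *)
Lemma oracle_bound k :
  Ex P (fun omega => sqnorm (stack_grad f (y k omega) + xi k omega)) <=
  4 * (L ^+ 2 * (2 / mu * K)) + 4 * sqnorm (stack_grad f xinf) + 2 * (N%:R * sigma ^+ 2).
Proof.
have iV := L1_penalized_energy k.
have y2 : L2mx P (y k) by exact: (L2mx_y L0 hf_smooth hub).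
have gy2 : L2mx P (fun omega => stack_grad f (y k omega)).
  exact: (L2mx_stack_grad L0 hf_smooth).
apply: (@le_trans _ _ (4 * (L ^+ 2 * (2 / mu * Ex P (V k)))
    + 4 * sqnorm (stack_grad f xinf) + 2 * Ex P (fun omega => sqnorm (xi k omega)))).
  have i1 : L1 P (fun omega => 4 * (L ^+ 2 * (2 / mu * V k omega))).
    by do 3 apply: L1Z.
  have i2 : L1 P (fun omega => 2 * sqnorm (xi k omega)) by apply: L1Z; exact: L1_sqnorm.
  have e1 : Ex P (fun omega => 4 * (L ^+ 2 * (2 / mu * V k omega))) =
      4 * (L ^+ 2 * (2 / mu * Ex P (V k))).
    by rewrite ExZ; [rewrite ExZ; [rewrite ExZ|exact: L1Z]|do 2 apply: L1Z].
  rewrite -e1 -ExZ; last exact: L1_sqnorm.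
  rewrite -[X in _ + X + _](Ex_cst P) -!ExD//; [|by apply: L1D => //; exact: L1_cst|exact: L1_cst].
  apply: le_Ex; [by apply: L1_sqnorm; exact: L2mxD| |move=> omega].
    by apply: L1D => //; apply: L1D => //; exact: L1_cst.
  have h1 := sqnormD_le (stack_grad f (y k omega)) (xi k omega).
  have h2 := sqnormD_le (stack_grad f (y k omega) - stack_grad f xinf) (stack_grad f xinf).
  rewrite subrK in h2.
  have h3 := stack_grad_lipschitz L0 hf_smooth (y k omega) xinf.
  have h4 : sqnorm (y k omega - xinf) <= 2 / mu * V k omega.
    rewrite /y; case e : (state k omega) => [u v]; rewrite /V e.
    exact: (extrapolate_dist mu0 alpha0 s0 s2 sw xinf_min).
  have h5 := ler_wpM2l (sqr_ge0 L) h4; lra.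
apply: lerD; first rewrite lerD2r ler_pM2l// ler_pM2l ?exprn_gt0// ler_pM2l ?divr_gt0//.
by rewrite ler_pM2l//; exact: (Ex_sqnorm_noise_stack hub).
Qed.

Variable K1 : R.
Hypothesis hK1 : 4 * (L ^+ 2 * (2 / mu * K)) + 4 * sqnorm (stack_grad f xinf)
  + 2 * (N%:R * sigma ^+ 2) <= K1.

(** The disagreement obeys z+ = W z + perturbation, where the perturbation has second moment of
    order alpha: increments give 16 K alpha and the oracle 2 K1 alpha^2. Starting from z = 0, the
    geometric sum of these is all that remains. *)
Lemma disagreement_bound k :
  Ex P (fun omega => sqnorm (disagreement (state k omega).1)) <=
    2 * (1 + rho) / (1 - rho) ^+ 2 * (16 * K + 2 * alpha * K1) * alpha /\
  Ex P (fun omega => sqnorm (disagreement (state k omega).2)) <=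
    2 * (1 + rho) / (1 - rho) ^+ 2 * (16 * K + 2 * alpha * K1) * alpha.
Proof.
have aK0 : 0 <= 16 * K + 2 * alpha * K1.
  have hk := VK 0; have hv : 0 <= Ex P (V 0).
    by apply: Ex_ge0 => omega; exact: energy_ge0.
  have ho := oracle_bound 0; have ho0 : 0 <= Ex P
      (fun omega => sqnorm (stack_grad f (y 0 omega) + xi 0 omega)).
    by apply: Ex_ge0 => omega; exact: sqnorm_ge0.
  have K10 : 0 <= K1 by exact: le_trans (le_trans ho0 ho) hK1.
  have K0 : 0 <= K by exact: le_trans hv hk.
  by rewrite addr_ge0// mulr_ge0// mulr_ge0// ltW.
have r10 : 0 < 1 - rho by rewrite subr_gt0.
set q := (1 + rho) / 2; set c := (1 + rho) / (1 - rho).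
have c0 : 0 <= c by apply: divr_ge0; [apply: addr_ge0 => //|]; exact: ltW.
have q0 : 0 <= q by apply: divr_ge0 => //; apply: addr_ge0 => //; exact: ltW.
have q1 : q < 1 by rewrite ltr_pdivrMr// mul1r; move: rho1; lra.
have step k' : Ex P (fun omega => sqnorm (disagreement (state k'.+1 omega).1)) <=
    q * Ex P (fun omega => sqnorm (disagreement (state k' omega).1))
    + c * ((16 * K + 2 * alpha * K1) * alpha).
  have [h1 h2] := st2 k'.
  pose o omega := stack_grad f (y k' omega) + xi k' omega.
  have o2 : L2mx P o.
    apply: L2mxD => //; apply: (L2mx_stack_grad L0 hf_smooth).
    exact: (L2mx_y L0 hf_smooth hub).
  pose d2 omega := sqnorm ((state k' omega).1 - (state k' omega).2).
  have id2 : L1 P d2 by apply: L1_sqnorm; exact: L2mxB.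
  have iz k'' : L1 P (fun omega => sqnorm (disagreement (state k'' omega).1)).
    have [h1' _] := st2 k''; apply: L1_sqnorm; apply: L2mxB => //.
    move=> i j; under eq_fun do rewrite mxE node_avgE.
    by apply: L2Z; apply: (@L2_sum _ _ _ _ _ (fun i omega => (state k'' omega).1 i j)).
  have io : L1 P (fun omega => sqnorm (o omega)) by exact: L1_sqnorm.
  apply: (@le_trans _ _ (q * Ex P (fun omega => sqnorm (disagreement (state k' omega).1))
      + c * (2 * Ex P d2 + 2 * alpha ^+ 2 * Ex P (fun omega => sqnorm (o omega))))).
    have i12 := L1D (L1Z 2 id2) (L1Z (2 * alpha ^+ 2) io).
    rewrite -(ExZ 2 id2) -(ExZ _ io) -(ExD (L1Z _ id2) (L1Z _ io)).
    rewrite -(ExZ c i12) -(ExZ q (iz k')) -(ExD (L1Z _ (iz k')) (L1Z _ i12)).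
    apply: le_Ex => //; first exact: L1D (L1Z _ (iz k')) (L1Z _ i12).
    move=> omega; set x := (state k' omega).1; set u := (state k' omega).2.
    have -> : (state k'.+1 omega).1 = W *m x + (beta *: (W *m (x - u)) - alpha *: o omega).
      rewrite stateS /= -/(o omega) addrA; congr (_ - _).
      rewrite scalemxAr -mulmxDr; congr (_ *m _).
      rewrite /y /extrapolate -/x -/u; apply/matrixP => i j; rewrite !mxE; ring.
    rewrite disagreementD (disagreement_mix hW).
    (* This weight turns the factor [rho] into [q] = (1 + rho) / 2, still below 1, at the price [c]
       = (1 + rho) / (1 - rho) on the perturbation. *)
    have cc : 0 < (1 - rho) / (2 * rho) by rewrite divr_gt0// mulr_gt0.
    apply: le_trans (sqnormD_young _ _ cc) _; apply: lerD.
      have cc1 : 0 <= 1 + (1 - rho) / (2 * rho) by rewrite addr_ge0// ltW.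
      apply: le_trans (ler_wpM2l cc1 (sqnorm_mix_disagreement N0 hW x hrho)) _.
      rewrite le_eqVlt; apply/orP; left; apply/eqP; rewrite /q; field.
      by rewrite gt_eqF.
    have -> : 1 + ((1 - rho) / (2 * rho))^-1 = c.
      by rewrite /c; field; rewrite !gt_eqF.
    rewrite ler_wpM2l//; apply: le_trans (sqnorm_disagreement_le N0 _) _.
    apply: le_trans (sqnormB_le _ _) _; rewrite !sqnormZ; apply: lerD; last by rewrite mulrA.
    rewrite ler_pM2l//; have [b0 b1] := andP beta_nneg.
    have w0 := sqnorm_mix_le hW (x - u); have w1 := sqnorm_ge0 (W *m (x - u)).
    apply: le_trans w0; rewrite -[leRHS]mul1r ler_wpM2r//.
    by rewrite exprn_ile1.
  rewrite lerD2l ler_wpM2l//.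
  have hd := increment_bound k'; have ho := le_trans (oracle_bound k') hK1.
  have t0 : 0 <= 2 * alpha ^+ 2 by rewrite mulr_ge0// sqr_ge0.
  have := lerD (ler_wpM2l (ler0n R 2) hd) (ler_wpM2l t0 ho).
  by move=> /le_trans; apply; rewrite le_eqVlt; apply/orP; left; apply/eqP; ring.
have b0 : 0 <= c * ((16 * K + 2 * alpha * K1) * alpha).
  by rewrite mulr_ge0// mulr_ge0// ltW.
have d1 k' : Ex P (fun omega => sqnorm (disagreement (state k' omega).1)) <=
    2 * (1 + rho) / (1 - rho) ^+ 2 * (16 * K + 2 * alpha * K1) * alpha.
  apply: le_trans (recursion_bound k' q0 q1 b0 step) _.
  rewrite /state /= disagreement0 sqnorm0 Ex_cst mulr0 add0r.
  rewrite le_eqVlt; apply/orP; left; apply/eqP; rewrite /c /q; field.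
  by rewrite !gt_eqF.
split; first exact: d1.
by case: k => [|k]; [exact: (d1 0)|exact: d1].
Qed.

End penalized_descent.

Section average_descent.
Variables (xstar : 'rV[R]_d) (Dy : R).
Hypothesis xstar_min : forall x, avg_fun f xstar <= avg_fun f x.
Hypothesis hDy : forall k, Ex P (fun omega => sqnorm (disagreement (y k omega))) <= Dy.

Let V k omega := energy alpha s (avg_fun f) xstar
  (node_avg (state k omega).1) (node_avg (state k omega).2).

Let L2_avg (A : T -> 'M[R]_(N, d)) : L2mx P A -> L2mx P (fun omega => node_avg (A omega)).
Proof.
move=> hA i j; rewrite (ord1 i); under eq_fun do rewrite node_avgE.
by apply: L2Z; apply: (@L2_sum _ _ _ _ _ (fun i omega => A omega i j)).
Qed.

Lemma L1_avg_energy k : L1 P (V k).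
Proof.
have [h1 h2] := st2 k; have {}h1 := L2_avg h1; have {}h2 := L2_avg h2; apply: L1D.
  apply: L1B; last exact: L1_cst.
  by apply: L1Z; apply: L1_sum => i; exact: L1_objective.
apply: L1Z; apply: L1_sqnorm; apply: L2mxB; first by apply: L2mxB => //; exact: L2mx_cst.
by apply: L2mxZ; apply: L2mxB => //; exact: L2mx_cst.
Qed.

Let sw : sandwiched mu L (avg_fun f) (avg_grad f).
Proof. exact: avg_sandwiched. Qed.

Let Ke := 2 * L / mu ^+ 2 + 3 / mu.

Lemma avg_grad_dist x : sqnorm (avg_grad f x) <= L ^+ 2 * sqnorm (x - xstar).
Proof.
rewrite -[avg_grad f x]subr0 -(sandwiched_min_grad sw xstar_min L0) !avg_gradE -node_avgB.
apply: le_trans (sqnorm_node_avg_le N0 _) _.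
rewrite ler_pdivrMl ?ltr0n//.
apply: le_trans (stack_grad_lipschitz L0 hf_smooth _ _) _.
rewrite mulrCA ler_pM2l ?exprn_gt0// sqnorm_rows.
under eq_bigr do rewrite raddfB /= !row_replicate.
by rewrite sumr_const card_ord mulr_natl.
Qed.

(** The bias [e] compares the mean of the gradients at the nodes' own points with the gradient of f
    at the mean point, so |e|^2 <= L^2 / N times the squared disagreement. It is predictable, hence
    its cross term with the averaged noise has zero mean too. *)
Lemma avg_energy_step k : Ex P (V k.+1) <= (1 - s / 2) * Ex P (V k)
  + (alpha / 2 * (1 + alpha * L) * (N%:R^-1 * sigma ^+ 2) + s * Ke * (N%:R^-1 * L ^+ 2 * Dy)).
Proof.
have [p1 p2] := predictable_state L0 hf_smooth hg hub k.
have py := predictable_y L0 hf_smooth hg hub k.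
pose yb omega := node_avg (y k omega).
have pyb : predictable w k yb by exact: predictable_node_avg.
pose e omega := node_avg (stack_grad f (y k omega)) - avg_grad f (yb omega).
have pG : predictable w k (fun omega => avg_grad f (yb omega)).
  under eq_fun do rewrite avg_gradE.
  apply: predictable_node_avg; apply: (predictable_stack_grad L0 hf_smooth).
  exact: predictable_replicate.
have pe : predictable w k e.
  apply: predictableB => //; apply: predictable_node_avg.
  exact: (predictable_stack_grad L0 hf_smooth).
pose eta omega := node_avg (xi k omega).
pose A omega := (alpha ^+ 2 * L) *: avg_grad f (yb omega)
  + (alpha * (1 + alpha * L)) *: e omega
  - drift s xstar (node_avg (state k omega).1) (yb omega).
have pA : predictable w k A.
  apply: predictableB; first by apply: predictableD; exact: predictableZ.
  have px := predictable_node_avg p1.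
  apply: predictableB; first by apply: predictableB => //; exact: predictable_cst.
  by apply: predictableZ; apply: predictableB => //; exact: predictable_cst.
have eta2 : L2mx P eta by exact: L2_avg.
have step omega : V k.+1 omega <= (1 - s / 2) * V k omega + dotmx (eta omega) (A omega)
    + alpha / 2 * (1 + alpha * L) * sqnorm (eta omega) + s * Ke * sqnorm (e omega).
  have ex : node_avg (state k.+1 omega).1 =
      yb omega - alpha *: (avg_grad f (yb omega) + (eta omega + e omega)).
    rewrite stateS /= node_avgB (node_avg_mix hW) node_avgZ node_avgD -/(yb omega).
    by rewrite /e addrCA subrKC addrC.
  rewrite /V ex stateS /=.
  have ye : yb omega = extrapolate ((1 - s) / (1 + s))
      (node_avg (state k omega).1, node_avg (state k omega).2).
    by rewrite /yb /y /extrapolate node_avgB !node_avgZ.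
  have aL1 : alpha * L <= 1 by exact: le_trans a1.
  exact: (biased_energy_step (eta omega) (e omega) mu0 L0 alpha0 s0 s1 s2 aL1 sw xstar_min
    (avg_grad_dist _) ye).
have iV := L1_avg_energy k.
have iA : L1 P (fun omega => dotmx (eta omega) (A omega)) by apply: L1_dotmx => //; exact: pA.1.
have ie : L1 P (fun omega => sqnorm (e omega)) by apply: L1_sqnorm; exact: pe.1.
have ieta := L1_sqnorm eta2.
have i1 := L1D (L1Z (1 - s / 2) iV) iA.
have i2 := L1D i1 (L1Z (alpha / 2 * (1 + alpha * L)) ieta).
have i3 := L1D i2 (L1Z (s * Ke) ie).
apply: le_trans (le_Ex (L1_avg_energy k.+1) i3 step) _.
rewrite (ExD i2 (L1Z _ ie)) (ExD i1 (L1Z _ ieta)) (ExD (L1Z _ iV) iA) !ExZ//.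
have -> : Ex P (fun omega => dotmx (eta omega) (A omega)) = 0.
  under eq_fun do rewrite dotmx_node_avg.
  rewrite ExZ; last first.
    by apply: L1_dotmx => //; exact: (predictable_replicate pA).1.
  by rewrite (Ex_noise_predictable L0 hf_smooth hw hg hub (predictable_replicate pA)) mulr0.
rewrite addr0 -addrA lerD2l; apply: lerD.
  rewrite ler_wpM2l//; last exact: (Ex_sqnorm_noise_avg N0 L0 hf_smooth hw hg hub).
  by rewrite mulr_ge0// ?divr_ge0 ?addr_ge0 ?mulr_ge0 ?(ltW alpha0) ?(ltW L0).
have Ke0 : 0 <= s * Ke.
  by rewrite mulr_ge0 ?addr_ge0 ?divr_ge0 ?mulr_ge0 ?exprn_ge0 ?(ltW s0) ?(ltW mu0) ?(ltW L0).
rewrite ler_wpM2l//.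
have c0 : 0 <= N%:R^-1 * L ^+ 2 :> R by rewrite mulr_ge0 ?sqr_ge0// invr_ge0.
have idy : L1 P (fun omega => sqnorm (disagreement (y k omega))).
  have y2 := L2mx_y L0 hf_smooth hub k; apply: L1_sqnorm; apply: L2mxB => // i j.
  by under eq_fun do rewrite mxE; exact: L2_avg.
apply: le_trans (ler_wpM2l c0 (hDy k)); rewrite -ExZ//; apply: le_Ex => //; first exact: L1Z.
move=> omega; rewrite /e avg_gradE -node_avgB; apply: le_trans (sqnorm_node_avg_le N0 _) _.
rewrite -mulrA ler_wpM2l ?invr_ge0//.
exact: (stack_grad_lipschitz L0 hf_smooth).
Qed.

Lemma avg_energy_bound k : Ex P (V k) <=
  (1 - s / 2) ^+ k * energy alpha s (avg_fun f) xstar 0 0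
  + (alpha / 2 * (1 + alpha * L) * (N%:R^-1 * sigma ^+ 2)
     + s * Ke * (N%:R^-1 * L ^+ 2 * Dy)) / (s / 2).
Proof.
have Dy0 : 0 <= Dy.
  by apply: le_trans (hDy 0); apply: Ex_ge0 => omega; exact: sqnorm_ge0.
have b0 : 0 <= alpha / 2 * (1 + alpha * L) * (N%:R^-1 * sigma ^+ 2)
     + s * Ke * (N%:R^-1 * L ^+ 2 * Dy).
  have := (ltW s0, ltW mu0, ltW L0, ltW alpha0) => -[[[s0' mu0'] L0'] al0'].
  apply: addr_ge0; first apply: mulr_ge0.
  - by rewrite mulr_ge0 ?divr_ge0// addr_ge0// mulr_ge0.
  - by rewrite mulr_ge0 ?invr_ge0// sqr_ge0.
  - rewrite mulr_ge0//; first by rewrite mulr_ge0// addr_ge0// divr_ge0 ?sqr_ge0// mulr_ge0.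
    by rewrite mulr_ge0// mulr_ge0 ?invr_ge0// sqr_ge0.
have q0 : 0 <= 1 - s / 2 by move: s1; lra.
have q1 : 1 - s / 2 < 1 by move: s0; lra.
have V0E : Ex P (V 0) = energy alpha s (avg_fun f) xstar 0 0.
  rewrite /V /state /= Ex_cst.
  suff -> : node_avg (0 : 'M[R]_(N, d)) = 0 by [].
  by rewrite -(scale0r (0 : 'M[R]_(N, d))) node_avgZ scale0r.
by have := recursion_bound k q0 q1 b0 avg_energy_step; rewrite V0E subKr.
Qed.

Lemma avg_dist_bound k :
  Ex P (fun omega => sqnorm (node_avg (state k omega).1 - xstar)) <= 2 / mu * Ex P (V k).
Proof.
have [h1 _] := st2 k; rewrite -ExZ; last exact: L1_avg_energy.
apply: le_Ex; first by apply: L1_sqnorm; apply: L2mxB; [exact: L2_avg|exact: L2mx_cst].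
  by apply: L1Z; exact: L1_avg_energy.
by move=> omega; exact: (energy_ge_dist s mu0 alpha0 sw xstar_min).
Qed.

End average_descent.

End expected_descent.

(** * Passage to the quantities of the statement *)

Lemma lyapunov_energy {R : realType} N d (f : 'I_N -> 'rV[R]_d -> R) W (mu alpha : R)
    (xinf x u : 'M[R]_(N, d)) : 0 < mu -> 0 < alpha ->
  lyapunov f W mu alpha xinf (x - xinf) (u - xinf) =
    energy alpha (Num.sqrt (alpha * mu)) (penalized f W alpha) xinf x u.
Proof.
by move=> mu0 a0; rewrite /lyapunov quad_blocks_energy// subrK /energy -addrA addrC.
Qed.

Lemma lyapunov_avg_energy {R : realType} N d (f : 'I_N -> 'rV[R]_d -> R) (mu alpha : R)
    (xstar x u : 'rV[R]_d) : 0 < mu -> 0 < alpha ->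
  lyapunov_avg f mu alpha xstar (x - xstar) (u - xstar) =
    energy alpha (Num.sqrt (alpha * mu)) (avg_fun f) xstar x u.
Proof.
by move=> mu0 a0; rewrite /lyapunov_avg quad_blocks_energy// subrK /energy -addrA addrC.
Qed.

(** The Rayleigh minimum is an eigenvalue, so it is at least the last entry of [lam]. As that entry
    is positive, the absolute values in gamma are harmless, and gamma < 1 amounts to the simplicity
    of the eigenvalue 1. *)
Lemma mixing_spectrum {R : realType} N (E : rel 'I_N) (W : 'M[R]_N) (lam : seq R) :
  (2 <= N)%N -> connected_graph E -> mixing_matrix E W -> spectrum W lam ->
  0 < lam`_N.-1 ->
  [/\ forall v : 'rV[R]_N, lam`_N.-1 * sqnorm v <= dotmx (v *m W) v,
      lam`_N.-1 <= 1,
      0 < Num.max `|lam`_1| `|lam`_N.-1| & Num.max `|lam`_1| `|lam`_N.-1| < 1].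
Proof.
case: N E W => [//|n] E W n1 hE hW hlam /= lamN0.
have sz := size_spectrum hlam; have mem := mem_spectrum hlam.
have lamN : lam`_n \in lam by rewrite mem_nth// sz.
have lam1 : lam`_1 \in lam by rewrite mem_nth// sz.
have ge_last := spectrum_ge_last hlam.
have lt1 := second_eigenvalue_lt1 hE hW hlam n1.
have l1 := ge_last _ lam1.
have [sW _ _ _ _] := hW.
have [b eb hb] := rayleigh_min sW (ltn0Sn n).
split.
- move=> v; apply: le_trans (hb v); rewrite ler_wpM2r ?sqnorm_ge0//.
  by apply: ge_last; rewrite mem.
- by apply: le_trans l1 _; exact: ltW.
- by rewrite lt_max normr_gt0 orbC normr_gt0 (gt_eqF lamN0).
- by rewrite gt_max !gtr0_norm ?lt1 ?(le_lt_trans l1)// (lt_le_trans lamN0).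
Qed.

Lemma cst_bigO {R : realType} (c : R) : ((fun=> c) : R -> R) =O_ (0^'+) (cst (1 : R)).
Proof.
apply/eqOP; exists `|c|; split; first exact: num_real.
by move=> k /ltW ck; near=> x; rewrite normr1 mulr1.
Unshelve. all: by end_near.
Qed.

Section bounds.
Context {R : realType}.

Lemma step_size (mu L alpha a : R) : 0 < mu -> mu <= L ->
  0 < alpha <= Num.min (1 / (L + mu)) (a / L) ->
  [/\ 0 < alpha, alpha * L <= a, alpha <= L^-1 & alpha * mu <= 2^-1].
Proof.
move=> mu0 muL; have L0 : 0 < L by exact: lt_le_trans muL.
rewrite le_min => /andP[a0 /andP[h1 h2]]; split=> //.
- by rewrite -ler_pdivlMr.
- apply: le_trans h1 _; rewrite div1r lef_pV2 ?posrE ?addr_gt0//.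
  by rewrite lerDl ltW.
- have : alpha * (L + mu) <= 1 by rewrite -ler_pdivlMr ?addr_gt0.
  by have := ler_wpM2l (ltW a0) muL; lra.
Qed.

(** With s^2 = alpha mu the first term equals 4 + 4 (1 - s)^2, and the subtracted 2 mu alpha is at
    most 1. The factor H_1 can then be dropped from lower bounds on the right-hand sides. *)
Lemma H1_ge1 (mu L alpha s : R) : 0 < mu -> 0 < L -> 0 < alpha -> 0 <= s ->
  s ^+ 2 = alpha * mu -> alpha * mu <= 2^-1 ->
  1 <= 8 * (1 + mu * alpha / 2 - s) + 2 * L ^+ 2 * alpha / mu
       + (L * alpha + 2 + mu * alpha) * s - 2 * mu * alpha.
Proof.
move=> mu0 L0 a0 s0 s2 am.
have h1 : 0 <= 2 * L ^+ 2 * alpha / mu.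
  by rewrite divr_ge0 ?mulr_ge0 ?sqr_ge0// ltW.
have h2 : 0 <= (L * alpha + 2 + mu * alpha) * s.
  by rewrite mulr_ge0 ?addr_ge0 ?mulr_ge0// ltW.
have h3 := sqr_ge0 (1 - s).
have h4 : (1 - s) ^+ 2 = 1 - 2 * s + s ^+ 2 by ring.
by rewrite h4 s2 in h3; lra.
Qed.

Lemma sqrt_ratio (mu alpha s : R) : 0 < mu -> 0 < alpha -> s = Num.sqrt (alpha * mu) ->
  alpha / (mu * s) = Num.sqrt alpha / (mu * Num.sqrt mu).
Proof.
move=> mu0 a0 ->; rewrite sqrtrM ?ltW//.
have ra : 0 < Num.sqrt alpha by rewrite sqrtr_gt0.
have rm : 0 < Num.sqrt mu by rewrite sqrtr_gt0.
rewrite -{1}(sqr_sqrtr (ltW a0)); field.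
by rewrite !gt_eqF.
Qed.

(** Numerator and denominator have the same sign, powers being monotone on nonnegative reals. *)
Lemma geom_quotient_ge0 (a b : R) k : 0 <= a -> 0 <= b -> 0 <= geom_quotient a b k.
Proof.
move=> a0 b0; rewrite /geom_quotient; case: eqVneq => [_|ab].
  by rewrite mulr_ge0// exprn_ge0.
have [ba|ab'] := leP b a.
  by rewrite divr_ge0 ?subr_ge0// lerXn2r.
rewrite -mulrNN -invrN !opprB divr_ge0 ?subr_ge0 ?(ltW ab')//.
by rewrite lerXn2r// ltW.
Qed.

End bounds.

Lemma unique_minimizer_le {R : realType} (U : eqType) (h : U -> R) x y :
  unique_minimizer h x -> h x <= h y.
Proof. by move=> hx; have [->//|/eqP/hx/ltW] := eqVneq y x. Qed.

(* All the constants are uniform in the step size, because at the origin the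
   Lyapunov function of the penalized problem does not depend on it:
   its value is at most [2 * \sum_i (f i 0 - fmin i)]. *)
Lemma uniform_bounds {R : realType} (d N : nat) (mu L : R)
  (f : 'I_N -> 'rV[R]_d -> R) (xstar : 'rV[R]_d) (fmin : 'I_N -> R)
  (E : rel 'I_N) (W : 'M[R]_N) (a rho : R)
  (dT dZ : measure_display) (T : measurableType dT) (Z : measurableType dZ)
  (P : probability T R) (w : 'I_N -> nat -> {RV P >-> Z})
  (g : 'I_N -> 'rV[R]_d -> Z -> 'rV[R]_d) (sigma : R) :
  (0 < N)%N -> 0 < mu -> mu <= L ->
  (forall i, strongly_convex mu (f i)) -> (forall i, lipschitz_gradient L (f i)) ->
  (forall x, avg_fun f xstar <= avg_fun f x) -> (forall i x, fmin i <= f i x) ->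
  mixing_matrix E W -> (forall v : 'rV[R]_N, a * sqnorm v <= dotmx (v *m W) v) ->
  a <= 1 -> 0 < rho -> rho < 1 ->
  (forall v : 'rV[R]_N, \sum_j v 0 j = 0 -> sqnorm (v *m W) <= rho * sqnorm v) ->
  independent_noise w -> (forall i, measurable_oracle (g i)) ->
  exists2 C : R, 0 <= C &
  forall alpha : R, 0 < alpha <= Num.min (1 / (L + mu)) (a / L) ->
  forall xinf : 'M[R]_(N, d), (forall X, penalized f W alpha xinf <= penalized f W alpha X) ->
  let s := Num.sqrt (alpha * mu) in
  let beta := (1 - s) / (1 + s) in
  let state k omega := dasg_state W alpha beta (0, 0) (stack_oracle g w omega) k in
  unbiased_bounded_variance f g w sigma
    (fun i k omega => row i (extrapolate beta (state k omega))) ->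
  forall k,
  [/\ L2mx P (fun omega => (state k omega).1),
      Ex P (fun omega => sqnorm (node_avg (state k omega).1 - xstar)) <=
        (1 - s / 2) ^+ k * (2 * energy alpha s (avg_fun f) xstar 0 0 / mu) + C * alpha
        + 2 * sigma ^+ 2 * Num.sqrt alpha / (mu * Num.sqrt mu * N%:R) * (1 + alpha * L) &
      Ex P (fun omega => sqnorm (disagreement (state k omega).1)) <= C * alpha].
Proof.
move=> N0 mu0 muL hconv hsm hmin hfmin hW ha a1 r0 r1 hrho hw hg.
have L0 : 0 < L by exact: lt_le_trans muL.
have NR0 : 0 < N%:R :> R by rewrite ltr0n.
pose K0 := 2 * \sum_i (f i 0 - fmin i).
have K00 : 0 <= K0 by rewrite mulr_ge0// sumr_ge0// => i _; rewrite subr_ge0.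
pose K := K0 + N%:R * sigma ^+ 2 / mu.
have K_ge0 : 0 <= K.
  by rewrite addr_ge0// divr_ge0 ?(ltW mu0)// mulr_ge0 ?sqr_ge0// ltW.
pose K1 := 4 * (L ^+ 2 * (2 / mu * K))
  + 4 * (2 * (L ^+ 2 * (2 / mu * K0)) + 2 * sqnorm (stack_grad f (0 : 'M[R]_(N, d))))
  + 2 * (N%:R * sigma ^+ 2).
have K1_ge0 : 0 <= K1.
  have mu1 : 0 <= 2 / mu by rewrite divr_ge0// ltW.
  have L20 := sqr_ge0 L.
  have g0 := sqnorm_ge0 (stack_grad f (0 : 'M[R]_(N, d))).
  have ns : 0 <= N%:R * sigma ^+ 2 by rewrite mulr_ge0// sqr_ge0.
  have h1 := mulr_ge0 L20 (mulr_ge0 mu1 K_ge0).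
  have h2 := mulr_ge0 L20 (mulr_ge0 mu1 K00).
  by rewrite /K1; move: g0 ns h1 h2; lra.
(* The constant of [disagreement_bound], with alpha replaced by its upper bound 1 / L. *)
pose K7 := 2 * (1 + rho) / (1 - rho) ^+ 2 * (16 * K + 2 * L^-1 * K1).
have Kr : 0 <= 2 * (1 + rho) / (1 - rho) ^+ 2.
  by rewrite divr_ge0 ?sqr_ge0// mulr_ge0// addr_ge0// ltW.
have K7_ge0 : 0 <= K7.
  rewrite mulr_ge0// addr_ge0 ?mulr_ge0// invr_ge0; exact: ltW.
pose Ke := 2 * L / mu ^+ 2 + 3 / mu.
have Ke_ge0 : 0 <= Ke.
  by rewrite addr_ge0 ?divr_ge0 ?mulr_ge0 ?sqr_ge0// ltW.
(* The bias constant: 4 / mu is 2 / mu (from energy to distance) times 2 (division by s / 2 after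
   cancelling s). The 10 bounds 2 (1 + beta)^2 + 2 beta^2, which relates the disagreement of y to
   that of the last two iterates. *)
pose K8 := 4 / mu * Ke * (N%:R^-1 * L ^+ 2 * (10 * K7)).
have K8_ge0 : 0 <= K8.
  have h1 : 0 <= 4 / mu by rewrite divr_ge0// ltW.
  have h2 : 0 <= N%:R^-1 :> R by rewrite invr_ge0 ltW.
  have h3 : 0 <= 10 * K7 by rewrite mulr_ge0.
  exact: mulr_ge0 (mulr_ge0 h1 Ke_ge0) (mulr_ge0 (mulr_ge0 h2 (sqr_ge0 L)) h3).
exists (K7 + K8); first exact: addr_ge0.
move=> alpha /(step_size mu0 muL)[al0 aL alL am] xinf xinf_min s beta state hub k.
have s2 : s ^+ 2 = alpha * mu by rewrite sqr_sqrtr// mulr_ge0// ltW.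
have s0 : 0 < s by rewrite sqrtr_gt0 mulr_gt0.
have s1 : s < 1.
  rewrite -(expr_lt1 (n := 2))// ?(ltW s0)// s2; apply: le_lt_trans am _.
  by rewrite invf_lt1// ltr1n.
have sw := penalized_sandwiched hW L0 al0 hconv hsm ha.
have Lam0 : 0 < (1 - a) / alpha + L by rewrite ltr_wpDl// divr_ge0 ?subr_ge0// ltW.
have xinf_dist : mu / 2 * sqnorm (0 - xinf) <= penalized f W alpha 0 - penalized f W alpha xinf.
  by have [] := sandwiched_growth sw xinf_min 0 Lam0.
have pgap : penalized f W alpha 0 - penalized f W alpha xinf <= K0 / 2.
  have -> : K0 / 2 = \sum_i f i 0 - \sum_i fmin i by rewrite /K0 sumrB; field.
  rewrite /penalized dotmx0l mulr0 add0r /sum_fun.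
  have h1 : \sum_i fmin i <= \sum_i f i (row i xinf) by apply: ler_sum.
  have h2 : 0 <= 1 / (2 * alpha) * dotmx xinf ((1%:M - W) *m xinf).
    rewrite mulr_ge0 ?divr_ge0 ?mulr_ge0 ?(ltW al0)//.
    by rewrite mulmxBl mul1mx dotmxDr dotmxNr subr_ge0; exact: dotmx_mix_le hW _.
  have -> : \sum_i f i (row i (0 : 'M[R]_(N, d))) = \sum_i f i 0.
    by apply: eq_bigr => i _; rewrite row0.
  by move: h1 h2; lra.
have VK0 : energy alpha s (penalized f W alpha) xinf 0 0 <= K0.
  (* At the origin the momentum vector is - s xinf, so its term is mu / 2 |xinf|^2, free of alpha;
     quadratic growth bounds it by the gap of the penalized objective. *)
  rewrite /energy; have -> : 0 - xinf - (1 - s) *: (0 - xinf) = s *: (0 - xinf).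
    by apply/matrixP => i j; rewrite !mxE; ring.
  rewrite sqnormZ s2 mulrA.
  have -> : (2 * alpha)^-1 * (alpha * mu) = mu / 2 by field; rewrite gt_eqF.
  by move: xinf_dist pgap; lra.
have hK : energy alpha s (penalized f W alpha) xinf 0 0 + N%:R * sigma ^+ 2 / mu <= K.
  by rewrite lerD2r.
have hK1 : 4 * (L ^+ 2 * (2 / mu * K)) + 4 * sqnorm (stack_grad f xinf)
    + 2 * (N%:R * sigma ^+ 2) <= K1.
  rewrite lerD2r lerD2l ler_pM2l//.
  have h1 := sqnormD_le (stack_grad f xinf - stack_grad f 0) (stack_grad f 0).
  rewrite subrK in h1; apply: le_trans h1 _; rewrite lerD2r ler_pM2l//.
  apply: le_trans (stack_grad_lipschitz L0 hsm _ _) _; rewrite ler_pM2l ?exprn_gt0//.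
  rewrite subr0 -sqnormN -sub0r -ler_pdivrMl ?divr_gt0//.
  by rewrite invf_div; move: xinf_dist pgap; lra.
have hdis k' := disagreement_bound N0 mu0 L0 hconv hsm hW ha r0 r1 hrho hw hg
  al0 s0 s1 s2 aL a1 hub xinf_min hK hK1 k'.
have hK7 : 2 * (1 + rho) / (1 - rho) ^+ 2 * (16 * K + 2 * alpha * K1) * alpha <= K7 * alpha.
  rewrite ler_wpM2r ?(ltW al0)// ler_wpM2l// lerD2l ler_wpM2r// ler_pM2l//.
have [x2 u2] := L2mx_state L0 hsm hub k.
have beta0 : 0 <= beta by rewrite divr_ge0 ?subr_ge0 ?addr_ge0// ltW.
have beta1 : beta <= 1.
  by rewrite ler_pdivrMr ?addr_gt0// mul1r lerD2l (le_trans _ (ltW s0))// oppr_le0 ltW.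
have L2_avg (A : T -> 'M[R]_(N, d)) : L2mx P A -> L2mx P (fun omega => node_avg (A omega)).
  move=> hA i j; rewrite (ord1 i); under eq_fun do rewrite node_avgE.
  by apply: L2Z; apply: (@L2_sum _ _ _ _ _ (fun i omega => A omega i j)).
have L2_dis (A : T -> 'M[R]_(N, d)) : L2mx P A -> L2mx P (fun omega => disagreement (A omega)).
  move=> hA; apply: L2mxB => // i j.
  by under eq_fun do rewrite mxE; exact: L2_avg.
have hDy k' : Ex P (fun omega => sqnorm (disagreement (extrapolate beta (state k' omega))))
    <= 10 * K7 * alpha.
  have [h1 h2] := L2mx_state L0 hsm hub k'.
  have i1 := L1_sqnorm (L2_dis _ h1); have i2 := L1_sqnorm (L2_dis _ h2).
  have [d1 d2] := hdis k'.
  apply: (@le_trans _ _ (8 * Ex P (fun omega => sqnorm (disagreement (state k' omega).1))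
    + 2 * Ex P (fun omega => sqnorm (disagreement (state k' omega).2)))).
    rewrite -(ExZ 8 i1) -(ExZ 2 i2) -(ExD (L1Z 8 i1) (L1Z 2 i2)); apply: le_Ex.
    - by apply: L1_sqnorm; apply: L2_dis; exact: (L2mx_y L0 hsm hub).
    - exact: L1D (L1Z 8 i1) (L1Z 2 i2).
    move=> omega; rewrite /extrapolate disagreementD -scaleN1r !disagreementZ scaleN1r.
    apply: le_trans (sqnormB_le _ _) _; rewrite !sqnormZ.
    have q1 := sqnorm_ge0 (disagreement (state k' omega).1).
    have q2 := sqnorm_ge0 (disagreement (state k' omega).2).
    have b1 : (1 + beta) ^+ 2 <= 4 by nra.
    have b2 : beta ^+ 2 <= 1 by nra.
    by have := ler_wpM2r q1 b1; have := ler_wpM2r q2 b2; lra.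
  by move: d1 d2 hK7; lra.
have hav := avg_energy_bound N0 mu0 L0 hconv hsm hW hw hg al0 s0 s1 s2 aL a1 hub hmin hDy k.
have hdist := avg_dist_bound N0 mu0 L0 hconv hsm al0 hub hmin k.
split=> //; last first.
  have [d1 _] := hdis k; apply: le_trans d1 _; apply: le_trans hK7 _.
  by rewrite ler_pM2r// lerDl.
apply: le_trans hdist _.
have c0 : 0 <= 2 / mu by rewrite divr_ge0// ltW.
apply: le_trans (ler_wpM2l c0 hav) _.
have sr := sqrt_ratio mu0 al0 (erefl s).
have -> : 2 * sigma ^+ 2 * Num.sqrt alpha / (mu * Num.sqrt mu * N%:R) * (1 + alpha * L) =
    2 * sigma ^+ 2 / N%:R * (1 + alpha * L) * (alpha / (mu * s)).
  by rewrite sr; field; rewrite !gt_eqF ?sqrtr_gt0.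
(* The two sides differ by exactly [K7 * alpha], the share of the common constant meant for the
   disagreement. *)
rewrite -/Ke; have K7a : 0 <= K7 * alpha by rewrite mulr_ge0// ltW.
rewrite -subr_ge0; apply: le_trans K7a _; rewrite le_eqVlt; apply/orP; left; apply/eqP.
by rewrite /K8; field; rewrite !gt_eqF.
Qed.

Theorem proposition10 (R : realType) (d N : nat) (hN : (2 <= N)%N)
  (mu L : R) (hmu : 0 < mu) (hmuL : mu <= L)
  (f : 'I_N -> 'rV[R]_d -> R)
  (hf_convex : forall i, strongly_convex mu (f i))
  (hf_smooth : forall i, lipschitz_gradient L (f i))
  (xstar : 'rV[R]_d) (hxstar : unique_minimizer (avg_fun f) xstar)
  (fmin : 'I_N -> R) (hfmin : forall i, is_minimum (f i) (fmin i))
  (E : rel 'I_N) (hE : connected_graph E)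
  (W : 'M[R]_N) (hW : mixing_matrix E W)
  (lam : seq R) (hlam : spectrum W lam)
  (hlamN : 0 < lam`_(N.-1))
  (dT dZ : measure_display) (T : measurableType dT) (Z : measurableType dZ)
  (P : probability T R)
  (w : 'I_N -> nat -> {RV P >-> Z}) (hw : independent_noise w)
  (g : 'I_N -> 'rV[R]_d -> Z -> 'rV[R]_d)
  (hg : forall i, measurable_oracle (g i))
  (sigma : R) :
  let lambdaN := lam`_(N.-1) in
  let gamma := Num.max `|lam`_1| `|lambdaN| in
  let C1 := Num.sqrt (2 * L * \sum_i (f i 0 - fmin i)) *
            (1 + 2 * (L + mu) / mu) in
  let xstars : 'M[R]_(N, d) := replicate N xstar in
  exists C0 : R -> R,
    [/\ forall a, 0 < C0 a,
        (C0 : R -> R) =O_ (0^'+) (cst (1 : R)) &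
    forall alpha : R, 0 < alpha <= Num.min (1 / (L + mu)) (lambdaN / L) ->
    forall xinf : 'M[R]_(N, d), unique_minimizer (penalized f W alpha) xinf ->
    let s := Num.sqrt (alpha * mu) in
    let beta := (1 - s) / (1 + s) in
    let x0 : 'M[R]_(N, d) := 0 in
    let xm1 : 'M[R]_(N, d) := 0 in
    let x (k : nat) (omega : T) : 'M[R]_(N, d) :=
      dasg_x W alpha beta (x0, xm1) (stack_oracle g w omega) k in
    let y (k : nat) (omega : T) : 'M[R]_(N, d) :=
      dasg_y W alpha beta (x0, xm1) (stack_oracle g w omega) k in
    unbiased_bounded_variance f g w sigma (fun i k omega => row i (y k omega)) ->
    let VS := lyapunov f W mu alpha xinf (x0 - xinf) (xm1 - xinf) in
    let VSbar := lyapunov_avg f mu alpha xstar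
                   (node_avg x0 - xstar) (node_avg xm1 - xstar) in
    let M := 4 * VS / mu
             + 2 * sigma ^+ 2 * N%:R * Num.sqrt alpha / (mu * Num.sqrt mu)
               * (2 - lambdaN + alpha * L)
             + 2 * C1 ^+ 2 * N%:R * alpha ^+ 2 / (1 - gamma) ^+ 2 in
    let B := (1 + beta) ^+ 2 + beta ^+ 2 in
    let Dy2 := 4 * L ^+ 2 * B * M + 2 * sqnorm (grad (sum_fun f) xstars) in
    let H1 := 8 * (1 + mu * alpha / 2 - s) + 2 * L ^+ 2 * alpha / mu
              + (L * alpha + 2 + mu * alpha) * s - 2 * mu * alpha in
    let H2 := 2 / N%:R * L ^+ 2 * B *
              (4 * Dy2 * alpha / (1 - gamma) ^+ 2
               + 4 * sigma ^+ 2 * N%:R * alpha / (1 - gamma) ^+ 2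
               + 8 * C0 alpha / (1 - gamma) ^+ 2) in
    let H3 := 2 / N%:R * L ^+ 2 * B * (M + sqnorm xstars) in
    forall k : nat,
    ('E_P[fun omega => sqnorm (node_avg (x k omega) - xstar)] <=
      ((1 - s / 2) ^+ k * (2 * VSbar / mu)
       + 8 / (gamma ^+ 2 * mu * Num.sqrt mu) * Num.sqrt alpha * H1 * H3
         * geom_quotient (gamma ^+ 2) (1 - s / 2) k
       + 2 / mu ^+ 2 * alpha * H1 * H2
       + 2 * sigma ^+ 2 * Num.sqrt alpha / (mu * Num.sqrt mu * N%:R)
         * (1 + s / 2) * (1 + alpha * L))%:E)%E
    /\
    forall i : 'I_N,
    ('E_P[fun omega => sqnorm (row i (x k omega) - xstar)] <=
      ((1 - s / 2) ^+ k * (4 * VSbar / mu)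
       + 16 / (gamma ^+ 2 * mu * Num.sqrt mu) * Num.sqrt alpha * H1 * H3
         * geom_quotient (gamma ^+ 2) (1 - s / 2) k
       + 4 / mu ^+ 2 * alpha * H1 * H2
       + 16 * gamma ^+ (2 * k) * (M + sqnorm xstars)
       + 8 * Dy2 * alpha ^+ 2 / (1 - gamma) ^+ 2
       + 8 * sigma ^+ 2 * N%:R * alpha ^+ 2 / (1 - gamma) ^+ 2
       + 16 * C0 alpha * alpha / (1 - gamma) ^+ 2
       + 4 * sigma ^+ 2 * Num.sqrt alpha / (mu * Num.sqrt mu * N%:R)
         * (1 + s / 2) * (1 + alpha * L))%:E)%E].

Proof.
move=> lambdaN gamma C1 xstars.
have L0 : 0 < L by exact: lt_le_trans hmuL.
have N0 : (0 < N)%N by exact: ltnW.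
have NR0 : 0 < N%:R :> R by rewrite ltr0n.
have [ha a1 gam0 gam1] := mixing_spectrum hN hE hW hlam hlamN.
rewrite -/lambdaN -/gamma in ha a1 gam0 gam1.
have [rho' [r0' r1' hrho']] := spectral_gap hE hW.
(* The gap lemma may return 0, while the Young weight in [disagreement_bound] divides by [rho]. *)
pose rho := (1 + rho') / 2.
have r0 : 0 < rho by rewrite divr_gt0// ltr_pwDl.
have r1 : rho < 1 by rewrite ltr_pdivrMr// mul1r ltrD2l.
have hrho (v : 'rV[R]_N) : \sum_j v 0 j = 0 -> sqnorm (v *m W) <= rho * sqnorm v.
  move=> /hrho' /le_trans; apply; rewrite ler_wpM2r ?sqnorm_ge0//.
  by rewrite ler_pdivlMr//; lra.
have hmin x : avg_fun f xstar <= avg_fun f x by exact: unique_minimizer_le hxstar.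
have [C C_ge0 hC] := uniform_bounds (fmin := fmin) sigma N0 hmu hmuL hf_convex hf_smooth
  hmin (fun i => (hfmin i).2) hW ha a1 r0 r1 hrho hw hg.
(* Two demands on C_0: at least C, for the explicit term 16 C_0 alpha / (1 - gamma)^2, and at least
   C mu^2 N / (32 L^2), for the term with H_1 H_2. The added 1 gives positivity even if C = 0. *)
pose c0 := C * (mu ^+ 2 * N%:R / (32 * L ^+ 2) + 1) + 1.
have cNL : 0 <= mu ^+ 2 * N%:R / (32 * L ^+ 2).
  by rewrite divr_ge0 ?mulr_ge0 ?sqr_ge0// ltW.
have c0_gt0 : 0 < c0.
  by rewrite ltr_wpDl// mulr_ge0// addr_ge0.
have Cc0 : C <= c0.
  have := mulr_ge0 C_ge0 cNL; rewrite /c0; lra.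
have CNc0 : C * (mu ^+ 2 * N%:R / (32 * L ^+ 2)) <= c0 by rewrite /c0; lra.
exists (fun=> c0); split=> [//||alpha halpha xinf hxinf s beta x0 xm1 x y hub
  VS VSbar M B Dy2 H1 H2 H3 k]; first exact: cst_bigO.
have [al0 aL alL am] := step_size hmu hmuL halpha.
have s2 : s ^+ 2 = alpha * mu by rewrite sqr_sqrtr// mulr_ge0// ltW.
have s0 : 0 < s by rewrite sqrtr_gt0 mulr_gt0.
have s1 : s < 1.
  rewrite -(expr_lt1 (n := 2))// ?(ltW s0)// s2; apply: le_lt_trans am _.
  by rewrite invf_lt1// ltr1n.
have pmin X : penalized f W alpha xinf <= penalized f W alpha X.
  exact: unique_minimizer_le hxinf.
have [x2 havg hdis] := hC alpha halpha xinf pmin hub k.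
rewrite -/s -/beta in x2 havg hdis.
have node_avg0 : node_avg x0 = 0.
  by have := node_avgZ 0 x0; rewrite !scale0r; exact.
have VSbarE : VSbar = energy alpha s (avg_fun f) xstar 0 0.
  by rewrite /VSbar node_avg0 lyapunov_avg_energy.
have VS0 : 0 <= VS.
  rewrite /VS lyapunov_energy//; exact: energy_ge0.
have g2 : 0 < (1 - gamma) ^+ 2 by rewrite exprn_gt0// subr_gt0.
have g2' : (1 - gamma) ^+ 2 <= 1.
  by rewrite exprn_ile1 ?subr_ge0 ?(ltW gam1)// gerDl oppr_le0 ltW.
have sig0 : 0 <= 2 * sigma ^+ 2 by rewrite mulr_ge0// sqr_ge0.
have sN : 0 <= 2 * sigma ^+ 2 * N%:R by rewrite mulr_ge0.
have M0 : 0 <= M.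
  rewrite /M; apply: addr_ge0; first apply: addr_ge0.
  - by rewrite divr_ge0 ?(ltW hmu)// mulr_ge0.
  - apply: mulr_ge0.
      exact: divr_ge0 (mulr_ge0 sN (sqrtr_ge0 _)) (mulr_ge0 (ltW hmu) (sqrtr_ge0 _)).
    have := mulr_ge0 (ltW al0) (ltW L0); move: a1; rewrite -/lambdaN; lra.
  - apply: divr_ge0 (ltW g2); apply: mulr_ge0 (sqr_ge0 _).
    by rewrite mulr_ge0// mulr_ge0// sqr_ge0.
have B1 : 1 <= B.
  have b0 : 0 <= beta by rewrite divr_ge0 ?subr_ge0 ?addr_ge0// ltW.
  have h1 := sqr_ge0 beta.
  have h2 : 1 <= (1 + beta) ^+ 2 by rewrite exprn_ege1// lerDl.
  by rewrite /B; lra.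
have Dy20 : 0 <= Dy2.
  have B0 : 0 <= B by exact: le_trans B1.
  have L4 : 0 <= 4 * L ^+ 2 by rewrite mulr_ge0// sqr_ge0.
  apply: addr_ge0; first exact: mulr_ge0 (mulr_ge0 L4 B0) M0.
  by rewrite mulr_ge0// sqnorm_ge0.
have H1_1 : 1 <= H1 by exact: H1_ge1 hmu L0 al0 (ltW s0) s2 am.
have H3_0 : 0 <= H3.
  have B0 : 0 <= B by exact: le_trans B1.
  have M1 : 0 <= M + sqnorm xstars by rewrite addr_ge0 ?sqnorm_ge0.
  by rewrite mulr_ge0// mulr_ge0// mulr_ge0 ?sqr_ge0// divr_ge0// ltW.
have t1 : 0 <= 4 * Dy2 * alpha / (1 - gamma) ^+ 2.
  by rewrite divr_ge0 ?(ltW g2)// mulr_ge0 ?(ltW al0)// mulr_ge0.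
have t2 : 0 <= 4 * sigma ^+ 2 * N%:R * alpha / (1 - gamma) ^+ 2.
  by have := divr_ge0 (mulr_ge0 sN (ltW al0)) (ltW g2); lra.
have t3 : c0 <= c0 / (1 - gamma) ^+ 2.
  by rewrite ler_pdivlMr// -[leRHS]mulr1 ler_wpM2l// ltW.
(* Only the summand of H_2 containing C_0 is kept, with B >= 1 and (1 - gamma)^2 <= 1. *)
have H2_ge : 16 * L ^+ 2 / N%:R * c0 <= H2.
  have p0 : 0 <= 2 / N%:R * L ^+ 2 by rewrite mulr_ge0 ?sqr_ge0// divr_ge0// ltW.
  have sum_ge : 8 * c0 <= 4 * Dy2 * alpha / (1 - gamma) ^+ 2
      + 4 * sigma ^+ 2 * N%:R * alpha / (1 - gamma) ^+ 2 + 8 * c0 / (1 - gamma) ^+ 2.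
    rewrite -(mulrA 8 c0); move: t1 t2 t3; lra.
  have sum0 : 0 <= 8 * c0 by rewrite mulr_ge0// ltW.
  rewrite /H2 -(mulrA _ B); have := ler_pM (@ler01 R) sum0 B1 sum_ge.
  rewrite mul1r => /(ler_wpM2l p0); apply: le_trans; rewrite le_eqVlt.
  by apply/orP; left; apply/eqP; field; rewrite gt_eqF.
have H1H2 : C * alpha <= 2 / mu ^+ 2 * alpha * H1 * H2.
  have p0 : 0 <= 2 / mu ^+ 2 * alpha.
    by rewrite mulr_ge0 ?(ltW al0)// divr_ge0 ?sqr_ge0.
  have q0 : 0 <= 16 * L ^+ 2 / N%:R by rewrite divr_ge0 ?mulr_ge0 ?sqr_ge0// ltW.
  have q1 := mulr_ge0 q0 (ltW c0_gt0).
  rewrite -(mulrA _ H1); have := ler_pM (@ler01 R) q1 H1_1 H2_ge.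
  rewrite mul1r => /(ler_wpM2l p0); apply: le_trans.
  apply: le_trans (ler_wpM2l p0 (ler_wpM2l q0 CNc0)); rewrite le_eqVlt.
  by apply/orP; left; apply/eqP; field; rewrite !gt_eqF.
set noise := 2 * sigma ^+ 2 * Num.sqrt alpha / (mu * Num.sqrt mu * N%:R).
have noise0 : 0 <= noise.
  apply: divr_ge0; first exact: mulr_ge0 sig0 (sqrtr_ge0 _).
  exact: mulr_ge0 (mulr_ge0 (ltW hmu) (sqrtr_ge0 _)) (ltW NR0).
(* The recursion gives the noise term without the factor 1 + s / 2; the statement allows it as
   slack. *)
have noise_le : noise * (1 + alpha * L) <= noise * (1 + s / 2) * (1 + alpha * L).
  rewrite ler_wpM2r//; first by rewrite addr_ge0// mulr_ge0// ltW.
  by rewrite -[leLHS]mulr1 ler_wpM2l// lerDl divr_ge0// ltW.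
set geo := geom_quotient _ _ _.
have geo0 : 0 <= geo.
  apply: geom_quotient_ge0; first exact: sqr_ge0.
  by move: s1; lra.
have gam_sqr := exprn_ge0 2 (ltW gam0).
have trans0 : 0 <= 8 / (gamma ^+ 2 * mu * Num.sqrt mu) * Num.sqrt alpha * H1 * H3 * geo.
  have H10 : 0 <= H1 by exact: le_trans H1_1.
  do 4 (rewrite mulr_ge0 ?sqrtr_ge0//).
  by rewrite divr_ge0// mulr_ge0 ?sqrtr_ge0// mulr_ge0// ltW.
have L2_avg : L2mx P (fun omega => node_avg (x k omega)).
  move=> i j; rewrite (ord1 i); under eq_fun do rewrite node_avgE.
  by apply: L2Z; apply: (@L2_sum _ _ _ _ _ (fun i omega => x k omega i j)).
have i1 : L1 P (fun omega => sqnorm (node_avg (x k omega) - xstar)).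
  by apply: L1_sqnorm; apply: L2mxB => //; exact: L2mx_cst.
rewrite -VSbarE -/noise in havg.
split=> [|i].
  rewrite (expectationE i1) lee_fin; apply: le_trans havg _.
  by move: H1H2 noise_le trans0; lra.
have i2 : L1 P (fun omega => sqnorm (disagreement (x k omega))).
  apply: L1_sqnorm; apply: L2mxB => // i' j.
  by under eq_fun do rewrite mxE; exact: L2_avg.
have i3 : L1 P (fun omega => sqnorm (row i (x k omega) - xstar)).
  by apply: L1_sqnorm; apply: L2mxB; [exact: L2mx_row|exact: L2mx_cst].
rewrite (expectationE i3) lee_fin.
(* x_i - x_* is the error of the mean plus row i of the disagreement. Doubling the first bound
   accounts for the doubled constants of the second, and the disagreement is charged to 16 C_0 alpha
   / (1 - gamma)^2. *)
apply: (@le_trans _ _ (2 * Ex P (fun omega => sqnorm (node_avg (x k omega) - xstar))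
    + 2 * Ex P (fun omega => sqnorm (disagreement (x k omega))))).
  rewrite -(ExZ 2 i1) -(ExZ 2 i2) -(ExD (L1Z 2 i1) (L1Z 2 i2)).
  apply: le_Ex => // [|omega]; first exact: L1D (L1Z 2 i1) (L1Z 2 i2).
  have -> : row i (x k omega) - xstar =
      (node_avg (x k omega) - xstar) + row i (disagreement (x k omega)).
    by rewrite /disagreement raddfB /= row_replicate [RHS]addrC addrA subrK.
  apply: le_trans (sqnormD_le _ _) _; rewrite lerD2l ler_pM2l//.
  exact: sqnorm_row_le.
have e1 : 0 <= 16 * gamma ^+ (2 * k) * (M + sqnorm xstars).
  apply: mulr_ge0 (addr_ge0 M0 (sqnorm_ge0 _)).
  exact: mulr_ge0 (ler0n R 16) (exprn_ge0 _ (ltW gam0)).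
have e2 : 0 <= 8 * Dy2 * alpha ^+ 2 / (1 - gamma) ^+ 2.
  by rewrite divr_ge0 ?(ltW g2)// mulr_ge0 ?sqr_ge0// mulr_ge0.
have e3 : 0 <= 8 * sigma ^+ 2 * N%:R * alpha ^+ 2 / (1 - gamma) ^+ 2.
  by have := divr_ge0 (mulr_ge0 sN (sqr_ge0 alpha)) (ltW g2); lra.
have e4 : 2 * (C * alpha) <= 16 * c0 * alpha / (1 - gamma) ^+ 2.
  have -> : 16 * c0 * alpha / (1 - gamma) ^+ 2 = 16 * alpha * (c0 / (1 - gamma) ^+ 2).
    by ring.
  have p0 : 0 <= 16 * alpha by rewrite mulr_ge0// ltW.
  have := ler_wpM2l p0 (le_trans Cc0 t3); apply: le_trans.
  by have := mulr_ge0 C_ge0 (ltW al0); lra.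
have doubled : 4 * sigma ^+ 2 * Num.sqrt alpha / (mu * Num.sqrt mu * N%:R) = 2 * noise.
  by rewrite /noise; ring.
have doubled2 : 16 / (gamma ^+ 2 * mu * Num.sqrt mu) * Num.sqrt alpha * H1 * H3 * geo =
  2 * (8 / (gamma ^+ 2 * mu * Num.sqrt mu) * Num.sqrt alpha * H1 * H3 * geo) by ring.
have doubled3 : 4 / mu ^+ 2 * alpha * H1 * H2 = 2 * (2 / mu ^+ 2 * alpha * H1 * H2) by ring.
have doubled4 : (1 - s / 2) ^+ k * (4 * VSbar / mu) = 2 * ((1 - s / 2) ^+ k * (2 * VSbar / mu)).
  by ring.
rewrite doubled doubled2 doubled3 doubled4 -(mulrA 2 noise) -(mulrA 2 (noise * _)).
move: havg hdis H1H2 noise_le trans0 e1 e2 e3 e4.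
have comb (X Y A Ca n1 n2 hh tr q1 q2 q3 q4 : R) :
    X <= A + Ca + n1 -> Y <= Ca -> Ca <= hh -> n1 <= n2 -> 0 <= tr ->
    0 <= q1 -> 0 <= q2 -> 0 <= q3 -> 2 * Ca <= q4 ->
    2 * X + 2 * Y <= 2 * A + 2 * tr + 2 * hh + q1 + q2 + q3 + q4 + 2 * n2 by lra.
exact: comb.
Qed.
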